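(* Let $C_{-}$ denote the path from $ - \delta - i\infty$ up to $- \delta + i\infty $ and $C_{+}$ the path from $ \delta - i\infty$ up to $ \delta + i\infty$, where $\delta$ is a small positive number. Let $f$ be a holomorphic function of $n$ variables such that $f(x_{1}, \cdots, x_{n}) = f(\pm x_{1}, \cdots, \pm x_{n})$. Then \begin{align*} 2^n (2 \pi i )^n S_n^E(f)= \sum_{K \cup L \cup M = \{1, \cdots,n\}} \int_{C_+^K} \int_{C_{-}^{L \cup M}}(-1)^{|M|}J_E(z_K \cup - z_L, z_M) f(iz_1, \cdots,iz_n)\,dz_1 \cdots d z_n, \end{align*} where the sum is over disjoint $K,L,M$ with union $\{1,\dots,n\}$, $z_K = \{z_k: k \in K\}$, $-z_L = \{-z_l: l \in L\}$, the variables in $z_K$ are integrated along $C_+$ and all others along $C_-$, \begin{align*} S_n^{E}(f) = \sum_{\substack{0 < d \leq X \\ \chi_d(-M)\omega_E = +1}}\ \sum_{t_1, \cdots, t_n >0}f(\gamma_{t_1,d}, \cdots, \gamma_{t_n,d}), \end{align*} and \begin{align*} J_E(A,B) = \sum_{\substack{0 < d \leq X \\ \chi_d(-M)\omega_E = +1}}\prod_{\alpha \in A}\frac{L_E^{'}}{L_E}(\tfrac{1}{2}+\alpha, \chi_d)\prod_{\beta \in B}\frac{\psi^{'}}{\psi}(\tfrac{1}{2}+\beta, \chi_d) \end{align*} with $\psi(s, \chi_d)=\chi_d(-M) \omega_E \left(\frac{2 \pi}{\sqrt{M}|d|}\right)^{2s-1} \frac{\Gamma(\frac{3}{2}-s)}{\Gamma(s+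 \frac{1}{2})}$.
   Context: $E/\mathbb{Q}$ is an elliptic curve with prime conductor $M$, normalized $L$-function $L_E(s)$ (critical line $\Re s=\frac12$) and root number $\omega_E$; $L_E(s,\chi_d)$ is its quadratic twist by the Kronecker symbol $\chi_d$, satisfying $L_E(s,\chi_d)=\psi(s,\chi_d)L_E(1-s,\chi_d)$. Sums over $0<d\le X$ run over fundamental discriminants. $\gamma_{t,d}$ is the height of the $t$-th zero of $L_E(s,\chi_d)$ on the critical line above the real axis (the Riemann Hypothesis for these $L$-functions is assumed). The sum in $S_n^E$ is not restricted to distinct indices.
   Formalization: f is also assumed to satisfy |f(x)| ≤ K∏(1+|Re x_j|)^(-1-ε) on a polystrip wider than δ<1/2, so that sums and integrals converge; and half of any zeros at s=1/2 are counted among the γ_{t,d} as height 0, since with only γ>0 the identity fails when L_E(1/2,χ_d)=0. *)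

(* Defs.v *)
From Stdlib Require Export Reals ZArith.
From mathcomp Require Export all_boot.
From Coquelicot Require Export Coquelicot.

(* all_boot rebinds the key %R to ring_scope. *)
Delimit Scope R_scope with R.
Open Scope nat_scope.
Open Scope R_scope.

Set Implicit Arguments.
Unset Strict Implicit.
Unset Printing Implicit Defensive.

(** * Complex analysis on Coquelicot's [C] *)

Definition Cexp (z : C) : C :=
  (exp (Re z) * cos (Im z), exp (Re z) * sin (Im z))%R.

(* x ^ z for a positive real x, with the real logarithm of x. *)
Definition Rcpow (x : R) (z : C) : C := Cexp (z * RtoC (ln x))%C.

Definition Clim_seq (u : nat -> C) : C :=
  (real (Lim_seq (fun k => Re (u k))), real (Lim_seq (fun k => Im (u k)))).

(* Gauss' limit k! k^s / (s (s+1) ... (s+k)), which represents the Gamma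
   function on the whole plane minus its poles 0, -1, -2, ...  The value at
   a pole carries no meaning. *)
Definition CGamma (s : C) : C :=
  Clim_seq (fun k : nat =>
    RtoC (INR k`!) * Rcpow (INR k) s /
      \big[Cmult/RtoC 1]_(0 <= j < k.+1) (s + RtoC (INR j)))%C.

Definition entire (F : C -> C) : Prop :=
  forall s : C, ex_derive (K := C_AbsRing) (V := C_NormedModule) F s.

Definition logderiv (F : C -> C) (s : C) : C := (C_derive F s / F s)%C.

Definition zero_order (F : C -> C) (s : C) (k : nat) : Prop :=
  exists G : C -> C,
    G s <> RtoC 0 /\
    locally s (fun w : C =>
      ex_derive (K := C_AbsRing) (V := C_NormedModule) G w /\
      F w = ((w - s) ^ k * G w)%C).

(* The integral of g over the vertical line Re z = c, oriented upwards. *)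
Definition line_integral (c : R) (g : C -> C) : C :=
  (Ci * RInt_gen (V := C_R_CompleteNormedModule) (fun y : R => g (c, y))
          (Rbar_locally m_infty) (Rbar_locally p_infty))%C.

(** * Functions of n complex variables *)

Definition vcons (n : nat) (z0 : C) (z : 'I_n -> C) : 'I_n.+1 -> C :=
  fun i => if unlift ord0 i is Some j then z j else z0.

(* The iterated integral of g in which the j-th variable runs upwards along
   the line Re z = c j. *)
Fixpoint iterated_line_integral (n : nat) :
    ('I_n -> R) -> (('I_n -> C) -> C) -> C :=
  match n with
  | 0 => fun _ g => g (fun=> RtoC 0)
  | m.+1 => fun c g =>
      line_integral (c ord0) (fun z0 : C =>
        iterated_line_integral (fun j : 'I_m => c (lift ord0 j))
          (fun z => g (vcons z0 z)))
  end.

(* Complex (Frechet) differentiability, with gradient g. *)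
Definition holomorphic_at (n : nat) (f : ('I_n -> C) -> C) (x : 'I_n -> C) :
    Prop :=
  exists g : 'I_n -> C, forall eps : R, (0 < eps)%R ->
  exists r : R, (0 < r)%R /\
  forall h : 'I_n -> C, (forall j, (Cmod (h j) < r)%R) ->
    (Cmod (f (fun j => x j + h j)%C - f x
             - \big[Cplus/RtoC 0]_(j < n) (g j * h j))%C
     <= eps * \big[Rplus/0%R]_(j < n) Cmod (h j))%R.

Definition in_strip (n : nat) (eta : R) (x : 'I_n -> C) : Prop :=
  forall j, (Rabs (Im (x j)) < eta)%R.

Definition even_in_each_variable (n : nat) (eta : R) (f : ('I_n -> C) -> C) :
    Prop :=
  forall (e : 'I_n -> bool) (x : 'I_n -> C), in_strip eta x ->
    f (fun j => if e j then (- x j)%C else x j) = f x.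

(* The decay which makes the zero sums and the integrals over the infinite
   lines converge absolutely: the logarithmic derivatives and the density of
   the zeros grow only logarithmically. *)
Definition integrable_decay (n : nat) (eta : R) (f : ('I_n -> C) -> C) : Prop :=
  exists K eps : R, (0 < eps)%R /\
  forall x : 'I_n -> C, in_strip eta x ->
    (Cmod (f x) <=
     K * \big[Rmult/1%R]_(j < n)
           Rpower (1 + Rabs (Re (x j))) (- (1 + eps)))%R.

(** * Kronecker symbol and fundamental discriminants *)

Definition kronecker_prime (a : Z) (p : nat) : Z :=
  if p == 2%N then
    if Z.even a then 0%Z
    else if ((a mod 8 =? 1) || (a mod 8 =? 7))%Z then 1%Z else (-1)%Z
  else if (a mod Z.of_nat p =? 0)%Z then 0%Z
  else if [exists x : 'I_p,
             ((Z.of_nat x * Z.of_nat x - a) mod Z.of_nat p =? 0)%Z]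
  then 1%Z else (-1)%Z.

(* chi_a(m) = (a / m) *)
Definition kronecker (a m : Z) : Z :=
  if (m =? 0)%Z then (if (Z.abs a =? 1)%Z then 1%Z else 0%Z)
  else ((if ((m <? 0) && (a <? 0))%Z then -1 else 1) *
        \big[Z.mul/1]_(pe <- prime_decomp (Z.abs_nat m))
           (kronecker_prime a pe.1 ^ Z.of_nat pe.2))%Z.

Definition squarefree (m : nat) : bool :=
  (0 < m)%N && all (fun pe => pe.2 == 1%N) (prime_decomp m).

(* 1 is included as the discriminant of Q. *)
Definition fundamental_discriminant (d : Z) : bool :=
  ((d mod 4 =? 1)%Z && squarefree (Z.abs_nat d)) ||
  (((d mod 16 =? 8)%Z || (d mod 16 =? 12)%Z) &&
   squarefree (Z.abs_nat (d / 4)%Z)).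

(** * Elliptic curves of prime conductor and their twisted L-functions *)

(* y^2 + a1 x y + a3 y = x^3 + a2 x^2 + a4 x + a6; every elliptic curve over
   Q has a global minimal equation of this form. *)
Record weierstrass := Weierstrass {
  wa1 : Z; wa2 : Z; wa3 : Z; wa4 : Z; wa6 : Z }.

Section Weierstrass.
Variable E : weierstrass.
Local Open Scope Z_scope.

Local Notation a1 := (wa1 E).
Local Notation a2 := (wa2 E).
Local Notation a3 := (wa3 E).
Local Notation a4 := (wa4 E).
Local Notation a6 := (wa6 E).

Definition wb2 : Z := a1 ^ 2 + 4 * a2.
Definition wb4 : Z := 2 * a4 + a1 * a3.
Definition wb6 : Z := a3 ^ 2 + 4 * a6.
Definition wb8 : Z :=
  a1 ^ 2 * a6 + 4 * a2 * a6 - a1 * a3 * a4 + a2 * a3 ^ 2 - a4 ^ 2.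
Definition wc4 : Z := wb2 ^ 2 - 24 * wb4.
Definition wdisc : Z :=
  - wb2 ^ 2 * wb8 - 8 * wb4 ^ 3 - 27 * wb6 ^ 2 + 9 * wb2 * wb4 * wb6.

Definition good_reduction (p : nat) : Prop := ~ (Z.of_nat p | wdisc).

Definition multiplicative_reduction (p : nat) : Prop :=
  (Z.of_nat p | wdisc) /\ ~ (Z.of_nat p | wc4).

(* The conductor exponent at p is 0 for good, 1 for multiplicative and at
   least 2 for additive reduction.  An equation satisfying these conditions
   is minimal at every prime, and wdisc <> 0 is implied. *)
Definition has_prime_conductor (N : nat) : Prop :=
  prime N /\ multiplicative_reduction N /\
  forall p : nat, prime p -> p <> N -> good_reduction p.

Definition on_curve_mod (p x y : nat) : bool :=
  let x := Z.of_nat x in let y := Z.of_nat y in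
  (y ^ 2 + a1 * x * y + a3 * y - (x ^ 3 + a2 * x ^ 2 + a4 * x + a6))
    mod Z.of_nat p =? 0.

Definition affine_points (p : nat) : nat :=
  #|[set xy : 'I_p * 'I_p | on_curve_mod p xy.1 xy.2]|.

(* This is p + 1 - #E(F_p) at a good prime, and 1 or -1 at a prime of split
   or nonsplit multiplicative reduction (the count then includes the node). *)
Definition frobenius_trace (p : nat) : Z :=
  Z.of_nat p - Z.of_nat (affine_points p).

End Weierstrass.

(* The inverse Euler factor at p of L_E(s, chi_d), normalized by
   lambda(p) = a_p / sqrt p. *)
Definition euler_poly (E : weierstrass) (N d p : nat) (s : C) : C :=
  let chi := RtoC (IZR (kronecker (Z.of_nat d) (Z.of_nat p))) in
  let lambda := RtoC (IZR (frobenius_trace E p) / sqrt (INR p))%R in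
  let u := Rcpow (INR p) (- s)%C in
  (1 - lambda * chi * u + (if p == N then RtoC 0 else chi ^ 2 * u ^ 2))%C.

Definition psi (N : nat) (omega : Z) (d : nat) (s : C) : C :=
  (RtoC (IZR (kronecker (Z.of_nat d) (- Z.of_nat N) * omega)) *
   Rcpow (2 * PI / (sqrt (INR N) * INR d))%R (2 * s - 1) *
   (CGamma (3 / 2 - s) / CGamma (s + 1 / 2)))%C.

(* L is L_E(s, chi_d): the entire continuation of the Euler product, with
   its functional equation (tested away from the poles of the two Gamma
   factors, where psi has no meaningful value) and polynomial growth in
   vertical strips.  By modularity such an L exists, and it is unique, for d
   fundamental and prime to N. *)
Record is_twisted_L (E : weierstrass) (N : nat) (omega : Z) (d : nat)
    (L : C -> C) : Prop := IsTwistedL {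
  twisted_L_entire : entire L;
  twisted_L_euler : forall s : C, (1 < Re s)%R ->
    filterlim (fun k : nat =>
        \big[Cmult/RtoC 1]_(0 <= p < k | prime p) (/ euler_poly E N d p s)%C)
      eventually (locally (L s));
  twisted_L_functional_equation : forall s : C,
    (forall k : nat, s <> RtoC (3 / 2 + INR k)%R) ->
    (forall k : nat, s <> RtoC (- (1 / 2) - INR k)%R) ->
    L s = (psi N omega d s * L (1 - s))%C;
  twisted_L_growth : forall a b : R, exists (K : R) (A : nat),
    forall s : C, (a <= Re s <= b)%R ->
      (Cmod (L s) <= K * (1 + Rabs (Im s)) ^ A)%R }.

Definition riemann_hypothesis (L : C -> C) : Prop :=
  forall s : C, (0 < Re s < 1)%R -> L s = RtoC 0 -> Re s = (1 / 2)%R.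

(* g t is the height of the (t+1)-st zero of L on the critical line, with
   multiplicity.  A zero at the central point has even order when the
   functional equation is even; the zeros are listed up to s |-> 1 - s, so
   that half of the central zeros appear, as the height 0. *)
Record zero_heights (L : C -> C) (g : nat -> R) : Prop := ZeroHeights {
  heights_ge0 : forall t, (0 <= g t)%R;
  heights_sorted : forall t u, (t <= u)%N -> (g t <= g u)%R;
  heights_mult : forall y : R, (0 <= y)%R ->
    exists l : seq nat,
      uniq l /\ (forall t, t \in l <-> g t = y) /\
      ((0 < y)%R -> zero_order L ((1 / 2)%R, y) (size l)) /\
      (y = 0%R -> zero_order L ((1 / 2)%R, y) (2 * size l)%N) }.

(** * The family of even twists, n-level sums and J_E *)

Definition even_twist (N : nat) (omega : Z) (d : nat) : bool :=
  fundamental_discriminant (Z.of_nat d) &&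
  (kronecker (Z.of_nat d) (- Z.of_nat N) * omega =? 1)%Z.

(* The sum of F d over the even twists with 0 < d <= X. *)
Definition sum_family (N : nat) (omega : Z) (X : R) (F : nat -> C) : C :=
  \big[Cplus/RtoC 0]_(1 <= d < Z.to_nat (up X) | even_twist N omega d) F d.

(* The sum over t_1, ..., t_n is the limit of the sums over t_j < T. *)
Definition S_E (N : nat) (omega : Z) (X : R) (gamma : nat -> nat -> R)
    (n : nat) (f : ('I_n -> C) -> C) : C :=
  sum_family N omega X (fun d =>
    Clim_seq (fun T : nat =>
      \big[Cplus/RtoC 0]_(t : {ffun 'I_n -> 'I_T})
         f (fun j => RtoC (gamma d (t j))))).

Definition J_E (N : nat) (omega : Z) (X : R) (L : nat -> C -> C)
    (A B : seq C) : C :=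
  sum_family N omega X (fun d =>
    \big[Cmult/RtoC 1]_(alpha <- A) logderiv (L d) (1 / 2 + alpha) *
    \big[Cmult/RtoC 1]_(beta <- B) logderiv (psi N omega d) (1 / 2 + beta))%C.

(* Main.v *)
Require Import Defs.
From Stdlib Require Import Lra Lia Classical ClassicalEpsilon FunctionalExtensionality.
From HB Require Import structures.

(** On the line Re z = -delta the functional equation gives
    psi'/psi(1/2 + z) = L'/L(1/2 + z) + L'/L(1/2 - z), so for fixed d and one
    variable the K, L and M terms add up to the difference of the integrals of
    L'/L(1/2 + z) f(iz) over the two lines, which by the residue theorem is
    2 pi i times the sum of f over all the zeros, that is 4 pi i times the sum
    over the listed heights.  The case of n variables follows by induction,
    integrating over the first variable last: the inner integrals are
    replaced by finite sums over zeros, with an error controlled uniformly by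
    the decay of f.

    The estimates for L'/L come from L alone.  The Euler product bounds L below
    on Re s = 5 (the trivial bound |a_p| <= p^2 suffices), the maximum principle
    then bounds the number of zeros in a disc, and dividing these zeros out
    leaves a zero-free G with G'/G = O(log): if |G| <= exp A on the disc of
    radius r about s, then r |G'/G (s)| <= 2 (A - ln |G s|), a differential
    inequality for A - ln |G| along horizontal segments.  Nothing is needed
    about the Gamma function beyond its commuting with conjugation, which makes
    |L| symmetric on the critical line. *)

Set Implicit Arguments.
Unset Strict Implicit.
Unset Printing Implicit Defensive.

(** Logarithms are majorized by small powers [weight a], with [a = eps / 2] on the two lines:
    against a decay of order [1 + eps] this leaves a decay of order [1 + eps / 2], so that every
    integral converges absolutely. Zeros are carried as lists with repetition: [F = lprod l * G]
    with [G] entire. The residue theorem then reduces to one explicit integral of [1 / (s - p)] and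
    to Cauchy's theorem for [G' / G], and the same list is matched with the listed heights by
    counting multiplicities. In several variables the sum over the heights is a limit over cubes of
    indices, not an iterated limit; the truncation [T] is therefore the same in all variables
    throughout the induction, and only the final error [box_error n T] is sent to 0. Uniformity
    comes from the constant [K] in the bound for [f]: fixing one variable multiplies [K] by the
    weight of that variable, every error term is linear in [K], and this weight makes the errors
    integrable in the outer variable. *)

(** * Complex derivatives *)

Definition cder (F : C -> C) (z l : C) : Prop :=
  is_derive (K := C_AbsRing) (V := C_NormedModule) F z l.

Lemma cderP (F : C -> C) (z l : C) :
  cder F z l <->
  forall eps : R, 0 < eps -> exists d : R, 0 < d /\ forall w : C,
    Cmod (w - z) < d ->
    Cmod (F w - F z - l * (w - z))%C <= eps * Cmod (w - z).
Proof.
split.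
- move=> [_ H] eps he.
  have [d Hd] := H z (fun P HP => HP) (mkposreal _ he).
  exists d; split; first exact: cond_pos.
  move=> w hw; have := Hd w hw.
  rewrite (_ : (F w - F z - l * (w - z))%C = (F w - F z - (w - z) * l)%C) //.
  by congr Cminus; rewrite Cmult_comm.
- move=> H; split; first exact: is_linear_scal_l.
  move=> x Hx.
  have -> : x = z.
    by apply: (is_filter_lim_unique _ _ Hx (fun P HP => HP)).
  move=> eps; have [d [d0 Hd]] := H eps (cond_pos eps).
  exists (mkposreal _ d0) => w hw; have := Hd w hw.
  rewrite (_ : (F w - F z - l * (w - z))%C = (F w - F z - (w - z) * l)%C) //.
  by congr Cminus; rewrite Cmult_comm.
Qed.

(** [C_NormedModule] and [C_AbsRing] acting on itself are two module structures on [C]; the product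
    and chain rules go through the second. The limit statements coincide, so only the linearity
    component of the derivative is rebuilt. *)
Lemma cder_abs_ring (F : C -> C) (z l : C) :
  cder F z l <-> is_derive (K := C_AbsRing) (V := AbsRing_NormedModule C_AbsRing) F z l.
Proof.
split=> [[h1 h2]|[h1 h2]].
- split; first exact: (is_linear_scal_l (V := AbsRing_NormedModule C_AbsRing)).
  by move=> x hx; apply: h2.
- split; first exact: (is_linear_scal_l (V := C_NormedModule)).
  by move=> x hx; apply: h2.
Qed.

Lemma Cmod_le_abs (z : C) : Cmod z <= Rabs (Re z) + Rabs (Im z).
Proof.
case: z => x y; rewrite /Cmod /=.
apply: Rsqr_incr_0_var.
- rewrite Rsqr_sqrt; last by nra.
  have := Rabs_pos x; have := Rabs_pos y.
  have := Rsqr_abs x; have := Rsqr_abs y; rewrite /Rsqr; nra.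
- have := Rabs_pos x; have := Rabs_pos y; lra.
Qed.

Lemma im_le_Cmod (z : C) : Rabs (Im z) <= Cmod z.
Proof. by apply: Rle_trans (Rmax_r _ _) (Rmax_Cmod z). Qed.

Lemma Cmod_sub_sym (a b : C) : Cmod (a - b) = Cmod (b - a).
Proof. by rewrite -(Cmod_opp (b - a)); congr Cmod; ring. Qed.

Lemma Cmod_triangle_inv (a b : C) : Cmod a - Cmod b <= Cmod (a - b).
Proof.
have := Cmod_triangle (a - b) b.
rewrite (_ : (a - b + b = a)%C); [lra | ring].
Qed.

Lemma C_ext (a b : C) : Re a = Re b -> Im a = Im b -> a = b.
Proof. by case: a b => ? ? [? ?] /= -> ->. Qed.

Lemma cder_ext (F G : C -> C) (z l : C) :
  (exists r : R, 0 < r /\ forall w, Cmod (w - z) < r -> F w = G w) ->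
  cder F z l -> cder G z l.
Proof.
move=> [r [r0 E]] /cderP H; apply/cderP => eps he.
have [d [d0 Hd]] := H eps he.
exists (Rmin d r); split; first exact: Rmin_glb_lt.
move=> w hw.
have h1 : Cmod (w - z) < d by apply: Rlt_le_trans hw (Rmin_l _ _).
have h2 : Cmod (w - z) < r by apply: Rlt_le_trans hw (Rmin_r _ _).
rewrite -(E w h2) -(E z); first exact: Hd.
by rewrite (_ : (z - z = 0)%C) ?Cmod_0 //; ring.
Qed.

Lemma cder_eq (F : C -> C) (z l l' : C) : cder F z l -> l = l' -> cder F z l'.
Proof. by move=> H <-. Qed.

Lemma cder_const (c z : C) : cder (fun=> c) z 0.
Proof. exact: is_derive_const. Qed.

Lemma cder_id (z : C) : cder (fun w => w) z 1.
Proof.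
apply/cderP => eps he; exists 1; split; first exact: Rlt_0_1.
move=> w _; rewrite (_ : (w - z - 1 * (w - z))%C = 0) ?Cmod_0; last by ring.
by have := Cmod_ge_0 (w - z); nra.
Qed.

Lemma cder_plus (F G : C -> C) (z l m : C) :
  cder F z l -> cder G z m -> cder (fun w => F w + G w)%C z (l + m)%C.
Proof. exact: is_derive_plus. Qed.

Lemma cder_opp (F : C -> C) (z l : C) :
  cder F z l -> cder (fun w => - F w)%C z (- l)%C.
Proof. exact: is_derive_opp. Qed.

Lemma cder_minus (F G : C -> C) (z l m : C) :
  cder F z l -> cder G z m -> cder (fun w => F w - G w)%C z (l - m)%C.
Proof. exact: is_derive_minus. Qed.

Lemma cder_mult (F G : C -> C) (z l m : C) :
  cder F z l -> cder G z m ->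
  cder (fun w => F w * G w)%C z (l * G z + F z * m)%C.
Proof.
move=> /cder_abs_ring hF /cder_abs_ring hG; apply/cder_abs_ring.
by apply: (is_derive_mult (K := C_AbsRing) F G z l m) => // a b; apply: Cmult_comm.
Qed.

Lemma cder_comp (F G : C -> C) (z l m : C) :
  cder F (G z) l -> cder G z m -> cder (fun w => F (G w)) z (m * l)%C.
Proof.
move=> hF /cder_abs_ring hG.
exact: (is_derive_comp (K := C_AbsRing) (V := C_NormedModule) F G z l m).
Qed.

Lemma cder_scal (c : C) (F : C -> C) (z l : C) :
  cder F z l -> cder (fun w => c * F w)%C z (c * l)%C.
Proof.
move=> h; apply: cder_eq (cder_mult (cder_const c z) h) _; ring.
Qed.

Lemma cder_cont_eps (F : C -> C) (z l : C) : cder F z l ->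
  forall eps, 0 < eps -> exists d, 0 < d /\ forall w,
    Cmod (w - z) < d -> Cmod (F w - F z) < eps.
Proof.
move=> /cderP H eps he.
have [d [d0 Hd]] := H 1 Rlt_0_1.
have hl := Cmod_ge_0 l.
have h3 : 0 < eps / (2 + Cmod l) by apply: Rdiv_lt_0_compat; lra.
exists (Rmin d (eps / (2 + Cmod l))); split; first exact: Rmin_glb_lt.
move=> w hw.
have h1 : Cmod (w - z) < d by apply: Rlt_le_trans hw (Rmin_l _ _).
have h2 : Cmod (w - z) < eps / (2 + Cmod l) by apply: Rlt_le_trans hw (Rmin_r _ _).
have := Hd w h1.
have := Cmod_triangle_inv (F w - F z) (l * (w - z)); rewrite Cmod_mult.
have h4 : Cmod (w - z) * (2 + Cmod l) < eps.
  apply: Rlt_le_trans (Rmult_lt_compat_r _ _ _ _ h2) _; first lra.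
  by right; field; lra.
have := Cmod_ge_0 (w - z); nra.
Qed.

Lemma cder_inv_id (z : C) : z <> 0 -> cder (fun w => / w)%C z (- / (z * z))%C.
Proof.
move=> hz; apply/cderP => eps he.
have z0 : 0 < Cmod z by apply/Cmod_gt_0.
(* [c] is a lower bound for [|w| |z|^2], the denominator of the remainder, once
   [|w - z| < |z| / 2]. *)
pose c := (Cmod z * Cmod z * Cmod z / 2)%R.
have zz : 0 < Cmod z * Cmod z by apply: Rmult_lt_0_compat.
have zzz : 0 < Cmod z * Cmod z * Cmod z by apply: Rmult_lt_0_compat.
have c0 : 0 < c by rewrite /c; lra.
exists (Rmin (Cmod z / 2) (eps * c)); split.
  by apply: Rmin_glb_lt; nra.
move=> w hw.
have h1 : Cmod (w - z) < Cmod z / 2 by apply: Rlt_le_trans hw (Rmin_l _ _).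
have h2 : Cmod (w - z) < eps * c by apply: Rlt_le_trans hw (Rmin_r _ _).
have w2 : Cmod z / 2 < Cmod w.
  by have := Cmod_triangle_inv z w; rewrite Cmod_sub_sym; lra.
have w0 : w <> 0 by apply/Cmod_gt_0; lra.
rewrite (_ : (/ w - / z - - / (z * z) * (w - z))%C =
   ((w - z) * ((w - z) / (w * z * z)))%C); last by field.
rewrite Cmod_mult Rmult_comm; apply: Rmult_le_compat_r; first exact: Cmod_ge_0.
rewrite Cmod_div; last by do 2?apply: Cmult_neq_0.
rewrite !Cmod_mult; apply/Rle_div_l; first nra.
have : c <= Cmod w * Cmod z * Cmod z.
  have -> : c = (Cmod z / 2 * (Cmod z * Cmod z))%R by rewrite /c; field.
  by rewrite Rmult_assoc; apply: Rmult_le_compat_r; lra.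
nra.
Qed.

Lemma cder_inv (F : C -> C) (z l : C) : F z <> 0 -> cder F z l ->
  cder (fun w => / F w)%C z (- l / (F z * F z))%C.
Proof.
move=> hz h.
have h2 := cder_comp (cder_inv_id hz) h.
by apply: (cder_eq h2); field.
Qed.

Lemma cder_div (F G : C -> C) (z l m : C) : G z <> 0 ->
  cder F z l -> cder G z m ->
  cder (fun w => F w / G w)%C z (l / G z - F z * m / (G z * G z))%C.
Proof.
move=> h0 hF hG; apply: cder_eq (cder_mult hF (cder_inv h0 hG)) _.
by field.
Qed.

Definition hol (F : C -> C) (z : C) : Prop := exists l, cder F z l.

Lemma holE (F : C -> C) (z : C) :
  hol F z <-> ex_derive (K := C_AbsRing) (V := C_NormedModule) F z.
Proof. by []. Qed.

Lemma hol_der (F : C -> C) (z : C) : hol F z -> cder F z (C_derive F z).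
Proof. by move=> [l h]; rewrite (is_C_derive_unique _ _ _ h). Qed.

Lemma hol_ext (F G : C -> C) (z : C) :
  (exists r : R, 0 < r /\ forall w, Cmod (w - z) < r -> F w = G w) ->
  hol F z -> hol G z.
Proof. by move=> E [l h]; exists l; apply: cder_ext E h. Qed.

Lemma hol_const (c z : C) : hol (fun=> c) z.
Proof. by eexists; apply: cder_const. Qed.
Lemma hol_id (z : C) : hol (fun w => w) z.
Proof. by eexists; apply: cder_id. Qed.
Lemma hol_plus (F G : C -> C) (z : C) :
  hol F z -> hol G z -> hol (fun w => F w + G w)%C z.
Proof. by move=> [l h] [m k]; eexists; apply: (cder_plus h k). Qed.
Lemma hol_minus (F G : C -> C) (z : C) :
  hol F z -> hol G z -> hol (fun w => F w - G w)%C z.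
Proof. by move=> [l h] [m k]; eexists; apply: (cder_minus h k). Qed.
Lemma hol_mult (F G : C -> C) (z : C) :
  hol F z -> hol G z -> hol (fun w => F w * G w)%C z.
Proof. by move=> [l h] [m k]; eexists; apply: (cder_mult h k). Qed.
Lemma hol_div (F G : C -> C) (z : C) : G z <> 0 ->
  hol F z -> hol G z -> hol (fun w => F w / G w)%C z.
Proof. by move=> h0 [l h] [m k]; eexists; apply: (cder_div h0 h k). Qed.
Lemma hol_comp (F G : C -> C) (z : C) :
  hol F (G z) -> hol G z -> hol (fun w => F (G w)) z.
Proof. by move=> [l h] [m k]; eexists; apply: (cder_comp h k). Qed.

(** * Continuity and integrals of complex-valued functions *)

(** Componentwise, to match [cint]: a complex integral is a pair of real ones, and both are governed
    by the real theory. *)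
Definition ccont {T : UniformSpace} (f : T -> C) (x : T) : Prop :=
  continuous (fun t => Re (f t)) x /\ continuous (fun t => Im (f t)) x.

Local Notation ccontC := (ccont (T := C_UniformSpace)).

Lemma ccont_const {T : UniformSpace} (c : C) (x : T) : ccont (fun=> c) x.
Proof. by split; apply: continuous_const. Qed.

Lemma ccont_plus {T : UniformSpace} (f g : T -> C) (x : T) :
  ccont f x -> ccont g x -> ccont (fun t => f t + g t)%C x.
Proof. by move=> [? ?] [? ?]; split; apply: continuous_plus. Qed.

Lemma ccont_opp {T : UniformSpace} (f : T -> C) (x : T) :
  ccont f x -> ccont (fun t => - f t)%C x.
Proof. by move=> [? ?]; split; apply: continuous_opp. Qed.

Lemma ccont_minus {T : UniformSpace} (f g : T -> C) (x : T) :
  ccont f x -> ccont g x -> ccont (fun t => f t - g t)%C x.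
Proof. by move=> h1 h2; apply: ccont_plus h1 (ccont_opp h2). Qed.

Lemma ccont_mult {T : UniformSpace} (f g : T -> C) (x : T) :
  ccont f x -> ccont g x -> ccont (fun t => f t * g t)%C x.
Proof.
move=> [? ?] [? ?]; split => /=.
- by apply: continuous_minus; apply: continuous_mult.
- by apply: continuous_plus; apply: continuous_mult.
Qed.

Lemma ccont_inv {T : UniformSpace} (f : T -> C) (x : T) :
  f x <> 0 -> ccont f x -> ccont (fun t => / f t)%C x.
Proof.
move=> h0 [h1 h2].
have hs : (Re (f x) ^ 2 + Im (f x) ^ 2 <> 0)%R.
  move=> E; apply: h0; apply: C_ext => /=.
  - by have := pow2_ge_0 (Re (f x)); have := pow2_ge_0 (Im (f x)) => ? ?;
      apply: Rsqr_0_uniq; rewrite Rsqr_pow2; lra.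
  - by have := pow2_ge_0 (Re (f x)); have := pow2_ge_0 (Im (f x)) => ? ?;
      apply: Rsqr_0_uniq; rewrite Rsqr_pow2; lra.
have hi : continuous (fun t => / (Re (f t) ^ 2 + Im (f t) ^ 2))%R x.
  apply: (continuous_comp (fun t => Re (f t) ^ 2 + Im (f t) ^ 2)%R Rinv).
    by apply: (continuous_plus (V := R_NormedModule)) => /=;
       apply: continuous_mult => //; apply: continuous_mult => //;
       apply: continuous_const.
  exact: continuous_Rinv.
split; apply: continuous_mult => //.
exact: (continuous_opp (V := R_NormedModule)).
Qed.

Lemma ccont_div {T : UniformSpace} (f g : T -> C) (x : T) :
  g x <> 0 -> ccont f x -> ccont g x -> ccont (fun t => f t / g t)%C x.
Proof. by move=> h0 h1 h2; apply: ccont_mult h1 (ccont_inv h0 h2). Qed.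

Lemma ccont_ext_loc {T : UniformSpace} (f g : T -> C) (x : T) :
  locally x (fun t => f t = g t) -> ccont f x -> ccont g x.
Proof.
move=> E [h1 h2]; split.
- apply: continuous_ext_loc h1; apply: filter_imp E => t -> //.
- apply: continuous_ext_loc h2; apply: filter_imp E => t -> //.
Qed.

Lemma ccont_epsR (f : R -> C) (t : R) :
  ccont f t <-> forall eps, 0 < eps -> exists d, 0 < d /\ forall u,
    Rabs (u - t) < d -> Cmod (f u - f t) < eps.
Proof.
split.
- move=> [h1 h2] eps he.
  have he2 : 0 < eps / 2 by lra.
  have /filterlim_locally /(_ (mkposreal _ he2)) [d1 H1] := h1.
  have /filterlim_locally /(_ (mkposreal _ he2)) [d2 H2] := h2.
  exists (Rmin d1 d2); split; first by apply: Rmin_glb_lt; apply: cond_pos.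
  move=> u hu.
  have /= a1 := H1 u (Rlt_le_trans _ _ _ hu (Rmin_l _ _)).
  have /= a2 := H2 u (Rlt_le_trans _ _ _ hu (Rmin_r _ _)).
  apply: Rle_lt_trans (Cmod_le_abs _) _.
  move: a1 a2; rewrite /ball /= /AbsRing_ball /abs /minus /plus /opp /=.
  by rewrite /Rminus /Re /Im; lra.
- move=> H; split; apply/filterlim_locally => eps;
    have [d [d0 Hd]] := H eps (cond_pos eps);
    exists (mkposreal _ d0) => u hu; have {}Hd := Hd u hu;
    rewrite /ball /= /AbsRing_ball /abs /minus /plus /opp /=.
  + by apply: Rle_lt_trans Hd; apply: (re_le_Cmod (f u - f t)).
  + by apply: Rle_lt_trans Hd; apply: (im_le_Cmod (f u - f t)).
Qed.

Lemma ccont_epsC (f : C -> C) (t : C) :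
  ccontC f t <-> forall eps, 0 < eps -> exists d, 0 < d /\ forall u,
    Cmod (u - t) < d -> Cmod (f u - f t) < eps.
Proof.
split.
- move=> [h1 h2] eps he.
  have he2 : 0 < eps / 2 by lra.
  have /filterlim_locally /(_ (mkposreal _ he2)) [d1 H1] := h1.
  have /filterlim_locally /(_ (mkposreal _ he2)) [d2 H2] := h2.
  exists (Rmin d1 d2); split; first by apply: Rmin_glb_lt; apply: cond_pos.
  move=> u hu.
  have hb d : Cmod (u - t) < d -> ball t d u.
    move=> hd; split; [have := re_le_Cmod (u - t) | have := im_le_Cmod (u - t)];
    rewrite /ball /= /AbsRing_ball /abs /minus /plus /opp /= /Rminus /Re /Im /=; lra.
  have /= a1 := H1 u (hb _ (Rlt_le_trans _ _ _ hu (Rmin_l _ _))).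
  have /= a2 := H2 u (hb _ (Rlt_le_trans _ _ _ hu (Rmin_r _ _))).
  apply: Rle_lt_trans (Cmod_le_abs _) _.
  move: a1 a2; rewrite /ball /= /AbsRing_ball /abs /minus /plus /opp /=.
  by rewrite /Rminus /Re /Im; lra.
- move=> H; split; apply/filterlim_locally => eps;
    have [d [d0 Hd]] := H eps (cond_pos eps);
    have d02 : 0 < d / 2 by [lra];
    exists (mkposreal _ d02) => u hu; have {}Hd : Cmod (f u - f t) < eps.
  1,3: apply: Hd; apply: Rle_lt_trans (Cmod_le_abs _) _;
    move: hu => [] /=; rewrite /ball /= /AbsRing_ball /abs /minus /plus /opp /= /Rminus;
    rewrite /Re /Im; lra.
  + by apply: Rle_lt_trans Hd; apply: (re_le_Cmod (f u - f t)).
  + by apply: Rle_lt_trans Hd; apply: (im_le_Cmod (f u - f t)).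
Qed.

Lemma hol_ccont (F : C -> C) (z : C) : hol F z -> ccontC F z.
Proof. by move=> [l h]; apply/ccont_epsC; apply: cder_cont_eps h. Qed.

Lemma ccont_id (z : C) : ccontC (fun w => w) z.
Proof. exact: hol_ccont (hol_id z). Qed.

Lemma ccont_comp {T : UniformSpace} (F : C -> C) (g : T -> C) (x : T) :
  ccontC F (g x) -> ccont g x -> ccont (fun t => F (g t)) x.
Proof.
move=> [h1 h2] [k1 k2].
have hg : continuous (U := C_UniformSpace) g x.
  apply: (continuous_ext (fun t => (Re (g t), Im (g t)))); first by move=> t; case: (g t).
  apply: (continuous_comp_2 (W := R_UniformSpace) (V := R_UniformSpace)
    (X := C_UniformSpace) _ _ (fun a b => (a, b))) => //.
  have E : forall p : C_UniformSpace, p = (p.1, p.2) by case.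
  apply: (@continuous_ext C_UniformSpace C_UniformSpace (fun p => p)); first by case.
  exact: (@continuous_id C_UniformSpace).
split.
- exact: (@continuous_comp T C_UniformSpace _ g (fun t => Re (F t))).
- exact: (@continuous_comp T C_UniformSpace _ g (fun t => Im (F t))).
Qed.

Definition cint (f : R -> C) (a b : R) : C :=
  (RInt (fun t => Re (f t)) a b, RInt (fun t => Im (f t)) a b).

Definition cex (f : R -> C) (a b : R) : Prop :=
  ex_RInt (fun t => Re (f t)) a b /\ ex_RInt (fun t => Im (f t)) a b.

Definition ccont_on (f : R -> C) (a b : R) : Prop :=
  forall t, Rmin a b <= t <= Rmax a b -> ccont f t.

Lemma cex_cont (f : R -> C) (a b : R) : ccont_on f a b -> cex f a b.
Proof.
by move=> h; split; apply: (@ex_RInt_continuous R_CompleteNormedModule) => t /h [].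
Qed.

Lemma is_RInt_cint (f : R -> C) (a b : R) : cex f a b ->
  is_RInt (V := C_R_CompleteNormedModule) f a b (cint f a b).
Proof.
move=> [h1 h2]; apply: (is_RInt_fct_extend_pair (U := R_NormedModule) (V := R_NormedModule)).
- exact: (RInt_correct _ _ _ h1).
- exact: (RInt_correct _ _ _ h2).
Qed.

Lemma cint_ext (f g : R -> C) (a b : R) :
  (forall t, Rmin a b <= t <= Rmax a b -> f t = g t) -> cint f a b = cint g a b.
Proof.
move=> E; congr pair; apply: RInt_ext => t ht; rewrite E //; lra.
Qed.

Lemma cex_ext (f g : R -> C) (a b : R) :
  (forall t, Rmin a b <= t <= Rmax a b -> f t = g t) -> cex f a b -> cex g a b.
Proof.
move=> E [h1 h2]; split.
- by apply: ex_RInt_ext h1 => t ht; rewrite E //; lra.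
- by apply: ex_RInt_ext h2 => t ht; rewrite E //; lra.
Qed.

Lemma cint_point (f : R -> C) (a : R) : cint f a a = 0.
Proof. by rewrite /cint !RInt_point. Qed.

Lemma cint_swap (f : R -> C) (a b : R) : cex f a b -> cint f b a = (- cint f a b)%C.
Proof.
move=> [h1 h2]; apply: C_ext => /=.
- exact: (esym (opp_RInt_swap _ _ _ h1)).
- exact: (esym (opp_RInt_swap _ _ _ h2)).
Qed.

Lemma cex_swap (f : R -> C) (a b : R) : cex f a b -> cex f b a.
Proof. by move=> [h1 h2]; split; apply: ex_RInt_swap. Qed.

Lemma cint_Chasles (f : R -> C) (a b c : R) : cex f a b -> cex f b c ->
  (cint f a b + cint f b c)%C = cint f a c.
Proof.
move=> [h1 h2] [k1 k2]; apply: C_ext => /=.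
- exact: (RInt_Chasles (fun t => Re (f t)) a b c h1 k1).
- exact: (RInt_Chasles (fun t => Im (f t)) a b c h2 k2).
Qed.

Lemma cint_plus (f g : R -> C) (a b : R) : cex f a b -> cex g a b ->
  cint (fun t => f t + g t)%C a b = (cint f a b + cint g a b)%C.
Proof.
move=> [h1 h2] [k1 k2]; apply: C_ext => /=.
- exact: (RInt_plus (fun t => Re (f t)) (fun t => Re (g t)) a b h1 k1).
- exact: (RInt_plus (fun t => Im (f t)) (fun t => Im (g t)) a b h2 k2).
Qed.

Lemma cex_plus (f g : R -> C) (a b : R) : cex f a b -> cex g a b ->
  cex (fun t => f t + g t)%C a b.
Proof. by move=> [h1 h2] [k1 k2]; split; apply: (@ex_RInt_plus R_NormedModule). Qed.

Lemma cint_scal (c : C) (f : R -> C) (a b : R) : cex f a b ->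
  cint (fun t => c * f t)%C a b = (c * cint f a b)%C.
Proof.
move=> [h1 h2].
have s1 k := RInt_scal (fun t => Re (f t)) a b k h1.
have s2 k := RInt_scal (fun t => Im (f t)) a b k h2.
have e1 k := ex_RInt_scal (fun t => Re (f t)) a b k h1.
have e2 k := ex_RInt_scal (fun t => Im (f t)) a b k h2.
apply: C_ext => /=.
- have := RInt_minus _ _ _ _ (e1 (Re c)) (e2 (Im c)); rewrite s1 s2; exact.
- have := RInt_plus _ _ _ _ (e2 (Re c)) (e1 (Im c)); rewrite s1 s2; exact.
Qed.

Lemma cex_scal (c : C) (f : R -> C) (a b : R) : cex f a b ->
  cex (fun t => c * f t)%C a b.
Proof.
move=> [h1 h2].
have e1 k := ex_RInt_scal (fun t => Re (f t)) a b k h1.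
have e2 k := ex_RInt_scal (fun t => Im (f t)) a b k h2.
split => /=.
- exact: (ex_RInt_minus _ _ _ _ (e1 (Re c)) (e2 (Im c))).
- exact: (ex_RInt_plus _ _ _ _ (e2 (Re c)) (e1 (Im c))).
Qed.

Lemma cint_opp (f : R -> C) (a b : R) : cex f a b ->
  cint (fun t => - f t)%C a b = (- cint f a b)%C.
Proof.
move=> h; rewrite -(cint_ext (f := fun t => (RtoC (-1) * f t)%C)).
  by rewrite cint_scal //; apply: C_ext => /=; ring.
by move=> t _; apply: C_ext => /=; ring.
Qed.

Lemma cex_opp (f : R -> C) (a b : R) : cex f a b -> cex (fun t => - f t)%C a b.
Proof.
move=> /(cex_scal (RtoC (-1))); apply: cex_ext => t _.
by apply: C_ext => /=; ring.
Qed.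

Lemma cint_minus (f g : R -> C) (a b : R) : cex f a b -> cex g a b ->
  cint (fun t => f t - g t)%C a b = (cint f a b - cint g a b)%C.
Proof. by move=> h k; rewrite /Cminus -cint_opp // cint_plus //; apply: cex_opp. Qed.

Lemma cex_minus (f g : R -> C) (a b : R) : cex f a b -> cex g a b ->
  cex (fun t => f t - g t)%C a b.
Proof. by move=> h k; apply: cex_plus => //; apply: cex_opp. Qed.

Lemma cint_const (c : C) (a b : R) : cint (fun=> c) a b = (RtoC (b - a) * c)%C.
Proof.
by case: c => x y; rewrite /cint !RInt_const; apply: C_ext; rewrite /scal /= /mult /=; ring.
Qed.

Lemma cex_const (c : C) (a b : R) : cex (fun=> c) a b.
Proof. by split; apply: ex_RInt_const. Qed.

Lemma cint_norm_le (f : R -> C) (g : R -> R) (a b : R) : a <= b ->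
  cex f a b -> ex_RInt g a b ->
  (forall t, a <= t <= b -> Cmod (f t) <= g t) ->
  Cmod (cint f a b) <= RInt g a b.
Proof.
move=> hab hf hg H; rewrite Cmod_norm.
apply: (norm_RInt_le (V := C_R_CompleteNormedModule) f g a b) => //.
- by move=> t /H; rewrite Cmod_norm.
- exact: is_RInt_cint.
- exact: (RInt_correct _ _ _ hg).
Qed.

Lemma cint_bound (f : R -> C) (M a b : R) : cex f a b ->
  (forall t, Rmin a b <= t <= Rmax a b -> Cmod (f t) <= M) ->
  Cmod (cint f a b) <= M * Rabs (b - a).
Proof.
have main x y : x <= y -> cex f x y -> (forall t, Rmin x y <= t <= Rmax x y -> Cmod (f t) <= M) ->
  Cmod (cint f x y) <= M * Rabs (y - x).
  move=> hxy h H.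
  have := cint_norm_le (g := fun=> M) hxy h (ex_RInt_const _ _ _).
  rewrite RInt_const Rabs_pos_eq; last lra.
  rewrite /scal /= /mult /= Rmult_comm; apply => t ht; apply: H.
  by rewrite Rmin_left // Rmax_right.
move=> h H; case: (Rle_dec a b) => hab; first exact: main.
rewrite (cint_swap (cex_swap h)) Cmod_opp Rabs_minus_sym; apply: main; first lra.
- exact: cex_swap.
- by move=> t; rewrite Rmin_comm Rmax_comm; apply: H.
Qed.

Definition rder (w : R -> C) (t : R) (v : C) : Prop :=
  is_derive (fun u => Re (w u)) t (Re v) /\ is_derive (fun u => Im (w u)) t (Im v).

Lemma is_derive_eps (f : R -> R) (t l : R) :
  is_derive f t l <->
  forall eps, 0 < eps -> exists d, 0 < d /\ forall u, Rabs (u - t) < d ->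
    Rabs (f u - f t - l * (u - t)) <= eps * Rabs (u - t).
Proof.
split.
- move=> [_ H] eps he.
  have [d Hd] := H t (fun P HP => HP) (mkposreal _ he).
  exists d; split; first exact: cond_pos.
  move=> u hu; have := Hd u hu.
  by rewrite (Rmult_comm l).
- move=> H; split; first exact: is_linear_scal_l.
  move=> x Hx; have -> : x = t by apply: (is_filter_lim_unique _ _ Hx (fun P HP => HP)).
  move=> eps; have [d [d0 Hd]] := H eps (cond_pos eps).
  exists (mkposreal _ d0) => u hu; have := Hd u hu.
  by rewrite (Rmult_comm l).
Qed.

Lemma rder_eps (w : R -> C) (t : R) (v : C) :
  rder w t v <->
  forall eps, 0 < eps -> exists d, 0 < d /\ forall u, Rabs (u - t) < d ->
    Cmod (w u - w t - v * RtoC (u - t))%C <= eps * Rabs (u - t).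
Proof.
have hre u : Re (w u - w t - v * RtoC (u - t)) = (Re (w u) - Re (w t) - Re v * (u - t))%R.
  by rewrite /Re /Im /=; ring.
have him u : Im (w u - w t - v * RtoC (u - t)) = (Im (w u) - Im (w t) - Im v * (u - t))%R.
  by rewrite /Re /Im /=; ring.
split.
- move=> [/is_derive_eps h1 /is_derive_eps h2] eps he.
  have he2 : 0 < eps / 2 by lra.
  have [d1 [d10 H1]] := h1 _ he2; have [d2 [d20 H2]] := h2 _ he2.
  exists (Rmin d1 d2); split; first exact: Rmin_glb_lt.
  move=> u hu; apply: Rle_trans (Cmod_le_abs _) _; rewrite hre him.
  have := H1 u (Rlt_le_trans _ _ _ hu (Rmin_l _ _)).
  have := H2 u (Rlt_le_trans _ _ _ hu (Rmin_r _ _)); lra.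
- move=> H; split; apply/is_derive_eps => eps he; have [d [d0 Hd]] := H eps he;
    exists d; split=> // u hu; apply: Rle_trans (Hd u hu).
  + by rewrite -hre; apply: re_le_Cmod.
  + by rewrite -him; apply: im_le_Cmod.
Qed.

Lemma cint_FTC (w w' : R -> C) (a b : R) :
  (forall t, Rmin a b <= t <= Rmax a b -> rder w t (w' t)) ->
  (forall t, Rmin a b <= t <= Rmax a b -> ccont w' t) ->
  cint w' a b = (w b - w a)%C.
Proof.
move=> h1 h2; apply: C_ext => /=; apply: is_RInt_unique.
- by apply: (is_RInt_derive (fun t => Re (w t))) => t ht; [case: (h1 t ht) | case: (h2 t ht)].
- by apply: (is_RInt_derive (fun t => Im (w t))) => t ht; [case: (h1 t ht) | case: (h2 t ht)].
Qed.

Lemma rder_comp (F : C -> C) (w : R -> C) (t : R) (l v : C) :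
  cder F (w t) l -> rder w t v -> rder (fun u => F (w u)) t (l * v)%C.
Proof.
move=> /cderP hF /rder_eps hw; apply/rder_eps => eps he.
have hv := Cmod_ge_0 v; have hl := Cmod_ge_0 l.
(* The tolerance for [w] is at most 1, so that [|w u - w t| <= (1 + |v|) |u - t|]; it is also small
   enough that each of the two error terms contributes at most half of [eps]. *)
have h2 : 0 < Rmin 1 (eps / (2 * (1 + Cmod l))).
  by apply: Rmin_glb_lt; [lra | apply: Rdiv_lt_0_compat; lra].
have h1 : 0 < eps / (2 * (1 + Cmod v)) by apply: Rdiv_lt_0_compat; lra.
have [d1 [d10 H1]] := hF _ h1.
have [d2 [d20 H2]] := hw _ h2.
have h3 : 0 < d1 / (1 + Cmod v) by apply: Rdiv_lt_0_compat; lra.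
exists (Rmin d2 (d1 / (1 + Cmod v))); split; first exact: Rmin_glb_lt.
move=> u hu.
have a2 := H2 u (Rlt_le_trans _ _ _ hu (Rmin_l _ _)).
have a1 := Rlt_le_trans _ _ _ hu (Rmin_r _ _).
have u0 := Rabs_pos (u - t).
set m := Rmin 1 _ in a2 h2.
have m1 : m <= 1 by apply: Rmin_l.
have m2 : m * (2 * (1 + Cmod l)) <= eps.
  apply/Rle_div_r; first lra; exact: Rmin_r.
have b1 : Cmod (w u - w t) <= (1 + Cmod v) * Rabs (u - t).
  have := Cmod_triangle_inv (w u - w t) (v * RtoC (u - t)).
  rewrite Cmod_mult Cmod_R; nra.
have b2 : Cmod (w u - w t) < d1.
  apply: Rle_lt_trans b1 _; rewrite Rmult_comm; apply/Rlt_div_r => //; lra.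
have a3 := H1 _ b2.
have e1 : eps / (2 * (1 + Cmod v)) * Cmod (w u - w t) <= eps / 2 * Rabs (u - t).
  apply: Rle_trans (Rmult_le_compat_l _ _ _ (Rlt_le _ _ h1) b1) _.
  by right; field; lra.
rewrite (_ : (F (w u) - F (w t) - l * v * RtoC (u - t))%C =
  ((F (w u) - F (w t) - l * (w u - w t)) + l * (w u - w t - v * RtoC (u - t)))%C); last ring.
apply: Rle_trans (Cmod_triangle _ _) _; rewrite Cmod_mult.
have := Cmod_ge_0 (w u - w t - v * RtoC (u - t)); nra.
Qed.

(** * Cauchy's theorem on rectangles *)

Definition in_rect (a b c d : R) (z : C) : Prop := a <= Re z <= b /\ c <= Im z <= d.

Definition hint (F : C -> C) (y a b : R) : C := cint (fun x => F (x, y)) a b.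
Definition vint (F : C -> C) (x c d : R) : C := cint (fun y => F (x, y)) c d.

(** The contour integral over the boundary, counterclockwise from the bottom side; [Ci] comes from
    [dz = i dy] on the vertical sides. *)
Definition rect (F : C -> C) (a b c d : R) : C :=
  (hint F c a b + Ci * vint F b c d - hint F d a b - Ci * vint F a c d)%C.

Definition rcont (F : C -> C) (a b c d : R) : Prop :=
  forall z, in_rect a b c d z -> ccontC F z.

Lemma ccont_hline (F : C -> C) (x y : R) :
  ccontC F (x, y) -> ccont (fun t => F (t, y)) x.
Proof.
move=> h; apply: (ccont_comp (g := fun t => (t, y))) => //.
by split => /=; [apply: continuous_id | apply: continuous_const].
Qed.

Lemma ccont_vline (F : C -> C) (x y : R) :
  ccontC F (x, y) -> ccont (fun t => F (x, t)) y.
Proof.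
move=> h; apply: (ccont_comp (g := fun t => (x, t))) => //.
by split => /=; [apply: continuous_const | apply: continuous_id].
Qed.

Lemma cex_hint (F : C -> C) (a b c d y u v : R) : rcont F a b c d ->
  c <= y <= d -> a <= u <= b -> a <= v <= b -> cex (fun x => F (x, y)) u v.
Proof.
move=> h hy hu hv; apply: cex_cont => t ht; apply: ccont_hline; apply: h; split=> //=.
have : a <= Rmin u v by apply: Rmin_glb; lra.
have : Rmax u v <= b by apply: Rmax_lub; lra.
lra.
Qed.

Lemma cex_vint (F : C -> C) (a b c d x u v : R) : rcont F a b c d ->
  a <= x <= b -> c <= u <= d -> c <= v <= d -> cex (fun y => F (x, y)) u v.
Proof.
move=> h hx hu hv; apply: cex_cont => t ht; apply: ccont_vline; apply: h; split=> //=.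
have : c <= Rmin u v by apply: Rmin_glb; lra.
have : Rmax u v <= d by apply: Rmax_lub; lra.
lra.
Qed.

Lemma rcont_sub (F : C -> C) (a b c d a' b' c' d' : R) :
  rcont F a b c d -> a <= a' -> b' <= b -> c <= c' -> d' <= d -> rcont F a' b' c' d'.
Proof. by move=> h *; move=> z [? ?]; apply: h; split; lra. Qed.

Lemma rect_minus (F G : C -> C) (a b c d : R) : a <= b -> c <= d ->
  rcont F a b c d -> rcont G a b c d ->
  rect (fun z => F z - G z)%C a b c d = (rect F a b c d - rect G a b c d)%C.
Proof.
move=> hab hcd hF hG; rewrite /rect /hint /vint !cint_minus; first ring;
  by [apply: (cex_hint (c := c) (d := d)); eauto; lra |
      apply: (cex_vint (a := a) (b := b)); eauto; lra].
Qed.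

Lemma rect_bound (F : C -> C) (a b c d M : R) : a <= b -> c <= d ->
  rcont F a b c d -> (forall z, in_rect a b c d z -> Cmod (F z) <= M) ->
  Cmod (rect F a b c d) <= 2 * M * ((b - a) + (d - c)).
Proof.
move=> hab hcd hF H.
have hh y : c <= y <= d -> Cmod (hint F y a b) <= M * (b - a).
  move=> hy; rewrite -(Rabs_pos_eq (b - a)); last lra.
  apply: cint_bound; first by apply: (cex_hint (c := c) (d := d)); eauto; lra.
  by rewrite Rmin_left // Rmax_right // => t ht; apply: H; split.
have hv x : a <= x <= b -> Cmod (vint F x c d) <= M * (d - c).
  move=> hx; rewrite -(Rabs_pos_eq (d - c)); last lra.
  apply: cint_bound; first by apply: (cex_vint (a := a) (b := b)); eauto; lra.
  by rewrite Rmin_left // Rmax_right // => t ht; apply: H; split.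
have := hh c ltac:(lra); have := hh d ltac:(lra).
have := hv a ltac:(lra); have := hv b ltac:(lra).
rewrite /rect /Cminus.
have := Cmod_triangle (hint F c a b + Ci * vint F b c d + - hint F d a b) (- (Ci * vint F a c d)).
have := Cmod_triangle (hint F c a b + Ci * vint F b c d) (- hint F d a b).
have := Cmod_triangle (hint F c a b) (Ci * vint F b c d).
rewrite !Cmod_opp !Cmod_mult !Cmod_Ci; lra.
Qed.

Lemma rder_hline (F : C -> C) (x y : R) (l : C) :
  cder F (x, y) l -> rder (fun t => F (t, y)) x l.
Proof.
move=> h; rewrite -(Cmult_1_r l); apply: (rder_comp (w := fun t => (t, y))) => //.
by split => /=; [apply: is_derive_id | apply: is_derive_const].
Qed.

Lemma rder_vline (F : C -> C) (x y : R) (l : C) :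
  cder F (x, y) l -> rder (fun t => F (x, t)) y (Ci * l)%C.
Proof.
move=> h; rewrite Cmult_comm; apply: (rder_comp (w := fun t => (x, t))) => //.
by split => /=; [apply: is_derive_const | apply: is_derive_id].
Qed.

Lemma hint_primitive (Q F : C -> C) (y a b : R) :
  (forall x, Rmin a b <= x <= Rmax a b -> cder Q (x, y) (F (x, y)) /\
     ccontC F (x, y)) ->
  hint F y a b = (Q (b, y) - Q (a, y))%C.
Proof.
move=> h; apply: (cint_FTC (w := fun x => Q (x, y))) => t ht.
- by apply: rder_hline; case: (h t ht).
- by apply: ccont_hline; case: (h t ht).
Qed.

Lemma vint_primitive (Q F : C -> C) (x c d : R) :
  (forall y, Rmin c d <= y <= Rmax c d -> cder Q (x, y) (F (x, y)) /\
     ccontC F (x, y)) ->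
  (Ci * vint F x c d)%C = (Q (x, d) - Q (x, c))%C.
Proof.
move=> h; rewrite -cint_scal.
- apply: (cint_FTC (w := fun y => Q (x, y))) => t ht.
  + by apply: rder_vline; case: (h t ht).
  + by apply: ccont_mult; [apply: ccont_const | apply: ccont_vline; case: (h t ht)].
- by apply: cex_cont => t ht; apply: ccont_vline; case: (h t ht).
Qed.

Lemma rect_primitive (Q F : C -> C) (a b c d : R) : a <= b -> c <= d ->
  rcont F a b c d -> (forall z, in_rect a b c d z -> cder Q z (F z)) ->
  rect F a b c d = 0.
Proof.
move=> hab hcd hF H; rewrite /rect.
rewrite !(hint_primitive (Q := Q)) ?(vint_primitive (Q := Q)); first ring;
  rewrite Rmin_left // Rmax_right // => t ht; split; try apply: H; try apply: hF; split => /=; lra.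
Qed.

Lemma rect_split_h (F : C -> C) (a m b c d : R) : a <= m <= b -> c <= d ->
  rcont F a b c d -> rect F a b c d = (rect F a m c d + rect F m b c d)%C.
Proof.
move=> hm hcd hF; rewrite /rect /hint.
rewrite -(@cint_Chasles (fun x => F (x, c)) a m b);
  [rewrite -(@cint_Chasles (fun x => F (x, d)) a m b); first ring|..]; apply: (cex_hint (c := c) (d := d)); eauto; lra.
Qed.

Lemma rect_split_v (F : C -> C) (a b c m d : R) : a <= b -> c <= m <= d ->
  rcont F a b c d -> rect F a b c d = (rect F a b c m + rect F a b m d)%C.
Proof.
move=> hm hcd hF; rewrite /rect /vint.
rewrite -(@cint_Chasles (fun x => F (a, x)) c m d);
  [rewrite -(@cint_Chasles (fun x => F (b, x)) c m d); first ring|..]; apply: (cex_vint (a := a) (b := b)); eauto; lra.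
Qed.

Lemma pow2_unbounded (A r : R) : 0 < r -> exists k : nat, A / 2 ^ k < r.
Proof.
move=> hr.
have h2 : Rabs (/ 2) < 1 by rewrite Rabs_pos_eq; lra.
have hA : 0 < r / (1 + Rabs A) by apply: Rdiv_lt_0_compat => //; have := Rabs_pos A; lra.
have [k Hk] := pow_lt_1_zero _ h2 _ hA.
exists k; have := Hk k (Nat.le_refl _).
have p : 0 < / 2 ^ k by apply: Rinv_0_lt_compat; apply: pow_lt; lra.
rewrite pow_inv Rabs_pos_eq; last lra.
move=> h; have A0 := Rabs_pos A.
have : / 2 ^ k * (1 + Rabs A) < r by apply/Rlt_div_r => //; lra.
have := Rle_abs A; rewrite /Rdiv; nra.
Qed.

(** * Repeated bisection of a rectangle *)

Section Subdivision.
Variable P : R -> R -> R -> R -> Prop.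
Hypothesis P_step : forall x y A B,
  P x y (A / 2) (B / 2) -> P (x + A / 2) y (A / 2) (B / 2) ->
  P x (y + B / 2) (A / 2) (B / 2) -> P (x + A / 2) (y + B / 2) (A / 2) (B / 2) ->
  P x y A B.

(** The corner of a quarter on which [P] fails: if the first three quarters satisfy [P], then by
    [P_step] the fourth cannot. *)
Let next (x y A B : R) : R * R :=
  if excluded_middle_informative (P x y (A / 2) (B / 2)) then
    if excluded_middle_informative (P (x + A / 2) y (A / 2) (B / 2)) then
      if excluded_middle_informative (P x (y + B / 2) (A / 2) (B / 2)) then
        (x + A / 2, y + B / 2)%R
      else (x, y + B / 2)%R
    else (x + A / 2, y)%R
  else (x, y).

Let nextP x y A B : ~ P x y A B ->
  ~ P (next x y A B).1 (next x y A B).2 (A / 2) (B / 2).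
Proof.
move=> h; rewrite /next.
case: excluded_middle_informative => //= h1.
case: excluded_middle_informative => //= h2.
case: excluded_middle_informative => //= h3 h4.
by apply: h; apply: P_step.
Qed.

Let next_bounds x y A B : 0 <= A -> 0 <= B ->
  x <= (next x y A B).1 <= x + A / 2 /\ y <= (next x y A B).2 <= y + B / 2.
Proof.
move=> hA hB; rewrite /next.
by do 3?case: excluded_middle_informative => ? /=; lra.
Qed.

(** If [P] failed, bisection would give nested rectangles on which it fails. Their lower left
    corners have suprema [(u, v)], a point in all of them, and the local hypothesis at [(u, v)]
    contradicts the failure on a small one. *)
Lemma rect_induction (a b A B : R) : 0 <= A -> 0 <= B ->
  (forall u v, a <= u <= a + A -> b <= v <= b + B -> exists r, 0 < r /\
     forall x y A' B', x <= u <= x + A' -> y <= v <= y + B' -> A' < r -> B' < r ->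
       P x y A' B') ->
  P a b A B.
Proof.
move=> hA hB loc; apply: NNPP => hn.
pose s := fix s (k : nat) : R * R :=
  if k is k'.+1 then next (s k').1 (s k').2 (A / 2 ^ k') (B / 2 ^ k') else (a, b).
have pow2_gt0 k : 0 < 2 ^ k by apply: pow_lt; lra.
have half X k : (X / 2 ^ k.+1 = X / 2 ^ k / 2)%R.
  by rewrite /=; field; have := pow2_gt0 k; lra.
have pos X k : 0 <= X -> 0 <= X / 2 ^ k.
  by move=> h; apply: Rdiv_le_0_compat.
have hs k : ~ P (s k).1 (s k).2 (A / 2 ^ k) (B / 2 ^ k).
  elim: k => [|k ih]; first by rewrite /= !Rdiv_1_r.
  by rewrite !half; apply: nextP.
have hb k : (s k).1 <= (s k.+1).1 /\ (s k.+1).1 + A / 2 ^ k.+1 <= (s k).1 + A / 2 ^ k /\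
   (s k).2 <= (s k.+1).2 /\ (s k.+1).2 + B / 2 ^ k.+1 <= (s k).2 + B / 2 ^ k.
  have := next_bounds (s k).1 (s k).2 (pos A k hA) (pos B k hB).
  by rewrite !half -/(s k.+1); lra.
have mono k j : (s k).1 <= (s (j + k)%N).1 /\
   (s (j + k)%N).1 + A / 2 ^ (j + k)%N <= (s k).1 + A / 2 ^ k /\
   (s k).2 <= (s (j + k)%N).2 /\ (s (j + k)%N).2 + B / 2 ^ (j + k)%N <= (s k).2 + B / 2 ^ k.
  elim: j => [|j ih]; first by rewrite add0n; lra.
  by have := hb (j + k)%N; rewrite addSn; lra.
have cross k j : (s j).1 <= (s k).1 + A / 2 ^ k /\ (s j).2 <= (s k).2 + B / 2 ^ k.
  have := mono k j; have := mono j k; rewrite (addnC k j).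
  by have := pos A (j + k)%N hA; have := pos B (j + k)%N hB; lra.
have [u [hu1 hu2]] : {u | is_lub (fun x => exists k, x = (s k).1) u}.
  apply: completeness; last by exists a, 0%N.
  by exists (a + A) => _ [k ->]; have := cross 0%N k; rewrite /= Rdiv_1_r; lra.
have [v [hv1 hv2]] : {v | is_lub (fun x => exists k, x = (s k).2) v}.
  apply: completeness; last by exists b, 0%N.
  by exists (b + B) => _ [k ->]; have := cross 0%N k; rewrite /= !Rdiv_1_r; lra.
have hu k : (s k).1 <= u <= (s k).1 + A / 2 ^ k.
  split; first by apply: hu1; exists k.
  by apply: hu2 => _ [j ->]; case: (cross k j).
have hv k : (s k).2 <= v <= (s k).2 + B / 2 ^ k.
  split; first by apply: hv1; exists k.
  by apply: hv2 => _ [j ->]; case: (cross k j).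
have [r [r0 Hr]] : exists r, 0 < r /\
     forall x y A' B', x <= u <= x + A' -> y <= v <= y + B' -> A' < r -> B' < r ->
       P x y A' B'.
  by apply: loc; [have := hu 0%N | have := hv 0%N]; rewrite /= Rdiv_1_r.
have [k hk] := pow2_unbounded (A + B) r0.
have hk' : A / 2 ^ k + B / 2 ^ k < r by rewrite -Rdiv_plus_distr.
by apply: (hs k); apply: Hr => //; have := pos A k hA; have := pos B k hB; lra.
Qed.

End Subdivision.

(** The bound [2 * eps * (A + B) ^ 2] scales like an area, so it survives the addition of four
    quarters and suits [rect_induction]. Locally [F] differs by at most [eps * (A + B)] from its
    first-order expansion, which has a primitive and integrates to 0. The side conditions are part
    of [P], so the induction may run without reference to the original rectangle. *)
Lemma goursat (F : C -> C) (a b c d : R) : a <= b -> c <= d ->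
  (forall z, in_rect a b c d z -> hol F z) -> rect F a b c d = 0.
Proof.
move=> hab hcd H.
have hF : rcont F a b c d by move=> z /H /hol_ccont.
have key eps : 0 < eps -> Cmod (rect F a b c d) <= 2 * eps * ((b - a) + (d - c)) ^ 2.
  move=> he.
  pose P x y A B := 0 <= A -> 0 <= B -> a <= x -> x + A <= b -> c <= y -> y + B <= d ->
    Cmod (rect F x (x + A) y (y + B)) <= 2 * eps * (A + B) ^ 2.
  suff : P a c (b - a)%R (d - c)%R.
    rewrite /P.
    have -> : (a + (b - a) = b)%R by ring.
    have -> : (c + (d - c) = d)%R by ring.
    by apply; lra.
  apply: rect_induction; try lra.
    move=> x y A B h1 h2 h3 h4 hA hB ? ? ? ?.
    rewrite (rect_split_h (m := x + A / 2)); [| lra | lra | apply: rcont_sub hF _ _ _ _; lra].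
    rewrite (rect_split_v (m := y + B / 2)); [| lra | lra | apply: rcont_sub hF _ _ _ _; lra].
    rewrite (rect_split_v (m := y + B / 2) (a := x + A / 2));
      [| lra | lra | apply: rcont_sub hF _ _ _ _; lra].
    have := h1 ltac:(lra) ltac:(lra) ltac:(lra) ltac:(lra) ltac:(lra) ltac:(lra).
    have := h2 ltac:(lra) ltac:(lra) ltac:(lra) ltac:(lra) ltac:(lra) ltac:(lra).
    have := h3 ltac:(lra) ltac:(lra) ltac:(lra) ltac:(lra) ltac:(lra) ltac:(lra).
    have := h4 ltac:(lra) ltac:(lra) ltac:(lra) ltac:(lra) ltac:(lra) ltac:(lra).
    rewrite !Rplus_assoc.
    have -> : (A / 2 + A / 2 = A)%R by field.
    have -> : (B / 2 + B / 2 = B)%R by field.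
    move=> k1 k2 k3 k4.
    apply: Rle_trans (Cmod_triangle _ _) _.
    apply: Rle_trans (Rplus_le_compat _ _ _ _ (Cmod_triangle _ _) (Cmod_triangle _ _)) _.
    have -> : (2 * eps * (A + B) ^ 2 = 4 * (2 * eps * (A / 2 + B / 2) ^ 2))%R by field.
    lra.
  move=> u v hu hv.
  have [l /cderP hl] : hol F (u, v) by apply: H; split => /=; lra.
  have [r [r0 Hr]] := hl eps he.
  have r2 : 0 < r / 2 by lra.
  exists (r / 2); split=> // x y A B hx hy hA hB A0 B0 ? ? ? ?.
  pose G z := (F (u, v) + l * (z - (u, v)))%C.
  have hG z : ccontC G z.
    apply: ccont_plus; first exact: ccont_const.
    apply: ccont_mult; first exact: ccont_const.
    by apply: ccont_minus; [exact: ccont_id | exact: ccont_const].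
  have hF' : rcont F x (x + A) y (y + B) by apply: rcont_sub hF _ _ _ _; lra.
  have G0 : rect G x (x + A) y (y + B) = 0.
    apply: (rect_primitive (Q := fun z => (F (u, v) * z + l * ((z - (u, v)) * (z - (u, v)) / RtoC 2))%C)); try lra.
      by move=> z _; apply: hG.
    move=> z _.
    have h0 := cder_minus (cder_id z) (cder_const (u, v) z).
    have h1 := cder_mult h0 h0.
    have h2 := cder_scal l (cder_mult h1 (cder_const (/ RtoC 2) z)).
    have h3 := cder_plus (cder_scal (F (u, v)) (cder_id z)) h2.
    apply: (cder_eq h3); rewrite /G; field.
  have -> : rect F x (x + A) y (y + B) = rect (fun z => F z - G z)%C x (x + A) y (y + B).
    rewrite rect_minus ?G0; try lra; last by move=> z _; apply: hG.
      by ring.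
    by [].
  have := @rect_bound (fun z => F z - G z)%C x (x + A) y (y + B) (eps * (A + B)).
  rewrite (_ : 2 * (eps * (A + B)) * (x + A - x + (y + B - y)) = 2 * eps * (A + B) ^ 2)%R; last ring.
  apply; try lra.
    by move=> z hz; apply: ccont_minus; [apply: hF' | apply: hG].
  move=> z [hz1 hz2].
  have dz : Cmod (z - (u, v)) <= A + B.
    apply: Rle_trans (Cmod_le_abs _) _.
    move: hz1 hz2; rewrite /Re /Im /= => hz1 hz2.
    apply: Rplus_le_compat; apply/Rabs_le; lra.
  rewrite (_ : (F z - G z)%C = (F z - F (u, v) - l * (z - (u, v)))%C); last by rewrite /G; ring.
  apply: Rle_trans (Hr z _) _; first lra.
  apply: Rmult_le_compat_l; lra.
apply: Cmod_eq_0; apply: Rle_antisym; last exact: Cmod_ge_0.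
apply: le_epsilon => e he; rewrite Rplus_0_l.
set S := ((b - a) + (d - c))%R in key.
have S0 : 0 <= S by rewrite /S; lra.
have e1 : 0 < e / (2 * (1 + S ^ 2)) by apply: Rdiv_lt_0_compat => //; nra.
apply: Rle_trans (key _ e1) _.
have -> : (2 * (e / (2 * (1 + S ^ 2))) * S ^ 2 = e * (S ^ 2 / (1 + S ^ 2)))%R by field; nra.
rewrite -{2}(Rmult_1_r e); apply: Rmult_le_compat_l; first lra.
by apply/Rle_div_l; nra.
Qed.

(* An exceptional point, where F is only continuous, is isolated in a square
   whose boundary integral is as small as we please. *)
Lemma goursat_except (F : C -> C) (p : C) (a b c d : R) : a <= b -> c <= d ->
  rcont F a b c d ->
  (forall z, in_rect a b c d z -> z <> p -> hol F z) -> rect F a b c d = 0.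
Proof.
move=> hab hcd hF H.
case: (classic (in_rect a b c d p)) => [hp|np]; last first.
  by apply: goursat => // z hz; apply: H => // E; apply: np; rewrite -E.
have [M [M0 HM]] : exists M, 0 < M /\ exists r, 0 < r /\
   forall z, Cmod (z - p) < r -> Cmod (F z) <= M.
  have /ccont_epsC /(_ 1 Rlt_0_1) [r [r0 Hr]] := hF p hp.
  exists (Cmod (F p) + 1); split; first by have := Cmod_ge_0 (F p); lra.
  exists r; split=> // z /Hr; have := Cmod_triangle_inv (F z) (F p); lra.
have [r [r0 Hr]] := HM.
have key e : 0 < e -> e < r / 4 -> Cmod (rect F a b c d) <= 2 * M * (4 * e).
  move=> he her.
  have [hp1 hp2] := hp.
  (* The square of half-side [e] about [p], clipped to the rectangle. Each of the four pieces cut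
     off avoids [p] or has an empty interior. *)
  pose a' := Rmax a (Re p - e); pose b' := Rmin b (Re p + e).
  pose c' := Rmax c (Im p - e); pose d' := Rmin d (Im p + e).
  have ha : a <= a' <= Re p /\ Re p - e <= a'.
    by rewrite /a'; split; [split; [apply: Rmax_l | apply: Rmax_lub; lra] | apply: Rmax_r].
  have hb : Re p <= b' <= b /\ b' <= Re p + e.
    by rewrite /b'; split; [split; [apply: Rmin_glb; lra | apply: Rmin_l] | apply: Rmin_r].
  have hc : c <= c' <= Im p /\ Im p - e <= c'.
    by rewrite /c'; split; [split; [apply: Rmax_l | apply: Rmax_lub; lra] | apply: Rmax_r].
  have hd : Im p <= d' <= d /\ d' <= Im p + e.
    by rewrite /d'; split; [split; [apply: Rmin_glb; lra | apply: Rmin_l] | apply: Rmin_r].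
  have za : rect F a a' c d = 0.
    case: (Rle_lt_dec a (Re p - e)) => h.
      apply: goursat; try lra; move=> z [hz1 hz2]; apply: H; first by split; lra.
      move=> E; move: hz1; rewrite E /a' Rmax_right; lra.
    rewrite /a' Rmax_left; last lra.
    by rewrite /rect /hint !cint_point; ring.
  have zb : rect F b' b c d = 0.
    case: (Rle_lt_dec (Re p + e) b) => h.
      apply: goursat; try lra; move=> z [hz1 hz2]; apply: H; first by split; lra.
      move=> E; move: hz1; rewrite E /b' Rmin_right; lra.
    rewrite /b' Rmin_left; last lra.
    by rewrite /rect /hint !cint_point; ring.
  have zc : rect F a' b' c c' = 0.
    case: (Rle_lt_dec c (Im p - e)) => h.
      apply: goursat; try lra; move=> z [hz1 hz2]; apply: H; first by split; lra.
      move=> E; move: hz2; rewrite E /c' Rmax_right; lra.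
    rewrite /c' Rmax_left; last lra.
    by rewrite /rect /vint !cint_point; ring.
  have zd : rect F a' b' d' d = 0.
    case: (Rle_lt_dec (Im p + e) d) => h.
      apply: goursat; try lra; move=> z [hz1 hz2]; apply: H; first by split; lra.
      move=> E; move: hz2; rewrite E /d' Rmin_right; lra.
    rewrite /d' Rmin_left; last lra.
    by rewrite /rect /vint !cint_point; ring.
  rewrite (rect_split_h (m := a')) //; last lra.
  rewrite (rect_split_h (m := b') (a := a')); [| lra | lra | apply: rcont_sub hF _ _ _ _; lra].
  rewrite (rect_split_v (m := c') (a := a') (b := b')); [| lra | lra | apply: rcont_sub hF _ _ _ _; lra].
  rewrite (rect_split_v (m := d') (a := a') (b := b') (c := c')); [| lra | lra | apply: rcont_sub hF _ _ _ _; lra].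
  rewrite za zb zc zd (_ : (0 + (0 + (rect F a' b' c' d' + 0) + 0) = rect F a' b' c' d')%C); last ring.
  apply: Rle_trans (rect_bound (M := M) _ _ _ _) _; try lra.
  - by apply: rcont_sub hF _ _ _ _; lra.
  - move=> z [hz1 hz2]; apply: Hr; apply: Rle_lt_trans (Cmod_le_abs _) _.
    have h1 : Rabs (Re (z - p)) <= e.
      by apply/Rabs_le; rewrite /Re /= -/(Re z) -/(Re p); lra.
    have h2 : Rabs (Im (z - p)) <= e.
      by apply/Rabs_le; rewrite /Im /= -/(Im z) -/(Im p); lra.
    lra.
  - apply: Rmult_le_compat_l; lra.
apply: Cmod_eq_0; apply: Rle_antisym; last exact: Cmod_ge_0.
apply: le_epsilon => e he; rewrite Rplus_0_l.
have h1 : 0 < e / (8 * M) by apply: Rdiv_lt_0_compat; lra.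
pose e' := Rmin (e / (8 * M)) (r / 8).
have e'0 : 0 < e' by apply: Rmin_glb_lt; lra.
have e'1 : e' <= e / (8 * M) by apply: Rmin_l.
have e'2 : e' <= r / 8 by apply: Rmin_r.
apply: Rle_trans (key e' e'0 _) _; first lra.
have /Rle_div_r : e' <= e / (8 * M) by []. 
move=> /(_ ltac:(lra)); lra.
Qed.

(** * Primitives and Cauchy's formula on circles *)

Definition orect (a b c d : R) (z : C) : Prop := a < Re z < b /\ c < Im z < d.

(** The corners may come in any order, because the primitive below is defined by paths leaving the
    centre in all four directions. *)
Lemma signed_rect (F : C -> C) (p : C) (a b c d x1 x2 y1 y2 : R) :
  (forall z, orect a b c d z -> ccontC F z) ->
  (forall z, orect a b c d z -> z <> p -> hol F z) ->
  a < x1 < b -> a < x2 < b -> c < y1 < d -> c < y2 < d ->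
  (hint F y1 x1 x2 + Ci * vint F x2 y1 y2 - hint F y2 x1 x2 - Ci * vint F x1 y1 y2)%C = 0.
Proof.
move=> hF hp.
have main u1 u2 v1 v2 : a < u1 -> u1 <= u2 -> u2 < b -> c < v1 -> v1 <= v2 -> v2 < d ->
    rcont F u1 u2 v1 v2 /\ rect F u1 u2 v1 v2 = 0.
  move=> *; have hr : rcont F u1 u2 v1 v2 by move=> z [? ?]; apply: hF; split; lra.
  split=> //; apply: (goursat_except (p := p)) => // z [? ?] hz.
  by apply: hp => //; split; lra.
move=> h1 h2 h3 h4.
have sw_h u1 u2 v1 v2 : rcont F u1 u2 v1 v2 -> u1 <= u2 -> v1 <= v2 ->
    forall v, v1 <= v <= v2 -> hint F v u2 u1 = (- hint F v u1 u2)%C.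
  by move=> hr *; apply: cint_swap; apply: (cex_hint hr); lra.
have sw_v u1 u2 v1 v2 : rcont F u1 u2 v1 v2 -> u1 <= u2 -> v1 <= v2 ->
    forall u, u1 <= u <= u2 -> vint F u v2 v1 = (- vint F u v1 v2)%C.
  by move=> hr *; apply: cint_swap; apply: (cex_vint hr); lra.
case: (Rle_lt_dec x1 x2) => hx; case: (Rle_lt_dec y1 y2) => hy.
- by case: (main x1 x2 y1 y2 ltac:(lra) ltac:(lra) ltac:(lra) ltac:(lra) ltac:(lra) ltac:(lra)).
- have [hr hz] := main x1 x2 y2 y1 ltac:(lra) ltac:(lra) ltac:(lra) ltac:(lra) ltac:(lra) ltac:(lra).
  rewrite !(sw_v _ _ _ _ hr); try lra.
  rewrite /rect in hz.
  by rewrite -(Cmult_0_r (- (1))) -hz; ring.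
- have [hr hz] := main x2 x1 y1 y2 ltac:(lra) ltac:(lra) ltac:(lra) ltac:(lra) ltac:(lra) ltac:(lra).
  rewrite !(sw_h _ _ _ _ hr); try lra.
  rewrite /rect in hz.
  by rewrite -(Cmult_0_r (- (1))) -hz; ring.
- have [hr hz] := main x2 x1 y2 y1 ltac:(lra) ltac:(lra) ltac:(lra) ltac:(lra) ltac:(lra) ltac:(lra).
  rewrite !(sw_h _ _ _ _ hr); try lra.
  rewrite !(sw_v _ _ _ _ hr); try lra.
  by rewrite /rect in hz; rewrite -hz; ring.
Qed.

Lemma orect_nbhd (a b c d : R) (z : C) : orect a b c d z ->
  exists r, 0 < r /\ forall w, Rabs (Re (w - z)) < r -> Rabs (Im (w - z)) < r -> orect a b c d w.
Proof.
move=> [h1 h2].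
exists (Rmin (Rmin (Re z - a) (b - Re z)) (Rmin (Im z - c) (d - Im z))); split.
  by do !apply: Rmin_glb_lt; lra.
move=> w hr hi.
have [m1 m2] : Rmin (Rmin (Re z - a) (b - Re z)) (Rmin (Im z - c) (d - Im z)) <= Rmin (Re z - a) (b - Re z) /\
  Rmin (Rmin (Re z - a) (b - Re z)) (Rmin (Im z - c) (d - Im z)) <= Rmin (Im z - c) (d - Im z).
  by split; [apply: Rmin_l | apply: Rmin_r].
have := Rmin_l (Re z - a) (b - Re z); have := Rmin_r (Re z - a) (b - Re z).
have := Rmin_l (Im z - c) (d - Im z); have := Rmin_r (Im z - c) (d - Im z).
move: hr hi; rewrite /Re /Im /= -/(Re w) -/(Im w) -/(Re z) -/(Im z).
by move=> /Rabs_def2 ? /Rabs_def2 ?; split; lra.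
Qed.

(** The exceptional point [p] makes the result applicable to difference quotients, which are at
    first only known to be continuous there. *)
Lemma primitive (F : C -> C) (p : C) (a b c d : R) : a < b -> c < d ->
  (forall z, orect a b c d z -> ccontC F z) ->
  (forall z, orect a b c d z -> z <> p -> hol F z) ->
  exists Q : C -> C, forall z, orect a b c d z -> cder Q z (F z).
Proof.
move=> hab hcd hF hp.
pose x0 := ((a + b) / 2)%R; pose y0 := ((c + d) / 2)%R.
exists (fun z => hint F y0 x0 (Re z) + Ci * vint F (Re z) y0 (Im z))%C => z hz.
have [r [r0 Hr]] := orect_nbhd hz.
apply/cderP => eps he.
have /ccont_epsC /(_ (eps / 2)%R) := hF z hz.
case; first lra.
move=> d1 [d10 Hd1].
have dd : 0 < Rmin r (d1 / 2) by apply: Rmin_glb_lt; lra.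
exists (Rmin r (d1 / 2)); split=> // w hw.
have hw1 : Cmod (w - z) < r by apply: Rlt_le_trans hw (Rmin_l _ _).
have hw2 : Cmod (w - z) < d1 / 2 by apply: Rlt_le_trans hw (Rmin_r _ _).
have wr := re_le_Cmod (w - z); have wi := im_le_Cmod (w - z).
have hwD : orect a b c d w by apply: Hr; lra.
have [zD1 zD2] := hz; have [wD1 wD2] := hwD.
have box t s : Rmin (Re z) (Re w) <= t <= Rmax (Re z) (Re w) ->
    Rmin (Im z) (Im w) <= s <= Rmax (Im z) (Im w) ->
    orect a b c d (t, s) /\ Rabs (t - Re z) <= Rabs (Re (w - z)) /\ Rabs (s - Im z) <= Rabs (Im (w - z)).
  move=> ht hs.
  have b1 : Rabs (t - Re z) <= Rabs (Re (w - z)).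
    rewrite /Re /= -/(Re w) -/(Re z).
    move: ht; rewrite /Rmin /Rmax; case: (Rle_dec (Re z) (Re w)) => ? ht;
      rewrite /Rabs; do 2!case: Rcase_abs => ?; lra.
  have b2 : Rabs (s - Im z) <= Rabs (Im (w - z)).
    rewrite /Im /= -/(Im w) -/(Im z).
    move: hs; rewrite /Rmin /Rmax; case: (Rle_dec (Im z) (Im w)) => ? hs;
      rewrite /Rabs; do 2!case: Rcase_abs => ?; lra.
  by split=> //; apply: Hr; [apply: Rle_lt_trans b1 _ | apply: Rle_lt_trans b2 _]; lra.
have small t s : Rmin (Re z) (Re w) <= t <= Rmax (Re z) (Re w) ->
    Rmin (Im z) (Im w) <= s <= Rmax (Im z) (Im w) -> Cmod (F (t, s) - F z) <= eps / 2.
  move=> ht hs; have [_ [b1 b2]] := box t s ht hs.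
  apply: Rlt_le; apply: Hd1; apply: Rle_lt_trans (Cmod_le_abs _) _.
  by apply: Rle_lt_trans (Rplus_le_compat _ _ _ _ b1 b2) _; lra.
have y0D : c < y0 < d by rewrite /y0; lra.
have x0D : a < x0 < b by rewrite /x0; lra.
have eh : cex (fun t => F (t, Im z)) (Re z) (Re w).
  apply: cex_cont => t ht; apply: ccont_hline; apply: hF.
  by case: (box t (Im z) ht); first by split; [apply: Rmin_l | apply: Rmax_l].
have ev : cex (fun t => F (Re w, t)) (Im z) (Im w).
  apply: cex_cont => t ht; apply: ccont_vline; apply: hF.
  by case: (box (Re w) t _ ht); first by split; [apply: Rmin_r | apply: Rmax_r].
have bH : forall x x' y, a < x < b -> a < x' < b -> c < y < d -> cex (fun t => F (t, y)) x x'.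
  move=> x x' y hx hx' hy; apply: cex_cont => t ht; apply: ccont_hline; apply: hF; split => //=.
  by move: ht; rewrite /Rmin /Rmax; case: Rle_dec => ?; lra.
have bV : forall y y' x, c < y < d -> c < y' < d -> a < x < b -> cex (fun t => F (x, t)) y y'.
  move=> y y' x hx hx' hy; apply: cex_cont => t ht; apply: ccont_vline; apply: hF; split => //=.
  by move: ht; rewrite /Rmin /Rmax; case: Rle_dec => ?; lra.
have E1 := signed_rect hF hp zD1 wD1 y0D zD2.
have E2 : (hint F y0 x0 (Re w) = hint F y0 x0 (Re z) + hint F y0 (Re z) (Re w))%C.
  by rewrite /hint cint_Chasles //; apply: bH.
have E3 : (vint F (Re w) y0 (Im w) = vint F (Re w) y0 (Im z) + vint F (Re w) (Im z) (Im w))%C.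
  by rewrite /vint cint_Chasles //; apply: bV.
(* The horizontal step is moved from height [y0] to height [Im z], so that the increment of the
   primitive becomes an integral over a short path near [z]. *)
have E4 : hint F y0 (Re z) (Re w) = (hint F (Im z) (Re z) (Re w) + Ci * vint F (Re z) y0 (Im z) - Ci * vint F (Re w) y0 (Im z))%C.
  by rewrite -(Cplus_0_r (hint F (Im z) (Re z) (Re w))) -E1; ring.
have E5 : (w - z)%C = (RtoC (Re w - Re z) + Ci * RtoC (Im w - Im z))%C.
  by apply: C_ext; rewrite /Re /Im /=; ring.
have -> : (hint F y0 x0 (Re w) + Ci * vint F (Re w) y0 (Im w) - (hint F y0 x0 (Re z) + Ci * vint F (Re z) y0 (Im z)) - F z * (w - z))%C =
  (cint (fun t => F (t, Im z) - F z) (Re z) (Re w) + Ci * cint (fun t => F (Re w, t) - F z) (Im z) (Im w))%C.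
  rewrite !cint_minus ?cint_const //; try exact: cex_const.
  rewrite E2 E3 E4 E5 /hint /vint; ring.
apply: Rle_trans (Cmod_triangle _ _) _; rewrite Cmod_mult Cmod_Ci Rmult_1_l.
have k1 : Cmod (cint (fun t => F (t, Im z) - F z) (Re z) (Re w))%C <= eps / 2 * Rabs (Re w - Re z).
  apply: cint_bound; first by apply: cex_minus => //; apply: cex_const.
  by move=> t ht; apply: small => //; split; [apply: Rmin_l | apply: Rmax_l].
have k2 : Cmod (cint (fun t => F (Re w, t) - F z) (Im z) (Im w))%C <= eps / 2 * Rabs (Im w - Im z).
  apply: cint_bound; first by apply: cex_minus => //; apply: cex_const.
  by move=> t ht; apply: small => //; split; [apply: Rmin_r | apply: Rmax_r].
have wr' : Rabs (Re w - Re z) <= Cmod (w - z) := wr.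
have wi' : Rabs (Im w - Im z) <= Cmod (w - z) := wi.
nra.
Qed.

Definition expi (t : R) : C := (cos t, sin t).
Definition circ (a : C) (r t : R) : C := (a + RtoC r * expi t)%C.

Lemma Cmod_expi (t : R) : Cmod (expi t) = 1.
Proof.
rewrite /Cmod /expi /=.
rewrite (_ : (cos t * (cos t * 1) + sin t * (sin t * 1))%R = 1); first exact: sqrt_1.
by have := sin2_cos2 t; rewrite /Rsqr; lra.
Qed.

Lemma expi_neq0 (t : R) : expi t <> 0.
Proof. by apply/Cmod_gt_0; rewrite Cmod_expi; lra. Qed.

Lemma Cmod_circ (a : C) (r t : R) : 0 < r -> Cmod (circ a r t - a) = r.
Proof.
move=> hr; rewrite (_ : (circ a r t - a = RtoC r * expi t)%C); last by rewrite /circ; ring.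
by rewrite Cmod_mult Cmod_expi Cmod_R Rabs_pos_eq; lra.
Qed.

Lemma circ_2PI (a : C) (r : R) : circ a r (2 * PI) = circ a r 0.
Proof. by rewrite /circ /expi cos_2PI sin_2PI cos_0 sin_0. Qed.

Lemma ccont_expi (t : R) : ccont expi t.
Proof.
by split; [apply: continuous_cos | apply: continuous_sin].
Qed.

Lemma ccont_circ (a : C) (r t : R) : ccont (circ a r) t.
Proof.
by apply: ccont_plus; [apply: ccont_const | apply: ccont_mult; [apply: ccont_const | apply: ccont_expi]].
Qed.

Lemma rder_circ (a : C) (r t : R) : rder (circ a r) t (Ci * (RtoC r * expi t)).
Proof.
case: a => x y; split; rewrite /Re /Im /=; auto_derive => //; ring.
Qed.

(** The weight [RtoC r * expi t] is the velocity of the circle divided by [i]. Circle integrals keep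
    this normalization, so Cauchy's formula will carry [2 * PI] and no [i]. *)
Lemma circle_primitive (Q F : C -> C) (a : C) (r : R) :
  (forall t, cder Q (circ a r t) (F (circ a r t)) /\ ccontC F (circ a r t)) ->
  cint (fun t => F (circ a r t) * (RtoC r * expi t))%C 0 (2 * PI) = 0.
Proof.
move=> h.
have cF t : ccont (fun t => F (circ a r t) * (RtoC r * expi t))%C t.
  apply: ccont_mult; first by apply: ccont_comp; [case: (h t) | apply: ccont_circ].
  by apply: ccont_mult; [apply: ccont_const | apply: ccont_expi].
have : (Ci * cint (fun t => F (circ a r t) * (RtoC r * expi t))%C 0 (2 * PI))%C = 0.
  rewrite -cint_scal; last by apply: cex_cont => t _.
  rewrite (cint_FTC (w := fun t => Q (circ a r t))).
  - by rewrite circ_2PI; ring.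
  - move=> t _; have [h1 h2] := h t; have := rder_comp h1 (rder_circ a r t).
    by rewrite (_ : (F (circ a r t) * (Ci * (RtoC r * expi t)) = Ci * (F (circ a r t) * (RtoC r * expi t)))%C) //; ring.
  - by move=> t _; apply: ccont_mult; [apply: ccont_const | apply: cF].
move=> E.
have Ci0 : Ci <> 0 by apply/Cmod_gt_0; rewrite Cmod_Ci; lra.
by rewrite -(Cmult_1_l (cint _ _ _)) -(Cinv_l Ci) // -Cmult_assoc E; ring.
Qed.

(** Differentiation under the integral sign from a remainder that is quadratic uniformly in [t]; for
    Cauchy kernels the remainder is an explicit fraction. *)
Lemma cint_cder (k : R -> C -> C) (k' : R -> C) (z : C) (rho M al be : R) :
  al <= be -> 0 < rho -> 0 <= M ->
  (forall z', Cmod (z' - z) < rho -> ccont_on (fun t => k t z') al be) ->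
  ccont_on k' al be ->
  (forall t z', al <= t <= be -> Cmod (z' - z) < rho ->
    Cmod (k t z' - k t z - k' t * (z' - z))%C <= M * (Cmod (z' - z) * Cmod (z' - z))) ->
  cder (fun z' => cint (fun t => k t z') al be) z (cint k' al be).
Proof.
move=> hab hr hM hk hk' H; apply/cderP => eps he.
have h1 : 0 <= M * (be - al) by apply: Rmult_le_pos; lra.
have h2 : 0 < eps / (1 + M * (be - al)) by apply: Rdiv_lt_0_compat; lra.
exists (Rmin rho (eps / (1 + M * (be - al)))); split; first exact: Rmin_glb_lt.
move=> w hw.
have w1 : Cmod (w - z) < rho by apply: Rlt_le_trans hw (Rmin_l _ _).
have w2 : Cmod (w - z) < eps / (1 + M * (be - al)) by apply: Rlt_le_trans hw (Rmin_r _ _).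
have z0 : Cmod (z - z) < rho by rewrite (_ : (z - z = 0)%C) ?Cmod_0 //; ring.
have e1 := cex_cont (hk _ w1); have e2 := cex_cont (hk _ z0); have e3 := cex_cont hk'.
rewrite (Cmult_comm (cint k' al be)) -cint_scal // -!cint_minus //; [|exact: cex_minus | exact: cex_scal].
have := @cint_bound (fun t => k t w - k t z - (w - z) * k' t)%C (M * (Cmod (w - z) * Cmod (w - z))) al be.
rewrite (Rabs_pos_eq (be - al)); last lra.
move=> B; apply: Rle_trans (B _ _) _.
- by apply: cex_minus; [apply: cex_minus | apply: cex_scal].
- rewrite Rmin_left // Rmax_right // => t ht; rewrite (Cmult_comm (w - z)); exact: H.
have := Cmod_ge_0 (w - z) => ?.
have : Cmod (w - z) * (1 + M * (be - al)) <= eps.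
  by apply: Rlt_le; apply/Rlt_div_r => //; lra.
nra.
Qed.

Lemma ccont_bounded (f : R -> C) (a b : R) : a <= b ->
  (forall t, a <= t <= b -> ccont f t) ->
  exists M, 0 < M /\ forall t, a <= t <= b -> Cmod (f t) <= M.
Proof.
move=> hab h.
have hc t : a <= t <= b -> continuity_pt (fun t => Cmod (f t)) t.
  move=> /h /ccont_epsR H; apply/continuity_pt_filterlim; apply/filterlim_locally => eps.
  have [d [d0 Hd]] := H eps (cond_pos eps).
  exists (mkposreal _ d0) => u /Hd hu.
  rewrite /ball /= /AbsRing_ball /abs /minus /plus /opp /=.
  apply: Rle_lt_trans hu; apply/Rabs_le.
  have := Cmod_triangle_inv (f u) (f t); have := Cmod_triangle_inv (f t) (f u).
  rewrite (Cmod_sub_sym (f t)); lra.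
have [m [Hm _]] := continuity_ab_maj (fun t => Cmod (f t)) a b hab hc.
exists (Cmod (f m) + 1); split; first by have := Cmod_ge_0 (f m); lra.
move=> t ht; have := Hm t ht; lra.
Qed.

Lemma circ_dist (a z : C) (r t : R) : 0 < r -> r - Cmod (z - a) <= Cmod (circ a r t - z).
Proof.
move=> hr; have := Cmod_triangle_inv (circ a r t - a) (z - a).
by rewrite Cmod_circ // (_ : (circ a r t - a - (z - a) = circ a r t - z)%C) //; ring.
Qed.

Lemma circ_neq (a z : C) (r t : R) : Cmod (z - a) < r -> (circ a r t - z)%C <> 0.
Proof.
move=> h; apply/Cmod_gt_0; have := @circ_dist a z r t; have := Cmod_ge_0 (z - a); lra.
Qed.

Lemma circ_sub (a : C) (r t : R) : (circ a r t - a = RtoC r * expi t)%C.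
Proof. by rewrite /circ; ring. Qed.

Lemma PI2_pos : 0 <= 2 * PI.
Proof. have := PI_RGT_0; lra. Qed.

Lemma kernel1_cder (phi : R -> C) (a z : C) (r : R) :
  (forall t, ccont phi t) -> Cmod (z - a) < r ->
  cder (fun z' => cint (fun t => phi t / (circ a r t - z'))%C 0 (2 * PI)) z
    (cint (fun t => phi t / ((circ a r t - z) * (circ a r t - z)))%C 0 (2 * PI)).
Proof.
move=> hphi hz.
have r0 : 0 < r by have := Cmod_ge_0 (z - a); lra.
have [B [B0 HB]] := ccont_bounded PI2_pos (fun t _ => hphi t).
have [rho [rho0 hrho]] : exists rho, 0 < rho /\ 2 * rho = (r - Cmod (z - a))%R.
  by exists ((r - Cmod (z - a)) / 2)%R; lra.
have cw z' t : ccont (fun t => circ a r t - z')%C t.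
  by apply: ccont_minus; [apply: ccont_circ | apply: ccont_const].
have close z' : Cmod (z' - z) < rho -> Cmod (z' - a) + rho < r.
  move=> h; have := Cmod_triangle (z' - z) (z - a).
  by rewrite (_ : (z' - z + (z - a) = z' - a)%C); [lra | ring].
apply: (cint_cder (k := fun t z' => (phi t / (circ a r t - z'))%C) (rho := rho) (M := B / (rho * rho * rho))) => //.
- exact: PI2_pos.
- by apply: Rlt_le; apply: Rdiv_lt_0_compat => //; do !apply: Rmult_lt_0_compat.
- by move=> z' hz' t _; apply: ccont_div => //; apply: circ_neq; have := close z' hz'; lra.
- by move=> t _; apply: ccont_div => //; [apply: Cmult_neq_0; apply: circ_neq | apply: ccont_mult].
move=> t z' ht hz'.
have n1 := circ_neq (t := t) hz.
have n2 : (circ a r t - z')%C <> 0 by apply: circ_neq; have := close z' hz'; lra.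
have -> : (phi t / (circ a r t - z') - phi t / (circ a r t - z) -
   phi t / ((circ a r t - z) * (circ a r t - z)) * (z' - z))%C =
   (phi t * ((z' - z) * (z' - z)) / ((circ a r t - z) * (circ a r t - z) * (circ a r t - z')))%C.
  by field.
rewrite Cmod_div; last by do 2?apply: Cmult_neq_0.
rewrite !Cmod_mult.
have d1 : rho <= Cmod (circ a r t - z) by have := @circ_dist a z r t r0; lra.
have d2 : rho <= Cmod (circ a r t - z').
  by have := @circ_dist a z' r t r0; have := close z' hz'; lra.
have hB := HB t ht.
apply/Rle_div_l.
  by do 2?apply: Rmult_lt_0_compat; lra.
set h2 := (Cmod (z' - z) * Cmod (z' - z))%R.
have h20 : 0 <= h2 by apply: Rmult_le_pos; apply: Cmod_ge_0.
have k1 : rho * rho * rho <= Cmod (circ a r t - z) * Cmod (circ a r t - z) * Cmod (circ a r t - z').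
  by apply: Rmult_le_compat; try lra; [nra | apply: Rmult_le_compat; lra].
have k0 : 0 < rho * rho * rho by do 2?apply: Rmult_lt_0_compat.
apply: (Rle_trans _ (B * h2)); first by apply: Rmult_le_compat_r.
have -> : (B * h2 = B / (rho * rho * rho) * h2 * (rho * rho * rho))%R by field; lra.
apply: Rmult_le_compat_l => //; apply: Rmult_le_pos => //.
by apply: Rlt_le; apply: Rdiv_lt_0_compat.
Qed.

(** The derivative of a holomorphic function is an integral of this kernel, so this is what makes
    the derivative holomorphic again. *)
Lemma kernel2_hol (phi : R -> C) (a z : C) (r : R) :
  (forall t, ccont phi t) -> Cmod (z - a) < r ->
  hol (fun z' => cint (fun t => phi t / ((circ a r t - z') * (circ a r t - z')))%C 0 (2 * PI)) z.
Proof.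
move=> hphi hz.
have r0 : 0 < r by have := Cmod_ge_0 (z - a); lra.
have [B [B0 HB]] := ccont_bounded PI2_pos (fun t _ => hphi t).
have [rho [rho0 hrho]] : exists rho, 0 < rho /\ 2 * rho = (r - Cmod (z - a))%R.
  by exists ((r - Cmod (z - a)) / 2)%R; lra.
have cw z' t : ccont (fun t => circ a r t - z')%C t.
  by apply: ccont_minus; [apply: ccont_circ | apply: ccont_const].
have close z' : Cmod (z' - z) < rho -> Cmod (z' - a) + rho < r.
  move=> h; have := Cmod_triangle (z' - z) (z - a).
  by rewrite (_ : (z' - z + (z - a) = z' - a)%C); [lra | ring].
exists (cint (fun t => (1 + 1) * phi t / ((circ a r t - z) * (circ a r t - z) * (circ a r t - z)))%C 0 (2 * PI)).
apply: (cint_cder (k := fun t z' => (phi t / ((circ a r t - z') * (circ a r t - z')))%C) (rho := rho)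
  (M := 5 * B / (rho * rho * rho * rho))) => //.
- exact: PI2_pos.
- by apply: Rlt_le; apply: Rdiv_lt_0_compat; do ?apply: Rmult_lt_0_compat; lra.
- move=> z' hz' t _; apply: ccont_div => //; last by apply: ccont_mult.
  by apply: Cmult_neq_0; apply: circ_neq; have := close z' hz'; lra.
- move=> t _; apply: ccont_div => //.
  + by do 2?apply: Cmult_neq_0; apply: circ_neq.
  + by apply: ccont_mult => //; apply: ccont_const.
  + by do 2?apply: ccont_mult.
move=> t z' ht hz'.
have n1 := circ_neq (t := t) hz.
have n2 : (circ a r t - z')%C <> 0 by apply: circ_neq; have := close z' hz'; lra.
have -> : (phi t / ((circ a r t - z') * (circ a r t - z')) - phi t / ((circ a r t - z) * (circ a r t - z)) -
   (1 + 1) * phi t / ((circ a r t - z) * (circ a r t - z) * (circ a r t - z)) * (z' - z))%C =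
   (phi t * ((z' - z) * (z' - z)) * ((circ a r t - z) + (1 + 1) * (circ a r t - z')) /
     ((circ a r t - z) * (circ a r t - z) * (circ a r t - z) * ((circ a r t - z') * (circ a r t - z'))))%C.
  by field.
rewrite Cmod_div; last by do 4?apply: Cmult_neq_0.
rewrite !Cmod_mult.
have d1 : 2 * rho <= Cmod (circ a r t - z) by have := @circ_dist a z r t r0; lra.
have d2 : rho <= Cmod (circ a r t - z').
  by have := @circ_dist a z' r t r0; have := close z' hz'; lra.
have hB := HB t ht.
(* The bracket equals [3 (circ - z) - 2 (z' - z)], and [|z' - z| < rho] is at most half of
   [|circ - z|]. This is the origin of the 5 in [M]. *)
have s : Cmod ((circ a r t - z) + (1 + 1) * (circ a r t - z')) <= 5 * Cmod (circ a r t - z).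
  rewrite (_ : ((circ a r t - z) + (1 + 1) * (circ a r t - z') = RtoC 3 * (circ a r t - z) - RtoC 2 * (z' - z))%C).
    apply: Rle_trans (Cmod_triangle _ _) _; rewrite Cmod_opp !Cmod_mult !Cmod_R !Rabs_pos_eq; lra.
  by apply: C_ext; rewrite /Re /Im /=; ring.
set A := Cmod (circ a r t - z) in d1 s *.
set A' := Cmod (circ a r t - z') in d2 *.
apply/Rle_div_l.
  by do 4?apply: Rmult_lt_0_compat; lra.
set h2 := (Cmod (z' - z) * Cmod (z' - z))%R.
have h20 : 0 <= h2 by apply: Rmult_le_pos; apply: Cmod_ge_0.
have rr : 0 < rho * rho by apply: Rmult_lt_0_compat.
have k2 : rho * rho <= A * A by apply: Rmult_le_compat; lra.
have k3 : rho * rho <= A' * A' by apply: Rmult_le_compat; lra.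
have k1 : rho * rho * rho * rho <= A * A * (A' * A').
  rewrite Rmult_assoc; apply: Rmult_le_compat; lra.
have k0 : 0 < rho * rho * rho * rho by rewrite Rmult_assoc; apply: Rmult_lt_0_compat.
apply: (Rle_trans _ (B * h2 * (5 * A))).
  apply: Rmult_le_compat => //; try exact: Cmod_ge_0.
    by apply: Rmult_le_pos => //; apply: Cmod_ge_0.
  by apply: Rmult_le_compat_r.
have -> : (B * h2 * (5 * A) = 5 * B / (rho * rho * rho * rho) * h2 * A * (rho * rho * rho * rho))%R by field; lra.
have -> : (5 * B / (rho * rho * rho * rho) * h2 * (A * A * A * (A' * A')) =
  5 * B / (rho * rho * rho * rho) * h2 * A * (A * A * (A' * A')))%R by ring.
apply: Rmult_le_compat_l => //; apply: Rmult_le_pos; last lra.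
by apply: Rmult_le_pos => //; apply: Rlt_le; apply: Rdiv_lt_0_compat; lra.
Qed.

(** As a function of [z] the integral has derivative 0, since [1 / (w - z)^2] has the primitive
    [- 1 / (w - z)] along the closed circle. Moving along the segment from [a] to [z] reduces the
    claim to the centre, where the integrand is 1. *)
Lemma winding (a z : C) (r : R) : Cmod (z - a) < r ->
  cint (fun t => (RtoC r * expi t) / (circ a r t - z))%C 0 (2 * PI) = RtoC (2 * PI).
Proof.
move=> hz.
have r0 : 0 < r by have := Cmod_ge_0 (z - a); lra.
have Ci0 : Ci <> 0 by apply/Cmod_gt_0; rewrite Cmod_Ci; lra.
have cphi t : ccont (fun t => RtoC r * expi t)%C t.
  by apply: ccont_mult; [apply: ccont_const | apply: ccont_expi].
pose W z := cint (fun t => (RtoC r * expi t) / (circ a r t - z))%C 0 (2 * PI).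
have dW z' : Cmod (z' - a) < r -> cder W z' 0.
  move=> hz'; apply: (cder_eq (kernel1_cder cphi hz')).
  pose v t := ((RtoC r * expi t) / ((circ a r t - z') * (circ a r t - z')))%C.
  have cv t : ccont v t.
    apply: ccont_div => //; first by apply: Cmult_neq_0; apply: circ_neq.
    by apply: ccont_mult; apply: ccont_minus; by [apply: ccont_circ | apply: ccont_const].
  have : (Ci * cint v 0 (2 * PI))%C = 0.
    rewrite -cint_scal; last by apply: cex_cont => t _.
    rewrite (cint_FTC (w := fun t => (- / (circ a r t - z'))%C)).
    - by rewrite circ_2PI; ring.
    - move=> t _.
      have h1 := cder_minus (cder_id (circ a r t)) (cder_const z' (circ a r t)).
      have h2 := cder_opp (@cder_inv (fun w => w - z')%C (circ a r t) _ (circ_neq (t := t) hz') h1).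
      have := rder_comp h2 (rder_circ a r t).
      by rewrite (_ : (- (- (1 - 0) / ((circ a r t - z') * (circ a r t - z'))) * (Ci * (RtoC r * expi t)) = Ci * v t)%C) //;
        rewrite /v; field; apply: circ_neq.
    - by move=> t _; apply: ccont_mult => //; apply: ccont_const.
  by move=> E; rewrite -(Cmult_1_l (cint _ _ _)) -(Cinv_l Ci) // -Cmult_assoc E; ring.
have seg t : 0 <= t <= 1 -> Cmod (a + RtoC t * (z - a) - a) < r.
  move=> ht; rewrite (_ : (a + RtoC t * (z - a) - a = RtoC t * (z - a))%C); last ring.
  rewrite Cmod_mult Cmod_R Rabs_pos_eq; last lra.
  by have := Cmod_ge_0 (z - a); nra.
have E : cint (fun=> RtoC 0) 0 1 = (W (a + RtoC 1 * (z - a)) - W (a + RtoC 0 * (z - a)))%C.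
  apply: (cint_FTC (w := fun t => W (a + RtoC t * (z - a))%C)) => t; rewrite Rmin_left ?Rmax_right; try lra.
  - move=> ht; rewrite -(Cmult_0_l (z - a)).
    apply: (rder_comp (w := fun t => (a + RtoC t * (z - a))%C)); first by apply: dW; apply: seg.
    by case: a z {hz cphi W dW seg ht} => a1 a2 [z1 z2]; split; rewrite /Re /Im /=; auto_derive => //; ring.
  - by move=> _; apply: ccont_const.
move: E; rewrite cint_const Cmult_0_r (_ : (a + RtoC 1 * (z - a) = z)%C); last ring.
rewrite (_ : (a + RtoC 0 * (z - a) = a)%C); last ring.
have -> : W a = RtoC (2 * PI).
  rewrite /W (cint_ext (g := fun=> 1)); first by rewrite cint_const Cmult_1_r Rminus_0_r.
  move=> t _; rewrite circ_sub; apply: Cinv_r; apply: Cmult_neq_0; last exact: expi_neq0.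
  by move=> /RtoC_inj; lra.
move=> E; rewrite -/(W z) -(Cplus_0_l (RtoC (2 * PI))) E; ring.
Qed.

(** The difference quotient with its singularity removed. It serves first for Cauchy's formula and
    later for dividing out zeros. *)
Definition quot (F : C -> C) (p : C) (w : C) : C :=
  if excluded_middle_informative (w = p) then C_derive F p else ((F w - F p) / (w - p))%C.

Lemma quotE (F : C -> C) (p w : C) : w <> p -> quot F p w = ((F w - F p) / (w - p))%C.
Proof. by rewrite /quot; case: excluded_middle_informative. Qed.

Lemma quot_factor (F : C -> C) (p w : C) : (F w = F p + (w - p) * quot F p w)%C.
Proof.
rewrite /quot; case: excluded_middle_informative => [e|h] /=; first by rewrite e; ring.
field; move=> E; apply: h; rewrite -(Cplus_0_l p) -E; ring.
Qed.

Lemma Csub_eq0 (a b : C) : (a - b = 0)%C -> a = b.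
Proof. by move=> E; rewrite -(Cplus_0_l b) -E; ring. Qed.

Lemma Csub_neq0 (w p : C) : w <> p -> (w - p)%C <> 0.
Proof. by move=> h E; apply: h; rewrite -(Cplus_0_l p) -E; ring. Qed.

Lemma quot_hol_off (F : C -> C) (p w : C) : w <> p -> hol F w -> hol (quot F p) w.
Proof.
move=> hwp hF; have h0 := Csub_neq0 hwp.
apply: (hol_ext (F := fun w => ((F w - F p) / (w - p))%C)).
  exists (Cmod (w - p)); split; first by apply/Cmod_gt_0.
  move=> u hu; rewrite quotE // => E.
  by move: hu; rewrite E Cmod_sub_sym; lra.
apply: hol_div => //; apply: hol_minus => //; by [apply: hol_const | apply: hol_id].
Qed.

Lemma quot_ccont (F : C -> C) (p : C) : hol F p -> ccontC (quot F p) p.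
Proof.
move=> /hol_der /cderP H; apply/ccont_epsC => eps he.
have e2 : 0 < eps / 2 by lra.
have [d [d0 Hd]] := H _ e2; exists d; split=> // w hw.
case: (classic (w = p)) => [->|hwp].
  by rewrite (_ : (quot F p p - quot F p p = 0)%C) ?Cmod_0 //; ring.
have h0 := Csub_neq0 hwp.
have m0 : 0 < Cmod (w - p) by apply/Cmod_gt_0.
rewrite quotE // /quot; case: excluded_middle_informative => e //=.
rewrite (_ : ((F w - F p) / (w - p) - C_derive F p = (F w - F p - C_derive F p * (w - p)) / (w - p))%C);
  last by field.
rewrite Cmod_div //; apply: (Rle_lt_trans _ (eps / 2)); last lra.
by apply/Rle_div_l => //; apply: Hd.
Qed.

Lemma quot_ccont_all (F : C -> C) (p w : C) : hol F p -> hol F w ->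
  ccontC (quot F p) w.
Proof.
move=> hp hw; case: (classic (w = p)) => [->|h]; first exact: quot_ccont.
by apply: hol_ccont; apply: quot_hol_off.
Qed.

(** * Cauchy's formula and its consequences on a disc *)

Section Disc.
Variables (F : C -> C) (x0 x1 y0 y1 : R) (a : C) (r : R).
Hypothesis hF : forall w, orect x0 x1 y0 y1 w -> hol F w.
Hypothesis hD : forall w, Cmod (w - a) <= r -> orect x0 x1 y0 y1 w.
Hypothesis r0 : 0 < r.

Let circD t : orect x0 x1 y0 y1 (circ a r t).
Proof. by apply: hD; rewrite Cmod_circ //; lra. Qed.

Let aD : orect x0 x1 y0 y1 a.
Proof. by apply: hD; rewrite (_ : (a - a = 0)%C) ?Cmod_0; [lra | ring]. Qed.

Let hx : x0 < x1. Proof. by case: aD; lra. Qed.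
Let hy : y0 < y1. Proof. by case: aD; lra. Qed.

Let cF t : ccont (fun t => F (circ a r t)) t.
Proof. by apply: ccont_comp; [apply/hol_ccont/hF | apply: ccont_circ]. Qed.

Let cFe t : ccont (fun t => F (circ a r t) * (RtoC r * expi t))%C t.
Proof.
by apply: ccont_mult => //; apply: ccont_mult; [apply: ccont_const | apply: ccont_expi].
Qed.

Lemma cauchy_closed :
  cint (fun t => F (circ a r t) * (RtoC r * expi t))%C 0 (2 * PI) = 0.
Proof.
have [Q hQ] := @primitive F a x0 x1 y0 y1 hx hy (fun z hz => hol_ccont (hF hz)) (fun z hz _ => hF hz).
by apply: (circle_primitive (Q := Q)) => t; split; [apply: hQ | apply/hol_ccont/hF].
Qed.

(** [quot F z] has a primitive, hence a vanishing circle integral; the rest of the integrand is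
    [F z] times the one of [winding]. *)
Lemma cauchy_formula (z : C) : Cmod (z - a) < r ->
  cint (fun t => F (circ a r t) * (RtoC r * expi t) / (circ a r t - z))%C 0 (2 * PI)
  = (RtoC (2 * PI) * F z)%C.
Proof.
move=> hz.
have zD : orect x0 x1 y0 y1 z by apply: hD; lra.
have [Q hQ] : exists Q, forall w, orect x0 x1 y0 y1 w -> cder Q w (quot F z w).
  apply: (primitive (p := z) hx hy) => w hw.
  - by apply: quot_ccont_all; apply: hF.
  - by move=> h; apply: quot_hol_off => //; apply: hF.
have := circle_primitive (Q := Q) (F := quot F z) (a := a) (r := r).
move=> /(_ _) E.
have {}E := E (fun t => conj (hQ _ (circD t)) (quot_ccont_all (hF zD) (hF (circD t)))).
have c1 t : ccont (fun t => F (circ a r t) * (RtoC r * expi t) / (circ a r t - z))%C t.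
  apply: ccont_div => //; first exact: circ_neq.
  by apply: ccont_minus; [apply: ccont_circ | apply: ccont_const].
have c2 t : ccont (fun t => (RtoC r * expi t) / (circ a r t - z))%C t.
  apply: ccont_div; first exact: circ_neq.
  - by apply: ccont_mult; [apply: ccont_const | apply: ccont_expi].
  - by apply: ccont_minus; [apply: ccont_circ | apply: ccont_const].
have e2 : cex (fun t => (RtoC r * expi t) / (circ a r t - z))%C 0 (2 * PI) by apply: cex_cont => t _.
rewrite -(winding hz) Cmult_comm -cint_scal //.
apply: Csub_eq0; rewrite -cint_minus; last 2 first.
- by apply: cex_cont => t _.
- exact: cex_scal.
rewrite -[RHS]E; apply: cint_ext => t _; rewrite quotE.
  by field; apply: circ_neq.
by move=> E'; apply: (circ_neq (t := t) hz); rewrite E'; ring.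
Qed.

Lemma mean_value : cint (fun t => F (circ a r t)) 0 (2 * PI) = (RtoC (2 * PI) * F a)%C.
Proof.
rewrite -cauchy_formula; last by rewrite (_ : (a - a = 0)%C) ?Cmod_0; [|ring].
apply: cint_ext => t _; rewrite circ_sub; field; split; first exact: expi_neq0.
by move=> /RtoC_inj; lra.
Qed.

Lemma max_modulus (M : R) : (forall t, Cmod (F (circ a r t)) <= M) -> Cmod (F a) <= M.
Proof.
move=> hM; have P0 := PI_RGT_0.
have := cint_bound (f := fun t => F (circ a r t)) (M := M) (a := 0) (b := 2 * PI).
rewrite mean_value Cmod_mult Cmod_R Rminus_0_r Rabs_pos_eq; last lra.
move=> H; apply: (Rmult_le_reg_l (2 * PI)); first lra.
rewrite (Rmult_comm _ M); apply: H => //.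
by apply: cex_cont => t _.
Qed.

(** The difference of Cauchy's formulas at [z] and at [a]; the circle stays at distance at least
    [r / 2] from [z], which gives the factor 2. *)
Lemma lipschitz_disc (M : R) (z : C) : (forall t, Cmod (F (circ a r t)) <= M) ->
  Cmod (z - a) <= r / 2 -> Cmod (F z - F a) <= 2 * M / r * Cmod (z - a).
Proof.
move=> hM hz; have P0 := PI_RGT_0.
have a0 : Cmod (a - a) < r by rewrite (_ : (a - a = 0)%C) ?Cmod_0; [|ring].
have zr : Cmod (z - a) < r by lra.
have ce u t : Cmod (u - a) < r -> ccont (fun t => F (circ a r t) * (RtoC r * expi t) / (circ a r t - u))%C t.
  move=> hu; apply: ccont_div => //; first exact: circ_neq.
  by apply: ccont_minus; [apply: ccont_circ | apply: ccont_const].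
have e1 : cex (fun t => F (circ a r t) * (RtoC r * expi t) / (circ a r t - z))%C 0 (2 * PI).
  by apply: cex_cont => t _; apply: ce.
have e2 : cex (fun t => F (circ a r t) * (RtoC r * expi t) / (circ a r t - a))%C 0 (2 * PI).
  by apply: cex_cont => t _; apply: ce.
have E : (RtoC (2 * PI) * (F z - F a))%C = cint (fun t => F (circ a r t) * (RtoC r * expi t) / (circ a r t - z) -
   F (circ a r t) * (RtoC r * expi t) / (circ a r t - a))%C 0 (2 * PI).
  by rewrite cint_minus // !cauchy_formula //; ring.
have hb := cint_bound (M := 2 * M / r * Cmod (z - a)) (cex_minus e1 e2).
apply: (Rmult_le_reg_l (2 * PI)); first lra.
move: hb; rewrite -E Cmod_mult Cmod_R Rminus_0_r Rabs_pos_eq; last lra.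
move=> hb; rewrite (Rmult_comm _ (2 * M / r * Cmod (z - a))); apply: hb => t _.
have n1 := circ_neq (t := t) zr; have n2 := circ_neq (t := t) a0.
rewrite (_ : (F (circ a r t) * (RtoC r * expi t) / (circ a r t - z) - F (circ a r t) * (RtoC r * expi t) / (circ a r t - a) =
  F (circ a r t) * ((RtoC r * expi t) * (z - a)) / ((circ a r t - z) * (circ a r t - a)))%C); last by field.
rewrite Cmod_div; last exact: Cmult_neq_0.
rewrite !Cmod_mult Cmod_circ // Cmod_expi Cmod_R Rabs_pos_eq; last lra.
have d := @circ_dist a z r t r0.
have m0 := Cmod_ge_0 (F (circ a r t)); have mM := hM t; have za := Cmod_ge_0 (z - a).
apply/Rle_div_l; first by apply: Rmult_lt_0_compat; lra.
have -> : (2 * M / r * Cmod (z - a) * (Cmod (circ a r t - z) * r) = M * Cmod (z - a) * (2 * Cmod (circ a r t - z)))%R.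
  by field; lra.
have -> : (Cmod (F (circ a r t)) * (r * 1 * Cmod (z - a)) = Cmod (F (circ a r t)) * Cmod (z - a) * r)%R by ring.
by apply: Rmult_le_compat; try nra.
Qed.

Lemma cauchy_derivative (z : C) : Cmod (z - a) < r ->
  cder F z (RtoC (/ (2 * PI)) *
    cint (fun t => F (circ a r t) * (RtoC r * expi t) / ((circ a r t - z) * (circ a r t - z)))%C 0 (2 * PI))%C.
Proof.
move=> hz; have P0 := PI_RGT_0.
apply: (cder_ext (F := fun z' => (RtoC (/ (2 * PI)) *
  cint (fun t => F (circ a r t) * (RtoC r * expi t) / (circ a r t - z'))%C 0 (2 * PI))%C)).
  exists (r - Cmod (z - a))%R; split; first lra.
  move=> w hw; rewrite cauchy_formula.
    by rewrite Cmult_assoc -RtoC_mult Rinv_l ?Cmult_1_l //; lra.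
  have := Cmod_triangle (w - z) (z - a).
  by rewrite (_ : (w - z + (z - a) = w - a)%C); [lra | ring].
by apply: cder_scal; apply: kernel1_cder.
Qed.

Lemma hol_C_derive : hol (C_derive F) a.
Proof.
apply: (hol_ext (F := fun z => (RtoC (/ (2 * PI)) *
    cint (fun t => F (circ a r t) * (RtoC r * expi t) / ((circ a r t - z) * (circ a r t - z)))%C 0 (2 * PI))%C)).
  by exists r; split=> // w hw; rewrite (is_C_derive_unique _ _ _ (cauchy_derivative hw)).
apply: hol_mult; first exact: hol_const.
by apply: kernel2_hol => //; rewrite (_ : (a - a = 0)%C) ?Cmod_0; [|ring].
Qed.

(** The derivative as a Fourier coefficient of [F] on the circle, the form in which it can be
    combined with the coefficient of the conjugate function. *)
Lemma derivative_center :
  (RtoC (2 * PI) * (RtoC r * C_derive F a))%C = cint (fun t => F (circ a r t) * / expi t)%C 0 (2 * PI).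
Proof.
have P0 := PI_RGT_0.
have a0 : Cmod (a - a) < r by rewrite (_ : (a - a = 0)%C) ?Cmod_0; [|ring].
have rn : RtoC r <> 0 by move=> /RtoC_inj; lra.
rewrite (is_C_derive_unique _ _ _ (cauchy_derivative a0)).
have E t : (F (circ a r t) * (RtoC r * expi t) / ((circ a r t - a) * (circ a r t - a)) =
   / RtoC r * (F (circ a r t) * / expi t))%C.
  by rewrite circ_sub; field; split=> //; exact: expi_neq0.
rewrite (cint_ext (fun t _ => E t)) cint_scal; last first.
  apply: cex_cont => t _; apply: ccont_mult => //.
  by apply: ccont_inv; [exact: expi_neq0 | exact: ccont_expi].
rewrite RtoC_inv; last lra.
by field; split=> // /RtoC_inj; lra.
Qed.

End Disc.

(** Equality on [R] and [C] is decided classically, so that membership, multiplicities and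
    permutations of lists of zeros make sense. *)
Definition R_eqb (x y : R) : bool := if Req_EM_T x y then true else false.
Lemma R_eqbP : Equality.axiom R_eqb.
Proof. by move=> x y; rewrite /R_eqb; case: Req_EM_T => ?; constructor. Qed.
HB.instance Definition _ := hasDecEq.Build R R_eqbP.
HB.instance Definition _ := Equality.copy C (R * R)%type.

(** * Zeros and logarithmic derivatives *)

Lemma hol_C_derive_rect (F : C -> C) (x0 x1 y0 y1 : R) :
  (forall w, orect x0 x1 y0 y1 w -> hol F w) ->
  forall w, orect x0 x1 y0 y1 w -> hol (C_derive F) w.
Proof.
move=> hF w hw; have [r [r0 Hr]] := orect_nbhd hw.
apply: (hol_C_derive (r := r / 2) hF); last lra.
move=> u hu; apply: Hr.
- by have := re_le_Cmod (u - w); lra.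
- by have := im_le_Cmod (u - w); lra.
Qed.

Lemma orect_big (z : C) (R0 : R) : exists x0 x1 y0 y1,
  forall w, Cmod (w - z) <= R0 -> orect x0 x1 y0 y1 w.
Proof.
exists (Re z - R0 - 1)%R, (Re z + R0 + 1)%R, (Im z - R0 - 1)%R, (Im z + R0 + 1)%R => w hw.
have h1 : Rabs (Re w - Re z) <= R0 by apply: Rle_trans hw; apply: (re_le_Cmod (w - z)).
have h2 : Rabs (Im w - Im z) <= R0 by apply: Rle_trans hw; apply: (im_le_Cmod (w - z)).
by move: h1 h2 => /Rabs_le_between ? /Rabs_le_between ?; split; lra.
Qed.

Lemma entire_hol (F : C -> C) (z : C) : entire F -> hol F z.
Proof. by move=> h; apply/holE. Qed.

Lemma entire_C_derive (F : C -> C) : entire F -> entire (C_derive F).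
Proof.
move=> hF z; apply/holE.
have [x0 [x1 [y0 [y1 H]]]] := orect_big z 1.
apply: (hol_C_derive_rect (x0 := x0) (x1 := x1) (y0 := y0) (y1 := y1)).
  by move=> w _; apply: entire_hol.
by apply: H; rewrite (_ : (z - z = 0)%C) ?Cmod_0; [lra | ring].
Qed.

(* The quotient is continuous at [p], hence has a primitive; the derivative of
   a holomorphic function is holomorphic. *)
Lemma quot_hol (F : C -> C) (p : C) (x0 x1 y0 y1 : R) :
  orect x0 x1 y0 y1 p -> (forall w, orect x0 x1 y0 y1 w -> hol F w) ->
  forall w, orect x0 x1 y0 y1 w -> hol (quot F p) w.
Proof.
move=> hp hF w hw.
have [Q hQ] : exists Q, forall u, orect x0 x1 y0 y1 u -> cder Q u (quot F p u).
  apply: (primitive (p := p)).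
  - by case: hp; lra.
  - by case: hp; lra.
  - by move=> z hz; apply: quot_ccont_all; apply: hF.
  - by move=> z hz zp; apply: quot_hol_off => //; apply: hF.
apply: (hol_ext (F := C_derive Q)).
  have [r [r0 Hr]] := orect_nbhd hw; exists r; split=> // u hu.
  apply: is_C_derive_unique; apply: hQ; apply: Hr.
  - by have := re_le_Cmod (u - w); lra.
  - by have := im_le_Cmod (u - w); lra.
by apply: (hol_C_derive_rect (F := Q) _ hw) => u hu; eexists; apply: hQ.
Qed.

Lemma entire_quot (F : C -> C) (p : C) : entire F -> entire (quot F p).
Proof.
move=> hF z; apply/holE.
have [x0 [x1 [y0 [y1 H]]]] := orect_big z (Cmod (p - z)).
apply: (quot_hol (x0 := x0) (x1 := x1) (y0 := y0) (y1 := y1)).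
- by apply: H; lra.
- by move=> w _; apply: entire_hol.
- by apply: H; rewrite (_ : (z - z = 0)%C) ?Cmod_0; [apply: Cmod_ge_0 | ring].
Qed.

(** Repetitions in [l] encode multiplicities. *)
Fixpoint lprod (l : seq C) (s : C) : C :=
  if l is p :: l' then ((s - p) * lprod l' s)%C else 1.

Lemma lprod_lower (l : seq C) (s : C) (c : R) : 0 <= c ->
  (forall p, p \in l -> c <= Cmod (s - p)) -> c ^ size l <= Cmod (lprod l s).
Proof.
move=> hc; elim: l => [|p l ih] h /=; first by rewrite Cmod_1; lra.
rewrite Cmod_mult; apply: Rmult_le_compat => //.
- exact: pow_le.
- by apply: h; rewrite inE eqxx.
- by apply: ih => q hq; apply: h; rewrite inE hq orbT.
Qed.

Lemma lprod_upper (l : seq C) (s : C) (c : R) : 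
  (forall p, p \in l -> Cmod (s - p) <= c) -> Cmod (lprod l s) <= c ^ size l.
Proof.
elim: l => [|p l ih] h /=; first by rewrite Cmod_1; lra.
rewrite Cmod_mult; apply: Rmult_le_compat; try exact: Cmod_ge_0.
- by apply: h; rewrite inE eqxx.
- by apply: ih => q hq; apply: h; rewrite inE hq orbT.
Qed.

Lemma lprod_eq0 (l : seq C) (s : C) : lprod l s = 0 <-> s \in l.
Proof.
split.
- elim: l => [|p l ih] /=; first by move=> /RtoC_inj; lra.
  move=> E; rewrite inE.
  case: (classic (s = p)) => [->|h]; first by rewrite eqxx.
  rewrite ih ?orbT //; apply: NNPP => h2.
  by have := Cmult_neq_0 _ _ (Csub_neq0 h) h2.
- elim: l => [//|p l ih] /=; rewrite inE => /orP [/eqP ->|/ih ->]; ring.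
Qed.

(** * Counting the zeros in a disc and dividing them out *)

Section Factor.
Variables (F : C -> C) (s0 : C) (r M : R).
Hypothesis r1 : 1 <= r.
Hypothesis hM : forall w, Cmod (w - s0) <= 4 * r -> Cmod (F w) <= M.

(** The maximum principle for [G] on the circle of radius [3 * r] about [z], which stays within
    [4 * r] of [s0]. There each factor satisfies [|w - p| >= 3 * r - |p - z| >= c]. *)
Lemma factor_circle (l : seq C) (G : C -> C) (z : C) (c : R) :
  entire G -> (forall s, F s = (lprod l s * G s)%C) ->
  Cmod (z - s0) <= r -> 0 < c ->
  (forall p, p \in l -> Cmod (p - z) + c <= 3 * r) ->
  c ^ size l * Cmod (G z) <= M.
Proof.
move=> hG E hz hc hl.
have [x0 [x1 [y0 [y1 H]]]] := orect_big z (3 * r).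
have cm : 0 < c ^ size l by apply: pow_lt.
rewrite Rmult_comm; apply/Rle_div_r => //.
apply: (max_modulus (x0 := x0) (x1 := x1) (y0 := y0) (y1 := y1) (F := G) (r := 3 * r)) => //; try lra.
  by move=> w _; apply: entire_hol.
move=> t; apply/Rle_div_r => //.
set w := circ z (3 * r) t.
have wz : Cmod (w - z) = (3 * r)%R by rewrite Cmod_circ //; lra.
apply: (Rle_trans _ (Cmod (F w))); last first.
  apply: hM; have := Cmod_triangle (w - z) (z - s0).
  by rewrite (_ : (w - z + (z - s0) = w - s0)%C); [lra | ring].
rewrite E Cmod_mult Rmult_comm; apply: Rmult_le_compat_r; first exact: Cmod_ge_0.
apply: lprod_lower; first lra.
move=> p hp; have := hl p hp; have := Cmod_triangle_inv (w - z) (p - z).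
by rewrite (_ : (w - z - (p - z) = w - p)%C); [lra | ring].
Qed.

(** A bound of Jensen type: on the circle about [s0] each factor is at least [2 * r], at [s0] itself
    at most [r], so every zero costs a factor 2. *)
Lemma factor_count (l : seq C) (G : C -> C) :
  entire G -> (forall s, F s = (lprod l s * G s)%C) ->
  (forall p, p \in l -> Cmod (p - s0) <= r) ->
  2 ^ size l * Cmod (F s0) <= M.
Proof.
move=> hG E hl.
have := factor_circle (z := s0) (c := 2 * r) hG E.
rewrite (_ : (s0 - s0 = 0)%C) ?Cmod_0; last ring.
move=> /(_ ltac:(lra) ltac:(lra) (fun p hp => ltac:(have := hl p hp; lra))) h.
apply: Rle_trans h; rewrite Rpow_mult_distr Rmult_assoc.
apply: Rmult_le_compat_l; first by apply: pow_le; lra.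
rewrite E Cmod_mult; apply: Rmult_le_compat_r; first exact: Cmod_ge_0.
by apply: lprod_upper => p hp; rewrite Cmod_sub_sym; apply: hl.
Qed.

(** Here [c = 1]: two points of the disc are at most [2 * r] apart, and [2 * r + 1 <= 3 * r] by
    [r1]. *)
Lemma factor_bound (l : seq C) (G : C -> C) (z : C) :
  entire G -> (forall s, F s = (lprod l s * G s)%C) ->
  (forall p, p \in l -> Cmod (p - s0) <= r) ->
  Cmod (z - s0) <= r -> Cmod (G z) <= M.
Proof.
move=> hG E hl hz.
have := factor_circle (z := z) (c := 1) hG E hz Rlt_0_1.
rewrite pow1 Rmult_1_l; apply => p hp.
have := Cmod_triangle (p - s0) (s0 - z).
rewrite (_ : (p - s0 + (s0 - z) = p - z)%C); last ring.
by rewrite (Cmod_sub_sym s0); have := hl p hp; lra.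
Qed.

(** Zeros in [B] are divided out one at a time. By [factor_count] the list cannot reach a length [N]
    with [M < 2 ^ N * |F s0|], so the process stops, and it stops only when [G] has no zero left in
    [B]. *)
Lemma factor_zeros (B : C -> Prop) : entire F -> F s0 <> 0 ->
  (forall p, B p -> Cmod (p - s0) <= r) ->
  exists (l : seq C) (G : C -> C), entire G /\
    (forall s, F s = (lprod l s * G s)%C) /\
    (forall p, p \in l -> B p) /\ (forall p, B p -> G p <> 0).
Proof.
move=> hF h0 hB.
have f0 : 0 < Cmod (F s0) by apply/Cmod_gt_0.
have [N HN] : exists N : nat, M < 2 ^ N * Cmod (F s0).
  have [N hN] := pow2_unbounded M f0; exists N.
  by rewrite Rmult_comm; apply/Rlt_div_l => //; apply: pow_lt; lra.
suff main k : forall l G, (size l + k = N)%N -> entire G ->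
    (forall s, F s = (lprod l s * G s)%C) -> (forall p, p \in l -> B p) ->
  exists (l : seq C) (G : C -> C), entire G /\
    (forall s, F s = (lprod l s * G s)%C) /\
    (forall p, p \in l -> B p) /\ (forall p, B p -> G p <> 0).
  by apply: (main N [::] F) => // s; rewrite /= Cmult_1_l.
elim: k => [|k ih] l G hk hG E hl.
  have := factor_count hG E (fun p hp => hB p (hl p hp)).
  by rewrite -(addn0 (size l)) hk; lra.
case: (classic (exists p, B p /\ G p = 0)) => [[p [hp Gp]]|h]; last first.
  by exists l, G; split=> //; split=> //; split=> // p hp E'; apply: h; exists p.
apply: (ih (p :: l) (quot G p)).
- by rewrite /= addSnnS.
- exact: entire_quot.
- by move=> s; rewrite E /= {1}(quot_factor G p s) Gp; ring.
- by move=> q; rewrite inE => /orP [/eqP ->|/hl].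
Qed.

End Factor.

Lemma is_derive_ln_Cmod (g : R -> C) (t : R) (v : C) : g t <> 0 -> rder g t v ->
  is_derive (fun u => ln (Cmod (g u))) t (Re (v / g t)).
Proof.
move=> h0 [h1 h2].
have gpos : 0 < Cmod (g t) by apply/Cmod_gt_0.
have p0 : 0 < Re (g t) ^ 2 + Im (g t) ^ 2.
  by rewrite -Cmod2_alt; apply: pow_lt.
have h3 : is_derive (fun u => Re (g u) ^ 2 + Im (g u) ^ 2)%R t (2 * (Re (g t) * Re v + Im (g t) * Im v))%R.
  have k1 := is_derive_pow _ 2 _ _ h1; have k2 := is_derive_pow _ 2 _ _ h2.
  have := is_derive_plus _ _ _ _ _ k1 k2.
  rewrite /plus /= (_ : (_ + _)%R = (2 * (Re (g t) * Re v + Im (g t) * Im v))%R) //; ring.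
have h4 : is_derive (fun u => ln (sqrt (Re (g u) ^ 2 + Im (g u) ^ 2))) t
    ((2 * (Re (g t) * Re v + Im (g t) * Im v)) * (/ (2 * (Re (g t) ^ 2 + Im (g t) ^ 2))))%R.
  have e : is_derive (fun x => ln (sqrt x)) (Re (g t) ^ 2 + Im (g t) ^ 2)%R (/ (2 * (Re (g t) ^ 2 + Im (g t) ^ 2)))%R.
    move: (_ + _)%R p0 => p p0; have sp := sqrt_lt_R0 _ p0.
    auto_derive; first by [].
    rewrite -[in RHS](sqrt_sqrt p); last lra.
    by field; lra.
  exact: (is_derive_comp _ _ _ _ _ e h3).
have -> : Re (v / g t) = ((2 * (Re (g t) * Re v + Im (g t) * Im v)) * (/ (2 * (Re (g t) ^ 2 + Im (g t) ^ 2))))%R.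
  by case: (g t) v p0 {h0 h1 h2 h3 h4 gpos} => a b [c d] p0; rewrite /Re /Im /= in p0 *; field; lra.
exact: h4.
Qed.

Lemma rder_segment (z w : C) (t : R) : rder (fun t => z + RtoC t * (w - z))%C t (w - z)%C.
Proof.
by case: z w => a1 a2 [z1 z2]; split; rewrite /Re /Im /=; auto_derive => //; ring.
Qed.

Lemma is_derive_eq (f : R -> R) (x l l' : R) : is_derive f x l -> l = l' -> is_derive f x l'.
Proof. by move=> h <-. Qed.

Lemma is_derive_Rminus (f g : R -> R) (x l m : R) :
  is_derive f x l -> is_derive g x m -> is_derive (fun t => f t - g t)%R x (l - m)%R.
Proof. exact: is_derive_minus. Qed.

Lemma is_derive_Rmult (f g : R -> R) (x l m : R) :
  is_derive f x l -> is_derive g x m -> is_derive (fun t => f t * g t)%R x (l * g x + f x * m)%R.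
Proof. by move=> h k; apply: (is_derive_mult f g) => // ? ?; apply: Rmult_comm. Qed.

Lemma conv_itv (a b x y t : R) : a < x < b -> a < y < b -> 0 <= t <= 1 ->
  a < x + t * (y - x) < b.
Proof.
move=> hx hy ht; case: (Rle_lt_dec x y) => h.
- have : 0 <= t * (y - x) by apply: Rmult_le_pos; lra.
  have : 0 <= (1 - t) * (y - x) by apply: Rmult_le_pos; lra.
  lra.
- have : 0 <= t * (x - y) by apply: Rmult_le_pos; lra.
  have : 0 <= (1 - t) * (x - y) by apply: Rmult_le_pos; lra.
  lra.
Qed.

(** [Q] is a logarithm of [G] up to a constant, given as a primitive of [G' / G]. Along a segment
    [ln |G|] and [Re Q] have the same derivative. *)
Lemma logC_const (G Q : C -> C) (x0 x1 y0 y1 : R) :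
  (forall w, orect x0 x1 y0 y1 w -> hol G w) ->
  (forall w, orect x0 x1 y0 y1 w -> G w <> 0) ->
  (forall w, orect x0 x1 y0 y1 w -> cder Q w (C_derive G w / G w)%C) ->
  forall z w, orect x0 x1 y0 y1 z -> orect x0 x1 y0 y1 w ->
  (ln (Cmod (G w)) - Re (Q w) = ln (Cmod (G z)) - Re (Q z))%R.
Proof.
move=> hG h0 hQ z w hz hw.
pose s t := (z + RtoC t * (w - z))%C.
have sD t : 0 <= t <= 1 -> orect x0 x1 y0 y1 (s t).
  move=> ht; have [z1 z2] := hz; have [w1 w2] := hw.
  have -> : s t = (Re z + t * (Re w - Re z), Im z + t * (Im w - Im z))%R.
    by apply: C_ext; rewrite /s /Re /Im /=; ring.
  by split => /=; apply: conv_itv.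
have d t : 0 <= t <= 1 -> is_derive (fun t => ln (Cmod (G (s t))) - Re (Q (s t)))%R t 0.
  move=> ht; have hs := sD t ht.
  have d1 := rder_comp (hol_der (hG _ hs)) (rder_segment z w t).
  have e1 := is_derive_ln_Cmod (h0 _ hs) d1.
  have [e2 _] := rder_comp (hQ _ hs) (rder_segment z w t).
  apply: (is_derive_eq (is_derive_Rminus e1 e2)).
  rewrite (_ : (C_derive G (s t) * (w - z) / G (s t) = C_derive G (s t) / G (s t) * (w - z))%C).
    exact: Rminus_diag.
  by field; apply: h0.
have := @eq_is_derive _ (fun t => ln (Cmod (G (s t))) - Re (Q (s t)))%R 0 1 _ Rlt_0_1.
move=> /(_ d); rewrite /s.
rewrite (_ : (z + RtoC 1 * (w - z) = w)%C); last ring.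
by rewrite (_ : (z + RtoC 0 * (w - z) = z)%C) //; ring.
Qed.

Lemma Re_cint (f : R -> C) (a b : R) : Re (cint f a b) = RInt (fun t => Re (f t)) a b.
Proof. by []. Qed.

(* With [Q] a logarithm of [G], Cauchy's formula for [Q'] and the vanishing of
   the conjugate Fourier coefficient express [Q'] through [Re Q = ln |G|]. *)
Lemma log_derivative_bound (G : C -> C) (x0 x1 y0 y1 : R) (a : C) (r A : R) :
  (forall w, orect x0 x1 y0 y1 w -> hol G w) ->
  (forall w, orect x0 x1 y0 y1 w -> G w <> 0) ->
  (forall w, Cmod (w - a) <= r -> orect x0 x1 y0 y1 w) -> 0 < r ->
  (forall t, ln (Cmod (G (circ a r t))) <= A) ->
  r * Cmod (C_derive G a / G a) <= 2 * (A - ln (Cmod (G a))).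
Proof.
move=> hG h0 hD hr hA; have P0 := PI_RGT_0.
have aD : orect x0 x1 y0 y1 a by apply: hD; rewrite (_ : (a - a = 0)%C) ?Cmod_0; [lra | ring].
have cD t : orect x0 x1 y0 y1 (circ a r t) by apply: hD; rewrite Cmod_circ; lra.
pose q w := (C_derive G w / G w)%C.
have hq w : orect x0 x1 y0 y1 w -> hol q w.
  by move=> hw; apply: hol_div; [apply: h0 | apply: (hol_C_derive_rect hG) | apply: hG].
have [Q hQ] : exists Q, forall w, orect x0 x1 y0 y1 w -> cder Q w (q w).
  apply: (primitive (p := a)); [by case: aD; lra | by case: aD; lra | |].
  - by move=> w hw; apply/hol_ccont/hq.
  - by move=> w hw _; apply: hq.
have Qhol w : orect x0 x1 y0 y1 w -> hol Q w by move=> hw; eexists; apply: hQ.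
pose c := (ln (Cmod (G a)) - Re (Q a))%R.
have hc t : Re (Q (circ a r t)) = (ln (Cmod (G (circ a r t))) - c)%R.
  by rewrite /c -(logC_const hG h0 hQ aD (cD t)); ring.
have cQ t : ccont (fun t => Q (circ a r t)) t.
  by apply: ccont_comp; [apply/hol_ccont/Qhol | apply: ccont_circ].
have ce t : ccont (fun t => / expi t)%C t by apply: ccont_inv; [apply: expi_neq0 | apply: ccont_expi].
have conjE t : Cconj (expi t) = (/ expi t)%C.
  have E : (expi t * Cconj (expi t))%C = 1.
    apply: C_ext; rewrite /Re /Im /=; last ring.
    by have := sin2_cos2 t; rewrite /Rsqr; lra.
  rewrite -(Cmult_1_r (/ expi t)) -E Cmult_assoc Cinv_l; first by rewrite Cmult_1_l.
  exact: expi_neq0.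
have cconj t : ccont (fun t => Cconj (Q (circ a r t))) t.
  by split; [case: (cQ t) | apply: (continuous_opp (V := R_NormedModule)); case: (cQ t)].
(* The conjugate of the closed circle integral of [Q]: since [Cconj (expi t) = / expi t], the
   conjugate of [Q] has zero coefficient against [/ expi t]. *)
have z1 : cint (fun t => Cconj (Q (circ a r t)) * / expi t)%C 0 (2 * PI) = 0.
  have := cauchy_closed Qhol hD hr.
  have e t : (Q (circ a r t) * (RtoC r * expi t) = RtoC r * (Q (circ a r t) * expi t))%C by ring.
  have cx : cex (fun t => Q (circ a r t) * expi t)%C 0 (2 * PI).
    by apply: cex_cont => t _; apply: ccont_mult => //; apply: ccont_expi.
  rewrite (cint_ext (fun t _ => e t)) cint_scal // => E.
  have E2 : cint (fun t => Q (circ a r t) * expi t)%C 0 (2 * PI) = 0.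
    apply: NNPP => h; apply: (Cmult_neq_0 (RtoC r) _ _ h) => //.
    by move=> /RtoC_inj; lra.
  rewrite -(cint_ext (f := fun t => Cconj (Q (circ a r t) * expi t))); last first.
    by move=> t _; rewrite Cmult_conj conjE.
  have [c1 c2] := cx.
  apply: C_ext; first exact: (f_equal Re E2).
  rewrite /= (RInt_ext _ (fun t => - Im (Q (circ a r t) * expi t))%R) //.
  have := RInt_opp _ _ _ c2; rewrite /opp /= => ->.
  by have := f_equal Im E2; rewrite /Im /= => ->; ring.
have z2 : cint (fun t => / expi t)%C 0 (2 * PI) = 0.
  have h1 w : orect x0 x1 y0 y1 w -> hol (fun=> RtoC 1) w by move=> _; apply: hol_const.
  have := derivative_center h1 hD hr.
  rewrite (is_C_derive_unique _ _ _ (cder_const 1 a)) !Cmult_0_r => ->.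
  by apply: cint_ext => t _; ring.
have E := derivative_center Qhol hD hr.
rewrite (is_C_derive_unique _ _ _ (hQ a aD)) in E.
(* Adding the conjugate turns [Q] into [2 Re Q], and by [z2] a constant may be added freely. It is
   chosen so that the integrand becomes [2 (ln |G| - A) <= 0] times a unimodular factor; the modulus
   then integrates by the mean value property. *)
have E2 : (RtoC (2 * PI) * (RtoC r * q a))%C =
   cint (fun t => RtoC (2 * (ln (Cmod (G (circ a r t))) - A)) * / expi t)%C 0 (2 * PI).
  rewrite -(Cplus_0_r (_ * _)) -z1 E -cint_plus; last 2 first.
  - by apply: cex_cont => t _; apply: ccont_mult.
  - by apply: cex_cont => t _; apply: ccont_mult.
  rewrite -(Cplus_0_r (cint _ _ _)) -(Cmult_0_r (RtoC (2 * (c - A)))) -z2 -cint_scal; last by apply: cex_cont.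
  rewrite -cint_plus; last 2 first.
  - by apply: cex_plus; apply: cex_cont => t _; apply: ccont_mult.
  - by apply: cex_scal; apply: cex_cont.
  apply: cint_ext => t _.
  have -> : RtoC (2 * (ln (Cmod (G (circ a r t))) - A)) =
    (Q (circ a r t) + Cconj (Q (circ a r t)) + RtoC (2 * (c - A)))%C.
    by apply: C_ext; rewrite /Re /Im /=; [move: (hc t); rewrite /Re; lra | ring].
  by ring.
have cR t : continuous (fun t => 2 * (A - ln (Cmod (G (circ a r t)))))%R t.
  apply: (continuous_ext (fun t => 2 * (A - c) - 2 * Re (Q (circ a r t)))%R).
    by move=> u; rewrite hc; change (2 * (A - c) - 2 * (ln (Cmod (G (circ a r u))) - c) = 2 * (A - ln (Cmod (G (circ a r u)))))%R; ring.
  apply: (continuous_minus (V := R_NormedModule)); first exact: continuous_const.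
  by apply: continuous_mult; [apply: continuous_const | case: (cQ t)].
have iR : ex_RInt (fun t => 2 * (A - ln (Cmod (G (circ a r t)))))%R 0 (2 * PI).
  by apply: (@ex_RInt_continuous R_CompleteNormedModule) => t _.
have B := @cint_norm_le (fun t => RtoC (2 * (ln (Cmod (G (circ a r t))) - A)) * / expi t)%C
  (fun t => 2 * (A - ln (Cmod (G (circ a r t)))))%R 0 (2 * PI) PI2_pos.
have I : RInt (fun t => 2 * (A - ln (Cmod (G (circ a r t)))))%R 0 (2 * PI) =
   (2 * PI * (2 * (A - ln (Cmod (G a)))))%R.
  have [q1 _] : cex (fun t => Q (circ a r t)) 0 (2 * PI) by apply: cex_cont.
  have mv := f_equal Re (mean_value Qhol hD hr); rewrite Re_cint in mv.
  rewrite (RInt_ext _ (fun t => minus (2 * (A - c))%R (scal 2 (Re (Q (circ a r t)))))); last first.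
    by move=> t _; rewrite /minus /plus /opp /scal /= /mult /= hc; ring.
  rewrite RInt_minus; [|exact: ex_RInt_const | exact: ex_RInt_scal].
  rewrite RInt_const RInt_scal // mv /minus /plus /opp /scal /= /mult /= /c /Re /=; ring.
have : 2 * PI * (r * Cmod (q a)) <= 2 * PI * (2 * (A - ln (Cmod (G a)))).
  rewrite -I; have <- : Cmod (RtoC (2 * PI) * (RtoC r * q a))%C = (2 * PI * (r * Cmod (q a)))%R.
    by rewrite !Cmod_mult !Cmod_R !Rabs_pos_eq; lra.
  rewrite E2; apply: B => //.
  - apply: cex_cont => t _; apply: ccont_mult => //; split.
    + apply: (continuous_ext (fun t => - (2 * (A - ln (Cmod (G (circ a r t))))))%R).
        by move=> u; change (- (2 * (A - ln (Cmod (G (circ a r u))))) = 2 * (ln (Cmod (G (circ a r u))) - A))%R; ring.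
      exact: (continuous_opp (V := R_NormedModule)).
    + exact: continuous_const.
  - move=> t _; rewrite Cmod_mult Cmod_R Cmod_inv; last exact: expi_neq0.
    by rewrite Cmod_expi Rabs_left1; [lra | have := hA t; lra].
by move=> h; apply: (Rmult_le_reg_l (2 * PI)) => //; lra.
Qed.

Lemma log_derivative_segment (G : C -> C) (x0 x1 y0 y1 T al be r A : R) :
  (forall w, orect x0 x1 y0 y1 w -> hol G w) ->
  (forall w, orect x0 x1 y0 y1 w -> G w <> 0) -> 0 < r -> al <= be ->
  (forall x w, al <= x <= be -> Cmod (w - (x, T)) <= r ->
     orect x0 x1 y0 y1 w /\ ln (Cmod (G w)) <= A) ->
  r * Cmod (C_derive G (al, T) / G (al, T)) <=
    2 * ((A - ln (Cmod (G (be, T)))) * exp (2 * (be - al) / r)).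
Proof.
move=> hG h0 hr hab H.
have cD x w : al <= x <= be -> Cmod (w - (x, T)) <= r -> orect x0 x1 y0 y1 w.
  by move=> hx hw; case: (H x w hx hw).
have xD x : al <= x <= be -> orect x0 x1 y0 y1 (x, T).
  move=> hx; apply: (cD x _ hx); rewrite (_ : ((x, T) - (x, T) = 0)%C) ?Cmod_0; [lra | ring].
have bd x : al <= x <= be -> r * Cmod (C_derive G (x, T) / G (x, T)) <= 2 * (A - ln (Cmod (G (x, T)))).
  move=> hx; apply: (log_derivative_bound hG h0 _ hr).
  - by move=> w; apply: cD.
  - by move=> t; case: (H x (circ (x, T) r t) hx) => //; rewrite Cmod_circ; lra.
pose u x := (A - ln (Cmod (G (x, T))))%R.
have du x : al <= x <= be -> is_derive (fun x => u x * exp (2 * x / r))%R x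
   ((- Re (C_derive G (x, T) / G (x, T)) + 2 / r * u x) * exp (2 * x / r))%R.
  move=> hx.
  have e1 := is_derive_ln_Cmod (h0 _ (xD x hx)) (rder_hline (hol_der (hG _ (xD x hx)))).
  have e2 := is_derive_Rminus (is_derive_const A x) e1.
  have e3 : is_derive (fun x => exp (2 * x / r)) x (2 / r * exp (2 * x / r))%R.
    by auto_derive => //; rewrite /Rdiv; ring.
  apply: (is_derive_eq (is_derive_Rmult e2 e3)).
  by rewrite /zero /= -/(u x) /u; ring.
(* A Gronwall argument: [bd] gives [|u'| <= 2 * u / r], so the integrating factor [exp (2 * x / r)]
   makes the product nondecreasing. Control at the right end [be] thus passes to the left end. *)
have mono : u al * exp (2 * al / r) <= u be * exp (2 * be / r).
  case: (Req_dec al be) => [->|ne]; first lra.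
  have [x [hx E]] := MVT_gen (fun x => u x * exp (2 * x / r))%R al be
     (fun x => (- Re (C_derive G (x, T) / G (x, T)) + 2 / r * u x) * exp (2 * x / r))%R
     ltac:(rewrite Rmin_left ?Rmax_right //; move=> x hx; apply: du; lra)
     ltac:(rewrite Rmin_left ?Rmax_right //; move=> x hx; apply/continuity_pt_filterlim; apply: ex_derive_continuous; eexists; apply: du; lra).
  rewrite Rmin_left // Rmax_right // in hx.
  move: E; set q := (C_derive G (x, T) / G (x, T))%C.
  have : 0 <= (- Re q + 2 / r * u x) * exp (2 * x / r) * (be - al).
    apply: Rmult_le_pos; last lra.
    apply: Rmult_le_pos; last by apply: Rlt_le; apply: exp_pos.
    have /Rabs_le_between [_ h1] := re_le_Cmod q.
    have : Cmod q <= 2 / r * u x.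
      have -> : (2 / r * u x = 2 * u x / r)%R by field; lra.
      by apply/Rle_div_r => //; rewrite Rmult_comm; apply: bd.
    lra.
  move=> h E; have {}E := E; lra.
apply: Rle_trans (bd al _) _; first lra.
apply: Rmult_le_compat_l; first lra.
rewrite -/(u al) -/(u be).
have -> : u al = (u al * exp (2 * al / r) * exp (- (2 * al / r)))%R.
  by rewrite Rmult_assoc -exp_plus Rplus_opp_r exp_0 Rmult_1_r.
have -> : exp (2 * (be - al) / r) = (exp (2 * be / r) * exp (- (2 * al / r)))%R.
  by rewrite -exp_plus; congr exp; field; lra.
rewrite -Rmult_assoc; apply: Rmult_le_compat_r => //.
by apply: Rlt_le; apply: exp_pos.
Qed.

(** * Entire functions of polynomial growth in vertical strips *)

(** Small positive exponents stand in for logarithms, negative ones express decay; products of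
    bounds become sums of exponents. *)
Definition weight (a y : R) : R := Rpower (1 + Rabs y) a.

Lemma weight_ge1 (a y : R) : 0 <= a -> 1 <= weight a y.
Proof.
move=> ha; have y0 := Rabs_pos y; have := Rle_Rpower (1 + Rabs y) 0 a.
by rewrite Rpower_O; [apply; lra | lra].
Qed.

Lemma weight_gt0 (a y : R) : 0 < weight a y.
Proof. exact: exp_pos. Qed.

Lemma weight_plus (a b y : R) : weight (a + b) y = (weight a y * weight b y)%R.
Proof. exact: Rpower_plus. Qed.

Lemma ln_le_weight (a y : R) : 0 < a -> ln (1 + Rabs y) <= weight a y / a.
Proof.
move=> ha; apply/Rle_div_r => //.
have := exp_ineq1_le (a * ln (1 + Rabs y)); rewrite /weight /Rpower; lra.
Qed.

Lemma weight_mono (a x y : R) : 0 <= a -> Rabs x <= Rabs y -> weight a x <= weight a y.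
Proof. by move=> ha h; apply: Rle_Rpower_l => //; have := Rabs_pos x; lra. Qed.

(* The abscissa 5 makes the Euler product converge by the trivial bound
   |a_p| <= p^2. *)
Record L_like (F : C -> C) : Prop := LLike {
  L_like_entire : entire F;
  L_like_growth : forall a b : R, exists (K : R) (A : nat),
    forall s : C, a <= Re s <= b -> Cmod (F s) <= K * (1 + Rabs (Im s)) ^ A;
  L_like_lower : forall y : R, 1 / 2 <= Cmod (F (5, y)) }.

Lemma ln_ge0 (x : R) : 1 <= x -> 0 <= ln x.
Proof. by move=> h; rewrite -ln_1; apply: ln_le; lra. Qed.

Lemma exp_le_mono (x y : R) : x <= y -> exp x <= exp y.
Proof. by move=> [h|->]; [apply: Rlt_le; apply: exp_increasing | right]. Qed.

Lemma ln_pow_nat (x : R) (n : nat) : 0 < x -> ln (x ^ n) = (INR n * ln x)%R.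
Proof.
move=> hx; elim: n => [|n ih]; first by rewrite /= ln_1; ring.
rewrite S_INR /= ln_mult // ?ih; [ring | exact: pow_lt].
Qed.

(* The zeros near [5 + ik] are divided out, and [G'/G] is transported from
   [Re s = 5], where [G] is bounded below, to the left along [Im s]. *)
Lemma local_factor (F : C -> C) (a : R) : L_like F -> 0 < a ->
  exists Ca, 0 < Ca /\ forall k : R, exists (l : seq C) (G : C -> C),
    entire G /\ (forall s, F s = (lprod l s * G s)%C) /\
    (forall p, p \in l -> orect (-2) 12 (k - 3) (k + 3) p) /\
    (forall p, orect (-2) 12 (k - 3) (k + 3) p -> G p <> 0) /\
    INR (size l) <= Ca * weight a k /\
    forall s, 0 <= Re s <= 5 -> Rabs (Im s - k) <= 1 ->
      Cmod (C_derive G s / G s) <= Ca * weight a k.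
Proof.
move=> hF ha.
(* The real parts within [4 * 10] of the abscissa 5: the zeros are divided out around [5 + ik] with
   [r = 10]. *)
have [K [A HK]] := L_like_growth hF (-35) 45.
pose K' := (Rabs K + 1)%R.
have K'1 : 1 <= K' by rewrite /K'; have := Rabs_pos K; lra.
(* Chosen so that [ln (2 * M) <= c0 * weight a k] for the bound [M] of [|F|] below: the last two
   terms come from [ln (41 + |k|) <= ln 41 + ln (1 + |k|)] and [ln_le_weight]. *)
pose c0 := (ln (2 * K') + INR A * ln 41 + INR A / a)%R.
have c00 : 0 < c0.
  have h1 : 0 < ln (2 * K') by rewrite -ln_1; apply: ln_increasing; lra.
  have h2 : 0 <= INR A * ln 41 by apply: Rmult_le_pos; [apply: pos_INR | apply: ln_ge0; lra].
  have h3 : 0 <= INR A / a by apply: Rdiv_le_0_compat => //; apply: pos_INR.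
  by rewrite /c0; lra.
(* With [ell = ln (2 * M)] there are at most [2 * ell] zeros, because [ln 2 > 1 / 2], and [G' / G]
   is at most [2 * (5 * ell) * exp 10], the exponent being [2 * (5 - 0) / 1]. *)
exists ((2 + 10 * exp 10) * c0)%R; split.
  by apply: Rmult_lt_0_compat => //; have := exp_pos 10; lra.
move=> k.
have ak := Rabs_pos k.
pose M := (K' * (41 + Rabs k) ^ A)%R.
have hM w : Cmod (w - (5, k)) <= 4 * 10 -> Cmod (F w) <= M.
  move=> hw.
  have h1 : Rabs (Re w - 5) <= 40 by apply: Rle_trans (re_le_Cmod (w - (5, k))) _; lra.
  have h2 : Rabs (Im w - k) <= 40 by apply: Rle_trans (im_le_Cmod (w - (5, k))) _; lra.
  have h1' := proj1 (Rabs_le_between _ _) h1.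
  apply: Rle_trans (HK w _) _; first lra.
  have h3 : (1 + Rabs (Im w)) ^ A <= (41 + Rabs k) ^ A.
    apply: pow_incr; split; first by have := Rabs_pos (Im w); lra.
    have := Rabs_triang (Im w - k) k; rewrite (_ : Im w - k + k = Im w)%R; [lra | ring].
  have h4 : 0 <= (1 + Rabs (Im w)) ^ A by apply: pow_le; have := Rabs_pos (Im w); lra.
  apply: (Rle_trans _ (K' * (1 + Rabs (Im w)) ^ A)).
    by apply: Rmult_le_compat_r => //; rewrite /K'; have := Rle_abs K; lra.
  by apply: Rmult_le_compat_l => //; lra.
have r10 : 1 <= 10 by lra.
(* [D] contains the unit discs about the points of [[0, 5] x [k - 1, k + 1]], along which [G' / G]
   is transported, and lies within 10 of [5 + ik]. *)
pose D := orect (-2) 12 (k - 3) (k + 3).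
have hD p : D p -> Cmod (p - (5, k)) <= 10.
  move=> [d1 d2]; apply: Rle_trans (Cmod_le_abs _) _.
  have : Rabs (Re p - 5) <= 7 by apply/Rabs_le; lra.
  have : Rabs (Im p - k) <= 3 by apply/Rabs_le; lra.
  by rewrite /Re /Im /= /Rminus; lra.
have low T := L_like_lower hF T.
have F0 : F (5, k) <> 0 by apply/Cmod_gt_0; have := low k; lra.
have [l [G [hG [E [hl hGn]]]]] := factor_zeros r10 hM (L_like_entire hF) F0 hD.
exists l, G; split=> //; split=> //; split=> //; split=> //.
have hl10 p : p \in l -> Cmod (p - (5, k)) <= 10 by move=> /hl; apply: hD.
have cnt := factor_count r10 hM hG E hl10.
have Gle w : Cmod (w - (5, k)) <= 10 -> Cmod (G w) <= M.
  by move=> hw; apply: (factor_bound r10 hM hG E hl10 hw).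
pose ell := ln (2 * M).
have p2 : 0 < 2 ^ size l by apply: pow_lt; lra.
have p21 : 1 <= 2 ^ size l by apply: pow_R1_Rle; lra.
have M2 : 2 ^ size l <= 2 * M.
  have := low k => lk.
  have : 2 ^ size l * (1 / 2) <= 2 ^ size l * Cmod (F (5, k)) by apply: Rmult_le_compat_l; lra.
  by lra.
have M0 : 0 < M by lra.
have l2 : / 2 < ln 2 by apply: ln_lt_2.
have sz : INR (size l) * ln 2 <= ell.
  by rewrite -ln_pow_nat; [apply: ln_le | lra].
have sz0 := pos_INR (size l).
have ell0 : 0 <= ell by apply: Rle_trans sz; apply: Rmult_le_pos; lra.
have ellb : ell <= c0 * weight a k.
  have q1 := weight_ge1 k (Rlt_le _ _ ha).
  have q2 := ln_le_weight k ha.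
  have -> : ell = (ln (2 * K') + INR A * ln (41 + Rabs k))%R.
    rewrite /ell /M -ln_pow_nat; last lra.
    by rewrite -ln_mult -?Rmult_assoc //; [lra | apply: pow_lt; lra].
  have q3 : ln (41 + Rabs k) <= ln 41 + ln (1 + Rabs k).
    by rewrite -ln_mult; try lra; apply: ln_le; lra.
  have q4 := pos_INR A.
  have q5 : 0 <= ln (2 * K') by apply: ln_ge0; lra.
  have q6 : 0 <= ln 41 by apply: ln_ge0; lra.
  have -> : (c0 * weight a k = ln (2 * K') * weight a k + INR A * ln 41 * weight a k + INR A / a * weight a k)%R.
    by rewrite /c0; ring.
  have r1 : ln (2 * K') <= ln (2 * K') * weight a k by nra.
  have r2 : INR A * ln (41 + Rabs k) <= INR A * ln 41 * weight a k + INR A / a * weight a k.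
    apply: (Rle_trans _ (INR A * (ln 41 + weight a k / a))).
      by apply: Rmult_le_compat_l => //; lra.
    have : 0 <= INR A * ln 41 by apply: Rmult_le_pos.
    have -> : (INR A / a * weight a k = INR A * (weight a k / a))%R by field; lra.
    nra.
  lra.
have e10 := exp_pos 10.
have ellb2 : (2 + 10 * exp 10) * ell <= (2 + 10 * exp 10) * c0 * weight a k.
  by rewrite Rmult_assoc; apply: Rmult_le_compat_l; lra.
have e10ell : 0 <= exp 10 * ell by apply: Rmult_le_pos; lra.
split; first by nra.
move=> s hs1 hs2.
have hs2' := proj1 (Rabs_le_between _ _) hs2.
have n5 : D (5, Im s) by split => /=; lra.
have seg := @log_derivative_segment G (-2) 12 (k - 3) (k + 3) (Im s) (Re s) 5 1 (ln M)
  (fun w _ => entire_hol w hG) hGn Rlt_0_1 (proj2 hs1).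
have {seg}seg : 1 * Cmod (C_derive G (Re s, Im s) / G (Re s, Im s)) <=
    2 * ((ln M - ln (Cmod (G (5, Im s)))) * exp (2 * (5 - Re s) / 1)).
  apply: seg => x w hx hw.
  have h1 := proj1 (Rabs_le_between _ _) (Rle_trans _ _ _ (re_le_Cmod _) hw).
  have h2 := proj1 (Rabs_le_between _ _) (Rle_trans _ _ _ (im_le_Cmod _) hw).
  have hwD : D w.
    by move: h1 h2; rewrite /Re /Im /= -/(Re w) -/(Im w) -/(Re s) -/(Im s) => h1 h2; split; lra.
  split=> //; apply: ln_le; first by apply/Cmod_gt_0; apply: hGn.
  by apply: Gle; apply: hD.
(* The factors of [lprod l] are at most 11 here; rounding up to 16, a power of 2, gives [size l * ln
   16 = 4 * size l * ln 2 <= 4 * ell]. The fifth [ell] is [ln M + ln 2]. *)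
have g5 : ln M - ln (Cmod (G (5, Im s))) <= 5 * ell.
  have lu : Cmod (lprod l (5, Im s)) <= 16 ^ size l.
    apply: lprod_upper => p hp; have [d1 d2] := hl p hp.
    apply: Rle_trans (Cmod_le_abs _) _.
    have : Rabs (5 - Re p) <= 7 by apply/Rabs_le; lra.
    have : Rabs (Im s - Im p) <= 4 by apply/Rabs_le; lra.
    by rewrite /Re /Im /= /Rminus; lra.
  have Gp : 0 < Cmod (G (5, Im s)) by apply/Cmod_gt_0; apply: hGn.
  have h : 1 / 2 <= 16 ^ size l * Cmod (G (5, Im s)).
    apply: Rle_trans (low (Im s)) _; rewrite E Cmod_mult.
    by apply: Rmult_le_compat_r => //; lra.
  have p16 : 0 < 16 ^ size l by apply: pow_lt; lra.
  have := ln_le (1 / 2) _ ltac:(lra) h; rewrite ln_mult // ln_pow_nat; last lra.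
  have -> : ln (1 / 2) = (- ln 2)%R by rewrite /Rdiv Rmult_1_l ln_Rinv; lra.
  have -> : ln 16 = (4 * ln 2)%R.
    have := @ln_pow_nat 2 4 ltac:(lra); rewrite (_ : 2 ^ 4 = 16)%R; last ring.
    by move=> ->; rewrite /=; ring.
  have : ell = (ln 2 + ln M)%R by rewrite /ell ln_mult //; lra.
  lra.
have ex : exp (2 * (5 - Re s) / 1) <= exp 10.
  by apply: exp_le_mono; lra.
rewrite Rmult_1_l -surjective_pairing in seg.
apply: Rle_trans seg _.
have ep := exp_pos (2 * (5 - Re s) / 1).
set X := (ln M - _)%R in g5 *.
set Y := exp (2 * _ / 1) in ex ep *.
have : X * Y <= 5 * ell * exp 10.
  case: (Rle_lt_dec 0 X) => hX; first by apply: Rmult_le_compat; lra.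
  have : X * Y <= 0 by nra.
  by nra.
nra.
Qed.

(** * The logarithmic derivative on vertical lines and at good heights *)

Fixpoint lsum (h : C -> C) (l : seq C) : C :=
  if l is p :: l' then (h p + lsum h l')%C else 0.

Lemma lsum_bound (h : C -> C) (l : seq C) (B : R) :
  (forall p, p \in l -> Cmod (h p) <= B) -> Cmod (lsum h l) <= INR (size l) * B.
Proof.
elim: l => [|p l ih] H; first by rewrite /= Cmod_0; lra.
rewrite [size _]/= S_INR /=; apply: Rle_trans (Cmod_triangle _ _) _.
have := H p; rewrite inE eqxx => /(_ isT).
have := ih (fun q hq => H q ltac:(by rewrite inE hq orbT)); lra.
Qed.

Lemma cder_lprod (l : seq C) (s : C) : s \notin l ->
  cder (lprod l) s (lprod l s * lsum (fun p => / (s - p))%C l).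
Proof.
elim: l => [|p l ih]; first by move=> _; apply: (cder_eq (cder_const 1 s)); rewrite /=; ring.
rewrite inE negb_or => /andP [/eqP sp /ih h] /=.
apply: (cder_eq (cder_mult (cder_minus (cder_id s) (cder_const p s)) h)).
by field; apply: Csub_neq0.
Qed.

Lemma logderiv_factor (F G : C -> C) (l : seq C) (s : C) : entire G ->
  (forall s, F s = (lprod l s * G s)%C) -> F s <> 0 ->
  logderiv F s = (lsum (fun p => / (s - p))%C l + C_derive G s / G s)%C.
Proof.
move=> hG E h0.
have hl : lprod l s <> 0 by move=> e; apply: h0; rewrite E e; ring.
have hg : G s <> 0 by move=> e; apply: h0; rewrite E e; ring.
have sl : s \notin l by apply/negP => /lprod_eq0.
have d := cder_mult (cder_lprod sl) (hol_der (entire_hol s hG)).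
have {}d : cder F s _ := cder_ext (ex_intro _ 1 (conj Rlt_0_1 (fun w _ => esym (E w)))) d.
by rewrite /logderiv (is_C_derive_unique _ _ _ d) E; field.
Qed.

(** [riemann_hypothesis] concerns the open critical strip. A zero outside that strip is still at
    distance at least [1 / 2 - delta] from [s]. *)
Lemma strip_zero (F : C -> C) (s p : C) (delta : R) : riemann_hypothesis F ->
  Rabs (Re s - 1 / 2) <= delta -> F p = 0 ->
  Re p = (1 / 2)%R \/ 1 / 2 - delta <= Cmod (s - p).
Proof.
move=> rh /Rabs_le_between hs h0.
case: (Rle_lt_dec (Re p) 0) => h1; last case: (Rle_lt_dec 1 (Re p)) => h2.
- right; apply: Rle_trans (re_le_Cmod _); rewrite /Re /= -/(Re s) -/(Re p).
  by apply: Rle_trans (Rle_abs _); lra.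
- right; apply: Rle_trans (re_le_Cmod _); rewrite /Re /= -/(Re s) -/(Re p).
  by rewrite -Rabs_Ropp; apply: Rle_trans (Rle_abs _); lra.
- by left; apply: rh.
Qed.

(** On these lines every zero stays at distance at least [delta] or [1 / 2 - delta], so the polar
    part of [F' / F] is bounded by the number of nearby zeros. *)
Lemma line_bound (F : C -> C) (delta a : R) : L_like F -> riemann_hypothesis F ->
  0 < delta < 1 / 2 -> 0 < a ->
  exists Ca, 0 < Ca /\ forall s, Rabs (Re s - 1 / 2) = delta ->
    F s <> 0 /\ Cmod (logderiv F s) <= Ca * weight a (Im s).
Proof.
move=> hF rh hd ha.
have [c [c0 H]] := local_factor hF ha.
have d1 : 0 < / delta by apply: Rinv_0_lt_compat; lra.
have d2 : 0 < / (1 / 2 - delta) by apply: Rinv_0_lt_compat; lra.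
exists (c * (/ delta + / (1 / 2 - delta)) + c)%R; split; first by nra.
move=> s hs.
have hs' := hs.
have s01 : 0 < Re s < 1.
  by have := proj1 (Rabs_le_between _ _) (Req_le _ _ hs); lra.
have F0 : F s <> 0.
  by move=> /(rh s s01) E; move: hs; rewrite E Rminus_diag Rabs_R0; lra.
split=> //.
have [l [G [hG [E [hl [hGn [sz hb]]]]]]] := H (Im s).
rewrite (logderiv_factor hG E F0).
apply: Rle_trans (Cmod_triangle _ _) _.
have b1 : Cmod (lsum (fun p => / (s - p))%C l) <= INR (size l) * (/ delta + / (1 / 2 - delta)).
  apply: lsum_bound => p hp.
  have Fp : F p = 0 by rewrite E; move/lprod_eq0: hp => ->; ring.
  have sp : s <> p by move=> e; apply: F0; rewrite e.
  have m0 : 0 < Cmod (s - p) by apply/Cmod_gt_0; apply: Csub_neq0.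
  rewrite Cmod_inv; last exact: Csub_neq0.
  case: (strip_zero rh (Req_le _ _ hs) Fp) => h.
  - have : / Cmod (s - p) <= / delta; last lra.
    apply: Rinv_le_contravar; first lra.
    by rewrite -hs -h; apply: (re_le_Cmod (s - p)).
  - have : / Cmod (s - p) <= / (1 / 2 - delta); last lra.
    by apply: Rinv_le_contravar; lra.
have b2 := hb s ltac:(lra) ltac:(rewrite Rminus_diag Rabs_R0; lra).
have p0 := weight_gt0 a (Im s).
have : INR (size l) * (/ delta + / (1 / 2 - delta)) <= c * weight a (Im s) * (/ delta + / (1 / 2 - delta)).
  by apply: Rmult_le_compat_r; lra.
lra.
Qed.

(** Pigeonhole: the midpoints of the [n + 1] equal parts of [[k, k + 1]] are [2 * h] apart, so each
    of the [n] points of [hs] is within [h] of at most one of them. *)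
Lemma gap (hs : seq R) (k : R) : exists T, k <= T <= k + 1 /\
  forall y, y \in hs -> / (2 * (INR (size hs) + 1)) <= Rabs (T - y).
Proof.
set n := size hs; pose h := / (2 * (INR n + 1)).
have n0 := pos_INR n.
have h0 : 0 < h by apply: Rinv_0_lt_compat; lra.
have hh : (2 * (INR n + 1) * h = 1)%R by rewrite /h; field; lra.
pose T (j : nat) := (k + (2 * INR j + 1) * h)%R.
apply: NNPP => hn.
have [f hf] : exists f : 'I_n.+1 -> 'I_n, forall j : 'I_n.+1, Rabs (T j - nth 0 hs (f j)) < h.
  have := @fin_all_exists 'I_n.+1 (fun=> 'I_n) (fun (j : 'I_n.+1) (i : 'I_n) => Rabs (T j - nth 0 hs i) < h).
  apply.
  move=> j; apply: NNPP => hj; apply: hn; exists (T j); split.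
    have j1 : INR j <= INR n by apply: le_INR; apply/leP; rewrite -ltnS.
    by have := pos_INR j; rewrite /T; nra.
  move=> y hy; apply: Rnot_lt_le => hlt; apply: hj.
  have hi : (index y hs < n)%N by rewrite index_mem.
  by exists (Ordinal hi); rewrite /= nth_index.
have : ~ injective f by move=> /leq_card; rewrite !card_ord ltnn.
apply => i j eij; apply: val_inj => /=.
have := hf i; have := hf j; rewrite eij => /Rabs_def2 [a1 a2] /Rabs_def2 [b1 b2].
have c1 : Rabs (INR i - INR j) < 1.
  by apply: Rabs_def1; rewrite /T in a1 a2 b1 b2; nra.
case: (ltngtP i j) => // /leP /le_INR; rewrite S_INR => hij; exfalso;
  by move: c1 => /Rabs_def2; lra.
Qed.

(** The lists of zeros around [k] and around [- k] are merged before [gap] is used, so that one [T]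
    serves both horizontal sides. The number of zeros and the inverse gap are each of order
    [weight (a / 2) k], hence their product of order [weight a k]. *)
Lemma good_heights (F : C -> C) (delta a : R) : L_like F -> riemann_hypothesis F ->
  0 < delta < 1 / 2 -> 0 < a ->
  exists Ca, 0 < Ca /\ forall k, 0 <= k -> exists T, k <= T <= k + 1 /\
    forall s, Rabs (Re s - 1 / 2) <= delta -> Im s = T \/ Im s = (- T)%R ->
    F s <> 0 /\ Cmod (logderiv F s) <= Ca * weight a k.
Proof.
move=> hF rh hd ha.
have ha2 : 0 < a / 2 by lra.
have [c [c0 H]] := local_factor hF ha2.
have d2 : 0 < / (1 / 2 - delta) by apply: Rinv_0_lt_compat; lra.
exists (c * (/ (1 / 2 - delta) + 2 * (2 * c + 1)) + c)%R; split.
  by apply: Rplus_lt_0_compat => //; apply: Rmult_lt_0_compat => //; lra.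
move=> k k0.
have [l1 [G1 [hG1 [E1 [_ [hGn1 [sz1 hb1]]]]]]] := H k.
have [l2 [G2 [hG2 [E2 [_ [hGn2 [sz2 hb2]]]]]]] := H (- k)%R.
pose hs := [seq Im p | p <- l1] ++ [seq (- Im p)%R | p <- l2].
have [T [hT gapT]] := gap hs k.
exists T; split=> // s hs1 hs2.
have pk : weight (a / 2) (- k) = weight (a / 2) k by rewrite /weight Rabs_Ropp.
rewrite pk in sz2 hb2.
set P := weight (a / 2) k in sz1 sz2 hb1 hb2.
have P1 : 1 <= P by apply: weight_ge1; lra.
have -> : weight a k = (P * P)%R by rewrite -weight_plus; congr weight; field.
set g := / (2 * (INR (size hs) + 1)) in gapT.
have sz : INR (size hs) <= 2 * c * P.
  by rewrite size_cat !size_map plus_INR; lra.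
have n0 := pos_INR (size hs).
have g0 : 0 < g by apply: Rinv_0_lt_compat; lra.
have hs1' := proj1 (Rabs_le_between _ _) hs1.
have gi : / g <= 2 * (2 * c + 1) * P by rewrite /g Rinv_inv; nra.
have main l G : entire G -> (forall s, F s = (lprod l s * G s)%C) ->
   (forall p, p \in l -> g <= Rabs (Im s - Im p)) -> G s <> 0 -> INR (size l) <= c * P ->
   Cmod (C_derive G s / G s) <= c * P ->
   F s <> 0 /\ Cmod (logderiv F s) <= (c * (/ (1 / 2 - delta) + 2 * (2 * c + 1)) + c) * (P * P).
  move=> hG E hg Gs szl hb.
  have F0 : F s <> 0.
    rewrite E; apply: Cmult_neq_0 => // /lprod_eq0 /hg; rewrite Rminus_diag Rabs_R0; lra.
  split=> //; rewrite (logderiv_factor hG E F0).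
  apply: Rle_trans (Cmod_triangle _ _) _.
  have b1 : Cmod (lsum (fun p => / (s - p))%C l) <= INR (size l) * / g.
    apply: lsum_bound => p hp.
    have sp : s <> p by move=> e; have := hg p hp; rewrite e Rminus_diag Rabs_R0; lra.
    rewrite Cmod_inv; last exact: Csub_neq0.
    apply: Rinv_le_contravar => //; apply: Rle_trans (hg p hp) _.
    exact: (im_le_Cmod (s - p)).
  have s0 := pos_INR (size l).
  have gi0 : 0 < / g by apply: Rinv_0_lt_compat.
  have b2 : INR (size l) * / g <= c * P * (2 * (2 * c + 1) * P) by apply: Rmult_le_compat; lra.
  have b3 : 0 <= c * / (1 / 2 - delta) * (P * P) by do !apply: Rmult_le_pos; lra.
  have b4 : c * P <= c * (P * P) by apply: Rmult_le_compat_l; nra.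
  lra.
case: hs2 => e.
- apply: (main l1 G1) => //.
  + by move=> p hp; rewrite e; apply: gapT; rewrite mem_cat map_f.
  + by apply: hGn1; split; lra.
  + by apply: hb1; [lra | apply/Rabs_le; lra].
- apply: (main l2 G2) => //.
  + move=> p hp; rewrite e.
    have := gapT (- Im p)%R; rewrite mem_cat (map_f (fun p => - Im p)%R hp) orbT => /(_ isT).
    by rewrite -(Rabs_Ropp (- T - Im p)) (_ : - (- T - Im p) = T - - Im p)%R //; ring.
  + by apply: hGn2; split; lra.
  + by apply: hb2; [lra | apply/Rabs_le; lra].
Qed.

(** * The residue theorem for logarithmic derivatives *)

(** The real part has an arctangent and the imaginary part a logarithm as antiderivative. Both are
    smooth on a whole line that misses [p], so no branch of the complex logarithm has to be
    chosen. *)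
Lemma vint_inv (p : C) (x c d : R) : x <> Re p ->
  vint (fun s => / (s - p))%C x c d =
  (atan ((d - Im p) / (x - Re p)) - atan ((c - Im p) / (x - Re p)),
   - ln ((x - Re p) ^ 2 + (d - Im p) ^ 2) / 2 + ln ((x - Re p) ^ 2 + (c - Im p) ^ 2) / 2)%R.
Proof.
move=> hx.
have X0 : (x - Re p)%R <> 0 by lra.
have pos y : 0 < (x - Re p) ^ 2 + (y - Im p) ^ 2.
  by have := pow2_ge_0 (y - Im p); have := pow2_gt_0 _ X0; lra.
have n0 y : ((x, y) - p)%C <> 0 by move=> E; apply: X0; have := f_equal Re E.
rewrite /vint (cint_FTC (w := fun y => (atan ((y - Im p) / (x - Re p)), - ln ((x - Re p) ^ 2 + (y - Im p) ^ 2) / 2)%R)).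
- by apply: C_ext; rewrite /Re /Im /=; field.
- move=> y _; have py := pos y; case: p hx X0 pos n0 py => p1 p2 /= hx X0 pos n0 py.
  split; rewrite /Re /Im /=; auto_derive.
  + by [].
  + by field; rewrite /= in py X0; split=> //; nra.
  + by rewrite /= in py; lra.
  + by field; rewrite /= in py; lra.
- move=> y _; apply: ccont_inv => //; apply: (@ccont_vline (fun s => s - p)%C).
  by apply: ccont_minus; [apply: ccont_id | apply: ccont_const].
Qed.

Lemma hint_inv (p : C) (y a b : R) : y <> Im p ->
  hint (fun s => / (s - p))%C y a b =
  (ln ((b - Re p) ^ 2 + (y - Im p) ^ 2) / 2 - ln ((a - Re p) ^ 2 + (y - Im p) ^ 2) / 2,
   - atan ((b - Re p) / (y - Im p)) + atan ((a - Re p) / (y - Im p)))%R.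
Proof.
move=> hy.
have Y0 : (y - Im p)%R <> 0 by lra.
have pos x : 0 < (x - Re p) ^ 2 + (y - Im p) ^ 2.
  by have := pow2_ge_0 (x - Re p); have := pow2_gt_0 _ Y0; lra.
have n0 x : ((x, y) - p)%C <> 0 by move=> E; apply: Y0; have := f_equal Im E.
rewrite /hint (cint_FTC (w := fun x => (ln ((x - Re p) ^ 2 + (y - Im p) ^ 2) / 2, - atan ((x - Re p) / (y - Im p)))%R)).
- by apply: C_ext; rewrite /Re /Im /=; field.
- move=> x _; have py := pos x; case: p hy Y0 pos n0 py => p1 p2 /= hx X0 pos n0 py.
  split; rewrite /Re /Im /=; auto_derive.
  + by rewrite /= in py; lra.
  + by field; rewrite /= in py; lra.
  + by [].
  + by field; rewrite /= in py X0; split=> //; nra.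
- move=> x _; apply: ccont_inv => //; apply: (@ccont_hline (fun s => s - p)%C).
  by apply: ccont_minus; [apply: ccont_id | apply: ccont_const].
Qed.

(** The logarithms cancel by the symmetry about [Re s = x], and the arctangents combine in pairs,
    [atan t + atan (/ t)] being [PI / 2] or its negative. *)
Lemma rect_inv (x delta y c d : R) : 0 < delta -> c < y < d ->
  rect (fun s => / (s - (x, y)))%C (x - delta) (x + delta) c d = (2 * PI * Ci)%C.
Proof.
move=> hd hy; rewrite /rect !vint_inv /= ?hint_inv /=; try lra.
have -> : (x + delta - x = delta)%R by ring.
have -> : (x - delta - x = - delta)%R by ring.
have o u v : v <> 0 -> (u / - v = - (u / v))%R by move=> ?; field.
have o' u v : v <> 0 -> (- u / v = - (u / v))%R by move=> ?; field.
rewrite !o; try lra. rewrite !o'; try lra.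
rewrite !atan_opp.
have E1 : atan ((d - y) / delta) = (PI / 2 - atan (delta / (d - y)))%R.
  have -> : ((d - y) / delta = / (delta / (d - y)))%R by field; lra.
  by apply: atan_inv; apply: Rdiv_lt_0_compat; lra.
have E2 : atan ((c - y) / delta) = (- (PI / 2) - atan (delta / (c - y)))%R.
  have -> : ((c - y) / delta = - / (delta / (y - c)))%R by field; lra.
  have -> : (delta / (c - y) = - (delta / (y - c)))%R by field; lra.
  rewrite !atan_opp atan_inv; first ring.
  by apply: Rdiv_lt_0_compat; lra.
rewrite E1 E2; apply: C_ext; rewrite /Re /Im /=; field.
Qed.

Definition on_border (a b c d : R) (z : C) : Prop :=
  in_rect a b c d z /\ (Re z = a \/ Re z = b \/ Im z = c \/ Im z = d).

(** Continuity is asked on the boundary only, since the integrands have poles inside. *)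
Definition bcont (F : C -> C) (a b c d : R) : Prop :=
  forall z, on_border a b c d z -> ccontC F z.

Lemma bcont_cex (F : C -> C) (a b c d : R) : a <= b -> c <= d -> bcont F a b c d ->
  (cex (fun x => F (x, c)) a b /\ cex (fun x => F (x, d)) a b) /\
  (cex (fun y => F (a, y)) c d /\ cex (fun y => F (b, y)) c d).
Proof.
move=> hab hcd h; split; split; apply: cex_cont => t; rewrite Rmin_left // Rmax_right // => ht.
1,2: by apply: ccont_hline; apply: h; split; [split => /=; lra | rewrite /=; tauto].
all: by apply: ccont_vline; apply: h; split; [split => /=; lra | rewrite /=; tauto].
Qed.

Lemma rect_plus (F G : C -> C) (a b c d : R) : a <= b -> c <= d ->
  bcont F a b c d -> bcont G a b c d ->
  rect (fun z => F z + G z)%C a b c d = (rect F a b c d + rect G a b c d)%C.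
Proof.
move=> hab hcd /(bcont_cex hab hcd) [[? ?] [? ?]] /(bcont_cex hab hcd) [[? ?] [? ?]].
by rewrite /rect /hint /vint !cint_plus //; ring.
Qed.

Lemma rect_scal (k : C) (F : C -> C) (a b c d : R) : a <= b -> c <= d ->
  bcont F a b c d ->
  rect (fun z => k * F z)%C a b c d = (k * rect F a b c d)%C.
Proof.
move=> hab hcd /(bcont_cex hab hcd) [[? ?] [? ?]].
by rewrite /rect /hint /vint !cint_scal //; ring.
Qed.

Lemma hint_ext (F G : C -> C) (y a b : R) : a <= b ->
  (forall x, a <= x <= b -> F (x, y) = G (x, y)) -> hint F y a b = hint G y a b.
Proof. by move=> h E; apply: cint_ext => t; rewrite Rmin_left // Rmax_right // => /E. Qed.

Lemma vint_ext (F G : C -> C) (x c d : R) : c <= d ->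
  (forall y, c <= y <= d -> F (x, y) = G (x, y)) -> vint F x c d = vint G x c d.
Proof. by move=> h E; apply: cint_ext => t; rewrite Rmin_left // Rmax_right // => /E. Qed.

Lemma rect_ext (F G : C -> C) (a b c d : R) : a <= b -> c <= d ->
  (forall z, on_border a b c d z -> F z = G z) ->
  rect F a b c d = rect G a b c d.
Proof.
move=> hab hcd E; rewrite /rect; congr (_ + _ * _ - _ - _ * _)%C;
  by [apply: hint_ext => // x hx; apply: E; split; [split => /=; lra | rewrite /=; tauto] |
      apply: vint_ext => // x hx; apply: E; split; [split => /=; lra | rewrite /=; tauto]].
Qed.

(** Write [g s = g p + (s - p) * quot g p s]. The quotient is holomorphic across [p] and integrates
    to 0, leaving [g p] times the integral of [1 / (s - p)]. *)
Lemma rect_pole (g : C -> C) (x delta y c d eta : R) : 0 < delta < eta -> c < y < d ->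
  (forall s, Rabs (Re s - x) < eta -> hol g s) ->
  rect (fun s => g s / (s - (x, y)))%C (x - delta) (x + delta) c d = (2 * PI * Ci * g (x, y))%C.
Proof.
move=> hd hy hg.
set p : C := (x, y).
have bdry z : on_border (x - delta) (x + delta) c d z -> z <> p.
  by move=> [_ h] e; move: h; rewrite e /p /=; lra.
have inD z : in_rect (x - delta) (x + delta) c d z -> orect (x - eta) (x + eta) (c - 1) (d + 1) z.
  by move=> [? ?]; split; lra.
have hgD w : orect (x - eta) (x + eta) (c - 1) (d + 1) w -> hol g w.
  by move=> [h _]; apply: hg; apply: Rabs_def1; lra.
have pD : orect (x - eta) (x + eta) (c - 1) (d + 1) p by split; rewrite /p /=; lra.
have qh := quot_hol pD hgD.
have cinv : bcont (fun s => / (s - p))%C (x - delta) (x + delta) c d.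
  move=> z /bdry hz; apply: ccont_inv; first exact: Csub_neq0.
  by apply: ccont_minus; [apply: ccont_id | apply: ccont_const].
rewrite (rect_ext (G := fun s => (quot g p s + g p * / (s - p))%C)); try lra; last first.
  by move=> z /bdry hz; rewrite quotE //; field; apply: Csub_neq0.
rewrite rect_plus; try lra; last 2 first.
- by move=> z [hz _]; apply/hol_ccont/qh/inD.
- by move=> z hz; apply: ccont_mult; [apply: ccont_const | apply: cinv].
rewrite rect_scal //; try lra.
rewrite (goursat (F := quot g p)); [|lra|lra|by move=> z /inD; apply: qh].
by rewrite rect_inv; [ring | lra | lra].
Qed.

Lemma rect_lsum (g : C -> C) (delta T eta : R) (l : seq C) : 0 < delta < eta -> 0 < T ->
  (forall s, Rabs (Re s - 1 / 2) < eta -> hol g s) ->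
  (forall p, p \in l -> Re p = (1 / 2)%R /\ Rabs (Im p) < T) ->
  bcont (fun s => lsum (fun p => / (s - p)) l * g s)%C (1 / 2 - delta) (1 / 2 + delta) (- T) T /\
  rect (fun s => lsum (fun p => / (s - p)) l * g s)%C (1 / 2 - delta) (1 / 2 + delta) (- T) T =
   (2 * PI * Ci * lsum g l)%C.
Proof.
move=> hd hT hg.
have cg z : on_border (1 / 2 - delta) (1 / 2 + delta) (- T) T z -> ccontC g z.
  by move=> [[h _] _]; apply/hol_ccont/hg; apply: Rabs_def1; lra.
elim: l => [|p l ih] hl.
  split; first by move=> z hz /=; apply: ccont_mult; [apply: ccont_const | apply: cg].
  by rewrite /= rect_scal; [ring | lra | lra | exact: cg].
have [hp1 hp2] := hl p ltac:(by rewrite inE eqxx).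
have [ih1 ih2] := ih (fun q hq => hl q ltac:(by rewrite inE hq orbT)).
have {}hp2 := Rabs_def2 _ _ hp2.
have bdry z : on_border (1 / 2 - delta) (1 / 2 + delta) (- T) T z -> (z - p)%C <> 0.
  by move=> [_ h]; apply: Csub_neq0 => e; move: h; rewrite e; lra.
have c1 : bcont (fun s => g s / (s - p))%C (1 / 2 - delta) (1 / 2 + delta) (- T) T.
  move=> z hz; apply: ccont_div; [exact: bdry | exact: cg |].
  by apply: ccont_minus; [apply: ccont_id | apply: ccont_const].
split.
  move=> z hz /=; apply: (@ccont_ext_loc C_UniformSpace (fun s => g s / (s - p) + lsum (fun p => / (s - p)) l * g s)%C).
    by apply: filter_forall => s /=; rewrite /Cdiv; ring.
  by apply: ccont_plus; [apply: c1 | apply: ih1].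
rewrite (rect_ext (G := fun s => (g s / (s - p) + lsum (fun p => / (s - p)) l * g s)%C)); try lra; last first.
  by move=> z hz /=; rewrite /Cdiv; ring.
rewrite rect_plus //; try lra.
rewrite ih2; have -> : p = ((1 / 2)%R, Im p) by apply: C_ext.
by rewrite (rect_pole (eta := eta)) //=; [ring | lra].
Qed.

(** All zeros in the closed rectangle are divided out; they lie on the critical line by [rh] and off
    the horizontal sides by [hTz]. The factorization is returned along with the integral, so that
    the same list [l] can be compared with the heights. *)
Lemma residue_rect (F g : C -> C) (delta T eta : R) : L_like F ->
  riemann_hypothesis F -> 0 < delta < 1 / 2 -> delta < eta -> 0 < T ->
  (forall s, Rabs (Re s - 1 / 2) < eta -> hol g s) ->
  (forall s, Rabs (Re s - 1 / 2) <= delta -> Im s = T \/ Im s = (- T)%R -> F s <> 0) ->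
  exists (l : seq C) (G : C -> C), entire G /\ (forall s, F s = (lprod l s * G s)%C) /\
    (forall p, p \in l -> Re p = (1 / 2)%R /\ Rabs (Im p) < T) /\
    (forall y, Rabs y <= T -> G ((1 / 2)%R, y) <> 0) /\
    rect (fun s => logderiv F s * g s)%C (1 / 2 - delta) (1 / 2 + delta) (- T) T =
    (2 * PI * Ci * lsum g l)%C.
Proof.
move=> hF rh hd he hT hg hTz.
have F0 : F (5, 0) <> 0 by apply/Cmod_gt_0; have := L_like_lower hF 0; lra.
pose B := in_rect (1 / 2 - delta) (1 / 2 + delta) (- T) T.
pose r := (10 + T)%R.
have [M HM] : exists M, forall w, Cmod (w - (5, 0)) <= 4 * r -> Cmod (F w) <= M.
  have [K [A HK]] := L_like_growth hF (5 - 4 * r) (5 + 4 * r).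
  exists (Rabs K * (1 + 4 * r) ^ A)%R => w hw.
  have /Rabs_le_between h1 : Rabs (Re w - 5) <= 4 * r by apply: Rle_trans (re_le_Cmod (w - (5, 0))) _.
  have h2 : Rabs (Im w - 0) <= 4 * r by apply: Rle_trans (im_le_Cmod (w - (5, 0))) _.
  rewrite Rminus_0_r in h2; have h3 := Rabs_pos (Im w).
  apply: Rle_trans (HK w _) _; first lra.
  apply: Rle_trans (Rmult_le_compat_r _ _ _ _ (Rle_abs K)) _; first by apply: pow_le; lra.
  by apply: Rmult_le_compat_l; [apply: Rabs_pos | apply: pow_incr; lra].
have hB p : B p -> Cmod (p - (5, 0)) <= r.
  move=> [h1 h2]; apply: Rle_trans (Cmod_le_abs _) _.
  apply: Rle_trans (Rplus_le_compat _ 6 _ T _ _) _; last by rewrite /r; lra.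
  - by apply/Rabs_le; rewrite /Re /= -/(Re p); lra.
  - by apply/Rabs_le; rewrite /Im /= -/(Im p); lra.
have r1 : 1 <= r by rewrite /r; lra.
have [l [G [hG [E [hl hGn]]]]] := factor_zeros r1 HM (L_like_entire hF) F0 hB.
exists l, G; split=> //; split=> //.
have Fl p : p \in l -> F p = 0 by move=> /lprod_eq0 h; rewrite E h; ring.
have hl2 p : p \in l -> Re p = (1 / 2)%R /\ Rabs (Im p) < T.
  move=> hp; have [b1 b2] := hl p hp; have Fp := Fl p hp; split.
    by apply: rh => //; lra.
  have := hTz p ltac:(apply/Rabs_le; lra) => h.
  have : Im p <> T /\ Im p <> (- T)%R by split=> e; apply: h => //; [left | right].
  by move=> [? ?]; apply: Rabs_def1; lra.
split=> //; split.
  by move=> y /Rabs_le_between hy; apply: hGn; split => /=; lra.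
have hgB z : B z -> hol g z by move=> [h _]; apply: hg; apply: Rabs_def1; lra.
have hGg z : B z -> hol (fun s => C_derive G s / G s * g s)%C z.
  move=> hz; apply: hol_mult; last exact: hgB.
  apply: hol_div; [exact: hGn | | exact: entire_hol].
  by apply: entire_hol; apply: entire_C_derive.
have [c1 c2] := rect_lsum (conj (proj1 hd) he) hT hg hl2.
rewrite (rect_ext (G := fun s => (lsum (fun p => / (s - p)) l * g s + C_derive G s / G s * g s)%C)); try lra; last first.
  move=> z [hz hb]; have Fz : F z <> 0.
    move=> Fz0; have [b1 b2] := hz.
    have z12 : Re z = (1 / 2)%R by apply: rh => //; lra.
    apply: (hTz z) => //; first by rewrite z12 Rminus_diag Rabs_R0; lra.
    by move: hb; rewrite z12; lra.
  by rewrite (logderiv_factor hG E Fz); ring.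
rewrite rect_plus; try lra; first last.
- by move=> z [hz _]; apply/hol_ccont/hGg.
- exact: c1.
rewrite c2 (goursat (F := fun s => (C_derive G s / G s * g s)%C)); [ring | lra | lra | exact: hGg].
Qed.

HB.instance Definition _ := Monoid.isComLaw.Build C (RtoC 0) Cplus Cplus_assoc Cplus_comm Cplus_0_l.

(** * Multiplicities and heights of the zeros *)

(* The order of vanishing is read off from [|F|] on a vertical line, because
   only [|L|] is known to be symmetric in [y]. *)
Definition has_ord (f : R -> R) (k : nat) : Prop :=
  exists d m M, 0 < d /\ 0 < m /\ forall h, 0 < Rabs h < d ->
    m * Rabs h ^ k <= f h <= M * Rabs h ^ k.

Lemma has_ord_unique (f : R -> R) (k k' : nat) : has_ord f k -> has_ord f k' -> k = k'.
Proof.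
have main i j : has_ord f i -> has_ord f j -> (i < j)%N -> False.
  move=> [d [m [M [d0 [m0 H]]]]] [d' [m' [M' [d'0 [m'0 H']]]]] ij.
  have M0 : 0 < Rabs M' + 1 by have := Rabs_pos M'; lra.
  (* Small enough for [M' * h ^ j < m * h ^ i]: one factor [h] is below [m / (|M'| + 1)], and the
     remaining powers are at most 1. *)
  pose h := (Rmin (Rmin d d') (Rmin 1 (m / (Rabs M' + 1))) / 2)%R.
  have mm : 0 < m / (Rabs M' + 1) by apply: Rdiv_lt_0_compat.
  have a0 : 0 < Rmin (Rmin d d') (Rmin 1 (m / (Rabs M' + 1))).
    by do !apply: Rmin_glb_lt => //; lra.
  have a1 := Rmin_l (Rmin d d') (Rmin 1 (m / (Rabs M' + 1))).
  have a2 := Rmin_r (Rmin d d') (Rmin 1 (m / (Rabs M' + 1))).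
  have a3 := Rmin_l d d'; have a4 := Rmin_r d d'.
  have a5 := Rmin_l 1 (m / (Rabs M' + 1)); have a6 := Rmin_r 1 (m / (Rabs M' + 1)).
  have h0 : 0 < h by rewrite /h; lra.
  have hh : Rabs h = h by rewrite Rabs_pos_eq; lra.
  have h1 : h < m / (Rabs M' + 1) by rewrite /h; lra.
  have h1' : h < 1 by rewrite /h; lra.
  have [b1 _] := H h ltac:(rewrite hh /h; lra).
  have [_ b2] := H' h ltac:(rewrite hh /h; lra).
  rewrite hh in b1 b2.
  have pi : 0 < h ^ i by apply: pow_lt.
  have e : h ^ j <= h ^ i * h.
    have -> : h ^ j = (h ^ i.+1 * h ^ (j - i.+1)%N)%R by rewrite -pow_add plusE subnKC.
    have q1 : h ^ (j - i.+1)%N <= 1 by rewrite -(pow1 (j - i.+1)%N); apply: pow_incr; lra.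
    have q2 : 0 < h ^ i.+1 by apply: pow_lt.
    rewrite (_ : h ^ i * h = h ^ i.+1)%R; last by rewrite /=; ring.
    by nra.
  have b3 : M' * h ^ j <= (Rabs M' + 1) * (h ^ i * h).
    apply: (Rle_trans _ ((Rabs M' + 1) * h ^ j)).
      by apply: Rmult_le_compat_r; [apply: pow_le; lra | have := Rle_abs M'; lra].
    by apply: Rmult_le_compat_l => //; lra.
  have b4 : h * (Rabs M' + 1) < m by apply/Rlt_div_r.
  nra.
move=> h h'; case: (ltngtP k k') => // c; exfalso.
- exact: (main k k').
- exact: (main k' k).
Qed.

Lemma has_ord_ext (f g : R -> R) (k : nat) : (forall h, f h = g h) -> has_ord f k -> has_ord g k.
Proof.
by move=> e [d [m [M [d0 [m0 H]]]]]; exists d, m, M; split=> //; split=> // h /H; rewrite e.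
Qed.

Lemma has_ord_neg (f : R -> R) (k : nat) : has_ord f k -> has_ord (fun h => f (- h)%R) k.
Proof.
move=> [d [m [M [d0 [m0 H]]]]]; exists d, m, M; split=> //; split=> // h hh.
by have := H (- h)%R; rewrite Rabs_Ropp; apply.
Qed.

Lemma has_ord_power (F G : C -> C) (x y : R) (k : nat) (r : R) : 0 < r ->
  (forall w, Cmod (w - (x, y)) < r -> F w = ((w - (x, y)) ^ k * G w)%C) ->
  hol G (x, y) -> G (x, y) <> 0 ->
  has_ord (fun h => Cmod (F (x, (y + h)%R))) k.
Proof.
move=> r0 E hG G0.
have g0 : 0 < Cmod (G (x, y)) by apply/Cmod_gt_0.
have g2 : 0 < Cmod (G (x, y)) / 2 by lra.
have [l hl] := hG; have [d [d0 Hd]] := cder_cont_eps hl g2.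
exists (Rmin r d), (Cmod (G (x, y)) / 2)%R, (2 * Cmod (G (x, y)))%R.
split; first exact: Rmin_glb_lt.
split=> // h [h0 hh].
have c : Cmod ((x, (y + h)%R) - (x, y)) = Rabs h.
  rewrite (_ : ((x, (y + h)%R) - (x, y) = Ci * RtoC h)%C).
    by rewrite Cmod_mult Cmod_Ci Cmod_R; ring.
  by apply: C_ext; rewrite /Re /Im /=; ring.
have := Rmin_l r d; have := Rmin_r r d => m1 m2.
rewrite E; last by rewrite c; lra.
rewrite Cmod_mult Cmod_pow c.
have {}Hd := Hd (x, (y + h)%R) ltac:(rewrite c; lra).
have t1 := Cmod_triangle_inv (G (x, (y + h)%R)) (G (x, y)).
have t2 := Cmod_triangle_inv (G (x, y)) (G (x, (y + h)%R)).
rewrite Cmod_sub_sym in t2.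
have p : 0 <= Rabs h ^ k by apply: pow_le; lra.
by split; nra.
Qed.

Lemma zero_order_ord (F : C -> C) (x y : R) (k : nat) :
  zero_order F (x, y) k -> has_ord (fun h => Cmod (F (x, (y + h)%R))) k.
Proof.
move=> [G [G0 [eps H]]].
have inb w : Cmod (w - (x, y)) < eps ->
    ex_derive (K := C_AbsRing) (V := C_NormedModule) G w /\ F w = ((w - (x, y)) ^ k * G w)%C.
  move=> hw; apply: H.
  by split; rewrite /ball /= /AbsRing_ball /abs /minus /plus /opp /=; apply: Rle_lt_trans hw;
   [apply: (re_le_Cmod (w - (x, y))) | apply: (im_le_Cmod (w - (x, y)))].
apply: (has_ord_power (G := G) (r := eps)) => //.
- exact: cond_pos.
- by move=> w /inb [].
- apply/holE; apply: (proj1 (inb _ _)).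
  by rewrite (_ : ((x, y) - (x, y) = 0)%C) ?Cmod_0; [apply: cond_pos | ring].
Qed.

Lemma lprod_order (l : seq C) (s : C) : exists H, entire H /\ H s <> 0 /\
  forall w, lprod l w = ((w - s) ^ count_mem s l * H w)%C.
Proof.
elim: l => [|p l [H [hH [H0 E]]]].
  exists (fun=> 1); split; first by move=> z; apply/holE; apply: hol_const.
  by split=> [/RtoC_inj|w /=]; [lra | ring].
rewrite /=; case: (eqVneq p s) => [->|ne].
  by exists H; split=> //; split=> // w; rewrite E (_ : (true + _ = (count_mem s l).+1)%N) // Cpow_S Cmult_assoc.
exists (fun w => (w - p) * H w)%C; split; [|split].
- move=> z; apply/holE; apply: hol_mult; last exact: entire_hol.
  by apply: hol_minus; [apply: hol_id | apply: hol_const].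
- by apply: Cmult_neq_0 => //; apply: Csub_neq0 => e; move: ne; rewrite e eqxx.
- by move=> w; rewrite E add0n !Cmult_assoc (Cmult_comm (w - p)).
Qed.

Lemma factor_ord (F G : C -> C) (l : seq C) (x y : R) : entire G ->
  (forall s, F s = (lprod l s * G s)%C) -> G (x, y) <> 0 ->
  has_ord (fun h => Cmod (F (x, (y + h)%R))) (count_mem (x, y) l).
Proof.
move=> hG E G0; have [H [hH [H0 E2]]] := lprod_order l (x, y).
apply: (has_ord_power (G := fun w => (H w * G w)%C) Rlt_0_1).
- by move=> w _; rewrite E E2 Cmult_assoc.
- by apply: hol_mult; apply: entire_hol.
- exact: Cmult_neq_0.
Qed.

Lemma count_Im (l : seq C) (x y : R) : (forall p, p \in l -> Re p = x) ->
  count_mem y [seq Im p | p <- l] = count_mem (x, y) l.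
Proof.
move=> h; rewrite count_map; apply: eq_in_count => p /h hp /=.
by case: p hp => a b /= ->; rewrite /eq_op /= eqxx.
Qed.

Lemma count_Im_le (l : seq C) (x y : R) :
  (count_mem (x, y) l <= count_mem y [seq Im p | p <- l])%N.
Proof.
rewrite count_map; apply: sub_count => p /= /eqP ->; exact: eqxx.
Qed.

Section Heights.
Variables (F : C -> C) (gamma : nat -> R).
Hypothesis hg : zero_heights F gamma.

(** [k] counts all indices with height [y], so a duplicate-free list meets at most [k] of them, and
    exactly [k] once it contains them all. At the centre the order of vanishing is [2 * k]. *)
Lemma count_height (s : seq nat) (y : R) : uniq s -> 0 <= y ->
  exists k, (count_mem y [seq gamma t | t <- s] <= k)%N /\
   (0 < y -> zero_order F ((1 / 2)%R, y) k) /\ (y = 0 -> zero_order F ((1 / 2)%R, y) (2 * k)%N) /\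
   ((forall t, gamma t = y -> t \in s) -> count_mem y [seq gamma t | t <- s] = k).
Proof.
move=> us y0; have [l [ul [hl [h1 h2]]]] := heights_mult hg y0.
exists (size l); rewrite count_map -size_filter.
have uf : uniq (filter (preim gamma (pred1 y)) s) by apply: filter_uniq.
split; last split=> //; last split=> //.
- by apply: uniq_leq_size => // t; rewrite mem_filter => /andP [/eqP /hl].
- move=> h; apply: perm_size; apply: uniq_perm => // t.
  rewrite mem_filter; apply/andP/idP => [[/eqP /hl] //|/hl e].
  by split; [apply/eqP | apply: h].
Qed.

(** Multiplicities are compared value by value through [has_ord_unique]. At [y = 0] only half of the
    zeros are listed as heights, which is harmless for an upper bound. *)
Lemma heights_density (l : seq C) (G : C -> C) (P : pred R) (s : seq nat) : entire G ->
  (forall s, F s = (lprod l s * G s)%C) -> uniq s ->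
  (forall y, 0 <= y -> P y -> G ((1 / 2)%R, y) <> 0) ->
  (size (filter (fun t => P (gamma t)) s) <= size l)%N.
Proof.
move=> hG E us hP.
set s' := filter _ s.
have us' : uniq s' by apply: filter_uniq.
have : forall y, (count_mem y [seq gamma t | t <- s'] <= count_mem y [seq Im p | p <- l])%N.
  move=> y; case: (classic (P y /\ 0 <= y)) => [[Py y0]|h].
    apply: leq_trans (count_Im_le l (1 / 2) y).
    have o := factor_ord hG E (hP y y0 Py).
    have [k [k1 [k2 [k3 _]]]] := count_height us' y0.
    apply: (leq_trans k1).
    case: (Rle_lt_or_eq_dec _ _ y0) => y0'.
      by rewrite (has_ord_unique o (zero_order_ord (k2 y0'))).
    by rewrite (has_ord_unique o (zero_order_ord (k3 (esym y0')))) leq_pmull.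
  suff -> : count_mem y [seq gamma t | t <- s'] = 0%N by [].
  apply/eqP; rewrite -leqn0 leqNgt -has_count; apply/hasPn => z /mapP [t].
  rewrite mem_filter => /andP [Pt _] ->; apply/negP => /eqP e; apply: h.
  by rewrite -e; split=> //; apply: (heights_ge0 hg).
move=> /count_subseqP [s2 ss /perm_size]; rewrite size_map => ->.
by apply: leq_trans (size_subseq ss) _; rewrite size_map.
Qed.

(** [n] is the first index whose height reaches [T]. Multiplicities agree at [y > 0] because the
    order of vanishing is unique, and they pass to [y < 0] by the symmetry of [|F|]. *)
Lemma heights_perm (l : seq C) (G : C -> C) (T : R) : entire G ->
  (forall s, F s = (lprod l s * G s)%C) ->
  (forall y, Cmod (F ((1 / 2)%R, y)) = Cmod (F ((1 / 2)%R, (- y)%R))) ->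
  (forall p, p \in l -> Re p = (1 / 2)%R /\ Rabs (Im p) < T) ->
  (forall y, Rabs y <= T -> G ((1 / 2)%R, y) <> 0) ->
  exists n, (forall t, (t < n)%N <-> gamma t < T) /\
   perm_eq [seq Im p | p <- l] ([seq gamma t | t <- seq.iota 0%N n] ++ [seq (- gamma t)%R | t <- seq.iota 0%N n]).
Proof.
move=> hG E sym hl hGn.
pose big t : bool := if Rle_dec T (gamma t) then true else false.
have bigP t : big t <-> T <= gamma t by rewrite /big; case: Rle_dec.
(* Otherwise [size l + 1] heights would lie below [T], more than [heights_density] allows. *)
have ex_big : exists t, big t.
  apply: NNPP => hn.
  have small t : gamma t < T by apply: Rnot_le_lt => h; apply: hn; exists t; apply/bigP.
  pose P y : bool := if Rlt_dec y T then true else false.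
  have PP y : P y <-> y < T by rewrite /P; case: Rlt_dec.
  have := @heights_density l G P (seq.iota 0%N (size l).+1) hG E (iota_uniq _ _).
  rewrite (eq_filter (a2 := predT)) => [|t]; last by apply/PP.
  rewrite filter_predT size_iota ltnn => H; have // : false.
  by apply: H => y y0 /PP yT; apply: hGn; rewrite Rabs_pos_eq; lra.
case: (ex_minnP ex_big) => n /bigP hn hmin.
have nP t : (t < n)%N <-> gamma t < T.
  split=> h.
    by apply: Rnot_le_lt => /bigP /hmin; rewrite leqNgt h.
  by rewrite ltnNge; apply/negP => /(heights_sorted hg); lra.
exists n; split=> //.
set zs := [seq gamma t | t <- seq.iota 0%N n].
have czs y : 0 <= y -> y < T -> exists k, count_mem y zs = k /\
   (0 < y -> zero_order F ((1 / 2)%R, y) k) /\ (y = 0 -> zero_order F ((1 / 2)%R, y) (2 * k)%N).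
  move=> y0 yT; have [k [_ [k2 [k3 k4]]]] := count_height (iota_uniq 0%N n) y0.
  exists k; split=> //; apply: k4 => t e; rewrite mem_iota add0n.
  by apply/andP; split=> //; apply/nP; rewrite e.
have neg : [seq (- gamma t)%R | t <- seq.iota 0%N n] = [seq (- y)%R | y <- zs] by rewrite -map_comp.
have cneg y : count_mem y [seq (- y)%R | y <- zs] = count_mem (- y)%R zs.
  rewrite count_map; apply: eq_count => z /=.
  by apply/eqP/eqP => [<-|->]; rewrite Ropp_involutive.
have zs_out y : y < 0 \/ T <= y -> count_mem y zs = 0%N.
  move=> hy; apply/eqP; rewrite -leqn0 leqNgt -has_count -all_predC; apply/allP => z.
  move=> /mapP [t]; rewrite mem_iota add0n => /andP [_ /nP ht] ->; apply/negP => /eqP e.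
  by have := heights_ge0 hg t; lra.
rewrite neg; apply/allP => y _ /=; apply/eqP; rewrite count_cat cneg.
have cl z : count_mem z [seq Im p | p <- l] = count_mem ((1 / 2)%R, z) l.
  by apply: count_Im => p /hl [].
case: (Rle_lt_dec T (Rabs y)) => hy.
  rewrite (_ : count_mem y [seq Im p | p <- l] = 0%N); last first.
    apply/eqP; rewrite -leqn0 leqNgt -has_count -all_predC; apply/allP => z.
    by move=> /mapP [p /hl [_ hp] ->]; apply/negP => /eqP e; rewrite e in hp; lra.
  have [h1 h2] : (y < 0 \/ T <= y) /\ (- y < 0 \/ T <= - y).
    by move: hy; rewrite /Rabs; case: Rcase_abs => ? ?; split; lra.
  by rewrite zs_out // zs_out.
rewrite cl.
have o z : Rabs z < T -> has_ord (fun h => Cmod (F ((1 / 2)%R, (z + h)%R))) (count_mem ((1 / 2)%R, z) l).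
  by move=> hz; apply: (factor_ord hG E); apply: hGn; lra.
have cpos z : 0 < z -> z < T -> count_mem ((1 / 2)%R, z) l = count_mem z zs.
  move=> z0 zT; have [k [-> [k2 _]]] := czs z (Rlt_le _ _ z0) zT.
  by apply: (has_ord_unique (o z _) (zero_order_ord (k2 z0))); rewrite Rabs_pos_eq; lra.
have csym z : Rabs z < T -> count_mem ((1 / 2)%R, z) l = count_mem ((1 / 2)%R, (- z)%R) l.
  move=> hz; apply: (has_ord_unique (o z hz)).
  have := has_ord_neg (o (- z)%R ltac:(by rewrite Rabs_Ropp)).
  apply: has_ord_ext => h; rewrite sym; congr (Cmod (F (_, _))); ring.
have [d1 d2] := Rabs_def2 _ _ hy.
case: (Rtotal_order y 0) => [yn|[y0|yp]].
- rewrite csym // cpos; try lra.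
  by rewrite (zs_out y) //; left.
(* The centre has order [2 * k], and its [k] listed heights occur in both halves of the list, once
   as [0] and once as [- 0]. *)
- have [k [c0 [_ k3]]] := czs y ltac:(lra) ltac:(lra).
  rewrite (has_ord_unique (o y hy) (zero_order_ord (k3 y0))) c0.
  by rewrite y0 Ropp_0 -y0 c0 mul2n addnn.
- by rewrite cpos; [rewrite (zs_out (- y)%R) ?addn0 //; left; lra | lra | lra].
Qed.

End Heights.

(** * Improper integrals and sums over the heights *)

Definition clim (J : nat -> C) (l : C) : Prop :=
  forall e, 0 < e -> exists N, forall n, (N <= n)%N -> Cmod (J n - l) < e.

Lemma clim_cauchy (J : nat -> C) :
  (forall e, 0 < e -> exists N, forall n m, (N <= n)%N -> (n <= m)%N -> Cmod (J m - J n) < e) ->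
  exists l, clim J l.
Proof.
move=> H.
have H' e : 0 < e -> exists N : nat, forall n m, (N <= n)%coq_nat -> (N <= m)%coq_nat -> Cmod (J n - J m) < e.
  move=> he; have [N HN] := H e he; exists N => n m /leP hn /leP hm.
  case: (leqP n m) => hnm; first by rewrite Cmod_sub_sym; apply: HN.
  by apply: HN => //; apply: ltnW.
have [lr /is_lim_seq_spec hlr] : ex_finite_lim_seq (fun n => Re (J n)).
  apply/ex_lim_seq_cauchy_corr => e; have [N HN] := H' e (cond_pos e).
  exists N => n m hn hm; apply: Rle_lt_trans (HN n m hn hm); exact: (re_le_Cmod (J n - J m)).
have [li /is_lim_seq_spec hli] : ex_finite_lim_seq (fun n => Im (J n)).
  apply/ex_lim_seq_cauchy_corr => e; have [N HN] := H' e (cond_pos e).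
  exists N => n m hn hm; apply: Rle_lt_trans (HN n m hn hm); exact: (im_le_Cmod (J n - J m)).
exists (lr, li) => e he; have he2 : 0 < e / 2 by lra.
have [N1 H1] := hlr (mkposreal _ he2); have [N2 H2] := hli (mkposreal _ he2).
exists (N1 + N2)%N => n hn.
have {}H1 := H1 n ltac:(apply/leP; apply: leq_trans hn; apply: leq_addr).
have {}H2 := H2 n ltac:(apply/leP; apply: leq_trans hn; apply: leq_addl).
apply: Rle_lt_trans (Cmod_le_abs _) _.
by move: H1 H2; rewrite /Re /Im /= /Rminus; lra.
Qed.

Lemma weight_neg_le1 (a y : R) : 0 <= a -> weight (- a) y <= 1.
Proof.
move=> ha; have := Rinv_le_contravar 1 (weight a y) Rlt_0_1 (weight_ge1 y ha).
by rewrite Rinv_1 /weight Rpower_Ropp.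
Qed.

Lemma weight_opp (a y : R) : weight a (- y) = weight a y.
Proof. by rewrite /weight Rabs_Ropp. Qed.

Lemma weight_neg_mono (a x y : R) : 0 <= a -> Rabs x <= Rabs y -> weight (- a) y <= weight (- a) x.
Proof.
move=> ha h; rewrite /weight !Rpower_Ropp; apply: Rinv_le_contravar; first exact: weight_gt0.
exact: weight_mono.
Qed.

Lemma weight_neg_lim (a e : R) : 0 < a -> 0 < e -> exists T0, 0 < T0 /\ forall T, T0 <= T -> weight (- a) T < e.
Proof.
move=> ha he; exists (1 + Rpower e (- / a))%R.
have e0 : 0 < Rpower e (- / a) by apply: exp_pos.
split; first lra; move=> T hT.
rewrite /weight (Rabs_pos_eq T); last lra.
have -> : e = Rpower (Rpower e (- / a)) (- a).
  rewrite Rpower_mult (_ : - / a * - a = 1)%R ?Rpower_1 //; field; lra.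
rewrite !(Rpower_Ropp _ a); apply: Rinv_lt_contravar.
  by apply: Rmult_lt_0_compat; apply: exp_pos.
by apply: Rlt_Rpower_l => //; lra.
Qed.

Lemma cint_tail (phi : R -> C) (B a b c : R) : 0 < a -> 0 <= b <= c -> 0 <= B ->
  (forall t, ccont phi t) -> (forall y, Cmod (phi y) <= B * weight (- (1 + a)) y) ->
  Cmod (cint phi b c) <= B / a * weight (- a) b.
Proof.
move=> ha hbc hB hc hb.
have ep : cex phi b c by apply: cex_cont.
have d y : 0 <= y -> is_derive (fun y => - (B / a) * Rpower (1 + y) (- a))%R y (B * Rpower (1 + y) (- (1 + a)))%R.
  move=> hy.
  have h : is_derive (fun y => Rpower (1 + y) (- a)) y (- a * Rpower (1 + y) (- (1 + a)))%R.
    rewrite /Rpower; auto_derive; first lra.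
    have -> : exp (- (1 + a) * ln (1 + y)) = (exp (- a * ln (1 + y)) * / (1 + y))%R.
      have -> : / (1 + y) = exp (- ln (1 + y)) by rewrite exp_Ropp exp_ln; lra.
      by rewrite -exp_plus; congr exp; ring.
    by field; lra.
  apply: (is_derive_eq (is_derive_scal _ _ (- (B / a))%R _ h)); field; lra.
have I : is_RInt (fun y => B * Rpower (1 + y) (- (1 + a)))%R b c
   (minus (- (B / a) * Rpower (1 + c) (- a)) (- (B / a) * Rpower (1 + b) (- a)))%R.
  apply: (is_RInt_derive (fun y => - (B / a) * Rpower (1 + y) (- a))%R) => y;
    rewrite Rmin_left ?Rmax_right; try lra; move=> hy.
  - by apply: d; lra.
  - apply: (ex_derive_continuous (fun y => B * Rpower (1 + y) (- (1 + a)))%R).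
    by rewrite /Rpower; auto_derive; lra.
have := @cint_norm_le phi (fun y => B * Rpower (1 + y) (- (1 + a)))%R b c (proj2 hbc) ep (ex_intro _ _ I).
rewrite (is_RInt_unique _ _ _ _ I) => H; apply: Rle_trans (H _) _.
  by move=> t ht; apply: Rle_trans (hb t) _; rewrite /weight Rabs_pos_eq; lra.
rewrite /minus /plus /opp /= /weight Rabs_pos_eq; last lra.
have : 0 <= B / a * Rpower (1 + c) (- a).
  by apply: Rmult_le_pos; [apply: Rdiv_le_0_compat | apply: Rlt_le; apply: exp_pos].
lra.
Qed.

Lemma cint_reflect (phi : R -> C) (b c : R) : (forall t, ccont phi t) ->
  cint phi (- c) (- b) = cint (fun t => phi (- t)%R) b c.
Proof.
move=> hc.
have h (f : R -> R) : (forall t, continuous f t) -> RInt f (- c) (- b) = RInt (fun t => f (- t)%R) b c.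
  move=> hf.
  have e1 : ex_RInt f (- c)%R (- b)%R by apply: (@ex_RInt_continuous R_CompleteNormedModule) => t _.
  have e2 : ex_RInt f (- b)%R (- c)%R by apply: ex_RInt_swap.
  have := is_RInt_comp_opp f b c _ (RInt_correct _ _ _ e2).
  move=> /is_RInt_opp /is_RInt_unique.
  rewrite opp_RInt_swap // => <-.
  by apply: RInt_ext => t _; rewrite opp_opp.
by apply: C_ext; rewrite /Re /Im /=; apply: h => t; case: (hc t).
Qed.

Lemma ccont_reflect (phi : R -> C) : (forall t, ccont phi t) -> forall t, ccont (fun t => phi (- t)%R) t.
Proof.
move=> hc t; have [h1 h2] := hc (- t)%R.
have ho : continuous Ropp t by apply: (continuous_opp (V := R_NormedModule)); apply: continuous_id.
split.
- exact: (continuous_comp Ropp (fun t => Re (phi t))).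
- exact: (continuous_comp Ropp (fun t => Im (phi t))).
Qed.

Lemma cint_tail_neg (phi : R -> C) (B a b c : R) : 0 < a -> 0 <= b <= c -> 0 <= B ->
  (forall t, ccont phi t) -> (forall y, Cmod (phi y) <= B * weight (- (1 + a)) y) ->
  Cmod (cint phi (- c) (- b)) <= B / a * weight (- a) b.
Proof.
move=> ha hbc hB hc hb; rewrite cint_reflect //; apply: cint_tail => //.
- exact: ccont_reflect.
- by move=> y; rewrite -(weight_opp _ y).
Qed.

Definition decays (phi : R -> C) (B a : R) : Prop :=
  0 < a /\ 0 <= B /\ (forall t, ccont phi t) /\
  forall y, Cmod (phi y) <= B * weight (- (1 + a)) y.

Lemma cint_diff (phi : R -> C) (B a T u v : R) : decays phi B a -> 0 <= T ->
  u <= - T -> T <= v -> Cmod (cint phi u v - cint phi (- T) T) <= 2 * B / a * weight (- a) T.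
Proof.
move=> [ha [hB [hc hb]]] hT hu hv.
have e x y : cex phi x y by apply: cex_cont.
have -> : (cint phi u v - cint phi (- T) T = cint phi (- (- u)) (- T) + cint phi T v)%C.
  rewrite Ropp_involutive.
  rewrite -(cint_Chasles (e u (- T)%R) (e (- T)%R v)) -(cint_Chasles (e (- T)%R T) (e T v)); ring.
apply: Rle_trans (Cmod_triangle _ _) _.
have h1 := cint_tail_neg (b := T) (c := - u) ha ltac:(lra) hB hc hb.
have h2 := cint_tail (b := T) (c := v) ha ltac:(lra) hB hc hb.
rewrite (_ : 2 * B / a = B / a + B / a)%R; [lra | field; lra].
Qed.

(* With the decay built in, the limit over symmetric intervals determines the
   integral over the line. *)
Definition improper (phi : R -> C) (I : C) : Prop :=
  (exists B a, decays phi B a) /\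
  forall e, 0 < e -> exists T0, 0 < T0 /\ forall T, T0 <= T -> Cmod (cint phi (- T) T - I) < e.

Lemma improper_exists (phi : R -> C) (B a : R) : decays phi B a ->
  exists I, improper phi I /\ Cmod I <= 2 * B / a.
Proof.
move=> h; have [ha [hB [hc hb]]] := h.
have A0 : 0 <= 2 * B / a by apply: Rdiv_le_0_compat; lra.
have small e : 0 < e -> exists T0, 0 < T0 /\ forall T, T0 <= T -> 2 * B / a * weight (- a) T < e.
  move=> he; have [T0 [T00 HT]] := weight_neg_lim ha (Rdiv_lt_0_compat e (1 + 2 * B / a) he ltac:(lra)).
  exists T0; split=> // T /HT /Rlt_div_r; move=> /(_ ltac:(lra)).
  by have := weight_gt0 (- a) T; nra.
pose J n := cint phi (- INR n) (INR n).
have [I hI] : exists I, clim J I.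
  apply: clim_cauchy => e he; have [T0 [T00 HT]] := small _ he.
  have [N HN] := INR_unbounded T0; exists N => n m /leP /le_INR hn /leP /le_INR hm.
  have n0 := pos_INR n.
  apply: Rle_lt_trans (cint_diff h n0 _ _) _; try lra.
  by apply: HT; lra.
have bound T : 0 <= T -> Cmod (cint phi (- T) T - I) <= 2 * B / a * weight (- a) T.
  move=> hT; apply: le_epsilon => e he.
  have [N1 H1] := hI _ he; have [N2 H2] := INR_unbounded T.
  pose n := (N1 + N2)%N.
  have {}H1 := H1 n (leq_addr _ _).
  have H3 : INR N2 <= INR n by apply: le_INR; apply/leP; apply: leq_addl.
  have n1 := cint_diff h hT (u := - INR n) (v := INR n) ltac:(lra) ltac:(lra).
  have -> : (cint phi (- T) T - I = - (J n - cint phi (- T) T) + (J n - I))%C by ring.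
  apply: Rle_trans (Cmod_triangle _ _) _; rewrite Cmod_opp -/(J n) in n1 *.
  by apply: Rplus_le_compat; [exact: n1 | exact: Rlt_le].
exists I; split; first split.
- by exists B, a.
- move=> e he; have [T0 [T00 HT]] := small e he; exists T0; split=> // T hT.
  by apply: Rle_lt_trans (bound T _) (HT T hT); lra.
(* The truncation at [T = 0] is the empty integral, so the tail estimate there bounds [I] itself. *)
- have := bound 0 (Rle_refl 0); rewrite Ropp_0 cint_point.
  rewrite (_ : (0 - I = - I)%C) ?Cmod_opp; last ring.
  have := weight_neg_le1 0 (Rlt_le _ _ ha); nra.
Qed.

Lemma improper_zero : improper (fun=> RtoC 0) 0.
Proof.
split.
  exists 0, 1; split; first lra; split; first lra; split; first by move=> t; apply: ccont_const.
  by move=> y; rewrite Cmod_0; lra.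
move=> e he; exists 1; split; first lra; move=> T _.
by rewrite cint_const Cmult_0_r (_ : (0 - 0 = 0)%C) ?Cmod_0 //; ring.
Qed.

(** In [line_integral] the two ends go to infinity independently. By [cint_diff] every interval
    containing [[-T, T]] gives nearly the same integral as [[-T, T]]. *)
Lemma improper_gen (phi : R -> C) (I : C) : improper phi I ->
  is_RInt_gen (V := C_R_CompleteNormedModule) phi (Rbar_locally m_infty) (Rbar_locally p_infty) I.
Proof.
move=> [[B [a h]] H].
have [ha [hB [hc hb]]] := h.
move=> P [eps HP].
have A0 : 0 <= 2 * B / a by apply: Rdiv_le_0_compat; lra.
have e2 : 0 < eps / 2 by have := cond_pos eps; lra.
have [T1 [T10 H1]] := H _ e2.
have [T2 [T20 H2]] := weight_neg_lim ha (Rdiv_lt_0_compat (eps / 2) (1 + 2 * B / a) e2 ltac:(lra)).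
pose T := Rmax T1 T2.
have hT1 : T1 <= T by apply: Rmax_l.
have hT2 : T2 <= T by apply: Rmax_r.
apply: (Filter_prod _ _ _ (fun u => u < - T) (fun v => T < v)).
- by exists (- T)%R.
- by exists T.
move=> u v hu hv; exists (cint phi u v); split.
  by apply: is_RInt_cint; apply: cex_cont.
apply: HP.
have close : Cmod (cint phi u v - I) < eps.
  have -> : (cint phi u v - I = (cint phi u v - cint phi (- T) T) + (cint phi (- T) T - I))%C by ring.
  apply: Rle_lt_trans (Cmod_triangle _ _) _.
  have k1 := cint_diff h (T := T) (u := u) (v := v) ltac:(lra) ltac:(lra) ltac:(lra).
  have k2 := H1 T hT1.
  have /Rlt_div_r k3 := H2 T hT2.
  have {}k3 := k3 ltac:(lra).
  have := weight_gt0 (- a) T; nra.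
split; rewrite /ball /= /AbsRing_ball /abs /minus /plus /opp /=; apply: Rle_lt_trans close.
- exact: (re_le_Cmod (cint phi u v - I)).
- exact: (im_le_Cmod (cint phi u v - I)).
Qed.

Lemma improper_unique (phi : R -> C) (I J : C) : improper phi I -> improper phi J -> I = J.
Proof.
move=> [_ h] [_ k]; apply: Csub_eq0; apply: Cmod_eq_0; apply: Rle_antisym; last exact: Cmod_ge_0.
apply: le_epsilon => e he; rewrite Rplus_0_l.
have e2 : 0 < e / 2 by lra.
have [T1 [_ H1]] := h _ e2; have [T2 [_ H2]] := k _ e2.
have {}H1 := H1 (Rmax T1 T2) (Rmax_l _ _); have {}H2 := H2 (Rmax T1 T2) (Rmax_r _ _).
set X := cint _ _ _ in H1 H2.
have -> : (I - J = (X - J) - (X - I))%C by ring.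
by apply: Rle_trans (Cmod_triangle _ _) _; rewrite Cmod_opp; lra.
Qed.

Lemma decays_plus (phi psi : R -> C) (B B' a a' : R) : decays phi B a -> decays psi B' a' ->
  decays (fun t => phi t + psi t)%C (B + B') (Rmin a a').
Proof.
move=> [ha [hB [hc hb]]] [ha' [hB' [hc' hb']]].
have m0 : 0 < Rmin a a' by apply: Rmin_glb_lt.
split=> //; split; first lra; split; first by move=> t; apply: ccont_plus.
move=> y; apply: Rle_trans (Cmod_triangle _ _) _; rewrite Rmult_plus_distr_r.
have mono x : Rmin a a' <= x -> weight (- (1 + x)) y <= weight (- (1 + Rmin a a')) y.
  by move=> hx; apply: Rle_Rpower; [have := Rabs_pos y; lra | lra].
apply: Rplus_le_compat.
- by apply: Rle_trans (hb y) _; apply: Rmult_le_compat_l => //; apply: mono; apply: Rmin_l.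
- by apply: Rle_trans (hb' y) _; apply: Rmult_le_compat_l => //; apply: mono; apply: Rmin_r.
Qed.

Lemma improper_plus (phi psi : R -> C) (I J : C) : improper phi I -> improper psi J ->
  improper (fun t => phi t + psi t)%C (I + J)%C.
Proof.
move=> [[B [a d]] h] [[B' [a' d']] k]; split.
  by exists (B + B')%R, (Rmin a a'); apply: decays_plus.
move=> e he; have e2 : 0 < e / 2 by lra.
have [T1 [T10 H1]] := h _ e2; have [T2 [T20 H2]] := k _ e2.
exists (Rmax T1 T2); split; first by apply: Rlt_le_trans T10 (Rmax_l _ _).
move=> T hT.
have {}H1 := H1 T (Rle_trans _ _ _ (Rmax_l _ _) hT).
have {}H2 := H2 T (Rle_trans _ _ _ (Rmax_r _ _) hT).
have [_ [_ [c1 _]]] := d; have [_ [_ [c2 _]]] := d'.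
rewrite cint_plus; [|by apply: cex_cont | by apply: cex_cont].
rewrite (_ : (_ - _ = (cint phi (- T) T - I) + (cint psi (- T) T - J))%C); last ring.
by apply: Rle_lt_trans (Cmod_triangle _ _) _; lra.
Qed.

Lemma improper_scal (c : C) (phi : R -> C) (I : C) : improper phi I ->
  improper (fun t => c * phi t)%C (c * I)%C.
Proof.
move=> [[B [a [ha [hB [hc hb]]]]] h].
have c0 := Cmod_ge_0 c.
split.
  exists (Cmod c * B)%R, a; split=> //; split; first exact: Rmult_le_pos.
  split; first by move=> t; apply: ccont_mult => //; apply: ccont_const.
  by move=> y; rewrite Cmod_mult Rmult_assoc; apply: Rmult_le_compat_l.
move=> e he; have e2 : 0 < e / (1 + Cmod c) by apply: Rdiv_lt_0_compat; lra.
have [T1 [T10 H1]] := h _ e2; exists T1; split=> // T hT.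
rewrite cint_scal; last by apply: cex_cont.
rewrite (_ : (_ - _ = c * (cint phi (- T) T - I))%C); last ring.
rewrite Cmod_mult; have := H1 T hT => /Rlt_div_r; move=> /(_ ltac:(lra)).
have := Cmod_ge_0 (cint phi (- T) T - I); nra.
Qed.

Lemma clim_Clim_seq (J : nat -> C) (l : C) : clim J l -> Clim_seq J = l.
Proof.
move=> h; apply: C_ext; rewrite /Clim_seq /Re /Im /=.
- rewrite (is_lim_seq_unique _ (Finite l.1)) //; apply/is_lim_seq_spec => e.
  have [N HN] := h e (cond_pos e); exists N => n /leP /HN hn.
  by apply: Rle_lt_trans hn; apply: (re_le_Cmod (J n - l)).
- rewrite (is_lim_seq_unique _ (Finite l.2)) //; apply/is_lim_seq_spec => e.
  have [N HN] := h e (cond_pos e); exists N => n /leP /HN hn.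
  by apply: Rle_lt_trans hn; apply: (im_le_Cmod (J n - l)).
Qed.

(** * Summability over the heights *)

Fixpoint rsum (w : nat -> R) (s : seq nat) : R :=
  if s is t :: s' then w t + rsum w s' else 0.

Lemma rsum_cat (w : nat -> R) (s s' : seq nat) : rsum w (s ++ s') = (rsum w s + rsum w s')%R.
Proof. by elim: s => [|t s ih] /=; rewrite ?ih; ring. Qed.

Lemma rsum_filter (w : nat -> R) (P : pred nat) (s : seq nat) :
  rsum w s = (rsum w (filter P s) + rsum w (filter (predC P) s))%R.
Proof. by elim: s => [|t s ih] /=; [ring | rewrite ih; case: (P t) => /=; ring]. Qed.

Lemma rsum_le_size (w : nat -> R) (s : seq nat) (B : R) :
  (forall t, t \in s -> w t <= B) -> rsum w s <= INR (size s) * B.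
Proof.
elim: s => [|t s ih] h; first by rewrite /=; lra.
rewrite [size _]/= S_INR /=.
have := h t; rewrite inE eqxx => /(_ isT).
have := ih (fun q hq => h q ltac:(by rewrite inE hq orbT)); lra.
Qed.

Lemma weight_0 (a : R) : weight a 0 = 1.
Proof. by rewrite /weight Rabs_R0 Rplus_0_r /Rpower ln_1 Rmult_0_r exp_0. Qed.

(** Comparison with the integral in telescoped form; the leading 1 is the term [k = 0]. *)
Lemma weight_sum (b : R) (m : nat) : 0 < b ->
  rsum (fun k => weight (- (1 + b)) (INR k)) (seq.iota 0 m) <= 1 + 1 / b.
Proof.
move=> hb.
suff main : rsum (fun k => weight (- (1 + b)) (INR k)) (seq.iota 0 m.+1) <= 1 + (1 - weight (- b) (INR m)) / b.
  apply: (Rle_trans _ (rsum (fun k => weight (- (1 + b)) (INR k)) (seq.iota 0 m.+1))).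
    rewrite -addn1 iotaD rsum_cat /=; have := weight_gt0 (- (1 + b)) (INR (0 + m)); lra.
  apply: Rle_trans main _; apply: Rplus_le_compat_l; rewrite /Rdiv.
  apply: Rmult_le_compat_r; first by apply: Rlt_le; apply: Rinv_0_lt_compat.
  by have := weight_gt0 (- b) (INR m); lra.
elim: m => [|m ih].
  by rewrite /= !weight_0 /Rdiv; lra.
rewrite -(addn1 m.+1) iotaD rsum_cat [rsum _ (seq.iota _ 1)]/= -/(INR m.+1) S_INR Rplus_0_r.
apply: Rle_trans (Rplus_le_compat_r _ _ _ ih) _.
have m0 := pos_INR m.
rewrite /weight !Rabs_pos_eq; try lra.
set x := (1 + (INR m + 1))%R; have -> : (1 + INR m = x - 1)%R by rewrite /x; ring.
have x2 : 2 <= x by rewrite /x; lra.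
(* With [x - 1 = x * (1 - / x)] this follows from [ln (1 - / x) <= - / x] and [1 + v <= exp v]. *)
have key : b * Rpower x (- (1 + b)) <= Rpower (x - 1) (- b) - Rpower x (- b).
  have -> : Rpower x (- (1 + b)) = (Rpower x (- b) * / x)%R.
    have -> : / x = Rpower x (- 1) by rewrite Rpower_Ropp Rpower_1; lra.
    by rewrite -Rpower_plus; congr Rpower; ring.
  have -> : Rpower (x - 1) (- b) = (Rpower x (- b) * exp (- b * ln (1 - / x)))%R.
    rewrite /Rpower -exp_plus; congr exp.
    have -> : (x - 1 = x * (1 - / x))%R by field; lra.
    rewrite ln_mult; [ring | lra |].
    have : / x <= / 2 by apply: Rinv_le_contravar; lra.
    lra.
  have ix : 0 < / x <= / 2 by split; [apply: Rinv_0_lt_compat; lra | apply: Rinv_le_contravar; lra].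
  have l1 : ln (1 - / x) <= - / x.
    have := exp_ineq1_le (ln (1 - / x)); rewrite exp_ln; lra.
  have := exp_ineq1_le (- b * ln (1 - / x)).
  have px : 0 < Rpower x (- b) by apply: exp_pos.
  have : b * / x <= - b * ln (1 - / x) by nra.
  nra.
have : Rpower x (- (1 + b)) <= (Rpower (x - 1) (- b) - Rpower x (- b)) / b.
  by apply/Rle_div_r; lra.
rewrite /Rdiv; lra.
Qed.

(** By [local_factor] at most [c * weight (eps / 2) m] heights lie in [[m, m + 1)], so the sum is
    dominated by the series of [weight (- (1 + eps / 2)) m]. *)
Lemma weights_bounded (F : C -> C) (gamma : nat -> R) (eps : R) : L_like F ->
  zero_heights F gamma -> 0 < eps ->
  exists W, forall N, rsum (fun t => weight (- (1 + eps)) (gamma t)) (seq.iota 0 N) <= W.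
Proof.
move=> hF hg he; have he2 : 0 < eps / 2 by lra.
have [c [c0 H]] := local_factor hF he2.
pose w t := weight (- (1 + eps)) (gamma t).
exists (c * (1 + 1 / (eps / 2)))%R => N.
(* Stated for every duplicate-free list, so that the induction can split off the heights in
   [[m, m + 1)] by filtering. *)
have main m : forall s : seq nat, uniq s -> (forall t, t \in s -> gamma t < INR m) ->
    rsum w s <= c * rsum (fun k => weight (- (1 + eps / 2)) (INR k)) (seq.iota 0 m).
  elim: m => [|m ih] s us hs.
    case: s us hs => [|t s] _ hs; first by rewrite /=; lra.
    by have := hs t; rewrite inE eqxx => /(_ isT); have := heights_ge0 hg t; rewrite /=; lra.
  pose P t : bool := if Rlt_dec (gamma t) (INR m) then true else false.
  have PP t : P t <-> gamma t < INR m by rewrite /P; case: Rlt_dec.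
  rewrite (rsum_filter w P) -addn1 iotaD rsum_cat add0n [rsum _ (seq.iota m 1)]/= Rplus_0_r Rmult_plus_distr_l.
  apply: Rplus_le_compat.
    apply: ih; first exact: filter_uniq.
    by move=> t; rewrite mem_filter => /andP [/PP].
  have m0 := pos_INR m.
  pose Q y : bool := if Rlt_dec y (INR m) then false else if Rlt_dec y (INR m + 1) then true else false.
  have QP y : Q y <-> INR m <= y < INR m + 1.
    by rewrite /Q; case: Rlt_dec => ?; [|case: Rlt_dec => ?]; split=> // *; lra.
  have e : filter (predC P) s = filter (fun t => Q (gamma t)) s.
    apply: eq_in_filter => t /hs ht; rewrite S_INR in ht.
    apply/idP/idP => [/negP h|/QP h] /=; first by apply/QP; split=> //; apply: Rnot_lt_le => /PP.
    by apply/negP => /PP; lra.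
  rewrite e.
  have [l [G [hG [E [_ [hGn [sz _]]]]]]] := H (INR m).
  have sl : (size (filter (fun t => Q (gamma t)) s) <= size l)%N.
    apply: (heights_density hg hG E us) => y y0 /QP hy; apply: hGn; split => /=; lra.
  have sR : INR (size (filter (fun t => Q (gamma t)) s)) <= c * weight (eps / 2) (INR m).
    by apply: Rle_trans sz; apply: le_INR; apply/leP.
  apply: Rle_trans (rsum_le_size (B := weight (- (1 + eps)) (INR m)) _) _.
    move=> t; rewrite mem_filter => /andP [/QP ht _]; apply: weight_neg_mono; first lra.
    by rewrite !Rabs_pos_eq; lra.
  rewrite (_ : weight (- (1 + eps / 2)) (INR m) = weight (eps / 2) (INR m) * weight (- (1 + eps)) (INR m))%R; last first.
    by rewrite -weight_plus; congr weight; field.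
  rewrite -Rmult_assoc; apply: Rmult_le_compat_r => //.
  exact: Rlt_le (weight_gt0 _ _).
have [m hm] : exists m, forall t, t \in seq.iota 0 N -> gamma t < INR m.
  have [m hm] := INR_unbounded (gamma N); exists m => t; rewrite mem_iota add0n => /andP [_ tN].
  by have := heights_sorted hg (ltnW tN); lra.
apply: Rle_trans (main m _ (iota_uniq _ _) hm) _.
by apply: Rmult_le_compat_l; [lra | apply: weight_sum].
Qed.

Definition csum (u : nat -> C) (N : nat) : C := \big[Cplus/RtoC 0]_(t < N) u t.

Lemma csumS (u : nat -> C) (N : nat) : csum u N.+1 = (csum u N + u N)%C.
Proof. by rewrite /csum big_ord_recr. Qed.

(** One [tail] serves all families dominated by [w]. This uniformity matters because the summand
    will depend on the truncation of the other variables. [tail 0] is the full sum of [w]. *)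
Lemma summable_tails (w : nat -> R) (W : R) : (forall t, 0 <= w t) ->
  (forall N, rsum w (seq.iota 0 N) <= W) ->
  exists tail : nat -> R, (forall N, 0 <= tail N <= tail 0%N) /\
    (forall e, 0 < e -> exists N0, forall N, (N0 <= N)%N -> tail N < e) /\
    (forall N, rsum w (seq.iota 0 N) <= tail 0%N) /\
    forall (u : nat -> C) K, (forall t, Cmod (u t) <= K * w t) ->
      exists S, forall N, Cmod (csum u N - S) <= K * tail N.
Proof.
move=> w0 hW.
pose s N := rsum w (seq.iota 0 N).
have sS N : s N.+1 = (s N + w N)%R.
  by rewrite /s -addn1 iotaD rsum_cat /= add0n; ring.
have mono n m : (n <= m)%N -> s n <= s m.
  move=> h; rewrite -(subnKC h); elim: (m - n)%N => [|k ih]; first by rewrite addn0; lra.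
  by rewrite addnS sS; have := w0 (n + k)%N; lra.
have [l hl] : ex_finite_lim_seq s.
  by apply: (ex_finite_lim_seq_incr s W) => // n; apply: mono.
have sl N : s N <= l by apply: (is_lim_seq_incr_compare s) => // n; apply: mono.
have s0 : s 0%N = 0 by [].
have tl0 e : 0 < e -> exists N0, forall N, (N0 <= N)%N -> l - s N < e.
  move=> he; move/is_lim_seq_spec: hl => /(_ (mkposreal _ he)) [N0 HN]; exists N0 => N /leP /HN /=.
  by move=> /Rabs_def2; lra.
exists (fun N => l - s N)%R; split.
  by move=> N; have := mono _ _ (leq0n N); have := sl N; lra.
split; first exact: tl0.
split; first by move=> N; rewrite s0; have := sl N; rewrite /s; lra.
move=> u K hu.
have k0 : 0 < 1 + Rabs K by have := Rabs_pos K; lra.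
have K0 t : 0 <= K * w t by apply: Rle_trans (hu t); apply: Cmod_ge_0.
have diff n m : (n <= m)%N -> Cmod (csum u m - csum u n) <= K * (s m - s n).
  move=> h; rewrite -(subnKC h); elim: (m - n)%N => [|k ih].
    by rewrite addn0 !Rminus_diag (_ : (csum u n - csum u n = 0)%C) ?Cmod_0; [lra | ring].
  rewrite addnS sS csumS (_ : (_ - _ = (csum u (n + k) - csum u n) + u (n + k)%N)%C); last ring.
  by apply: Rle_trans (Cmod_triangle _ _) _; have := hu (n + k)%N; lra.
have Kl n m : (n <= m)%N -> K * (s m - s n) <= Rabs K * (l - s n).
  move=> h; have := Rle_abs K; have := sl m; have := mono _ _ h; have := Rabs_pos K; nra.
have [S hS] : exists S, clim (csum u) S.
  apply: clim_cauchy => e he.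
  have [N0 HN] := tl0 (e / (1 + Rabs K)) (Rdiv_lt_0_compat _ _ he k0).
  exists N0 => n m hn hm; apply: Rle_lt_trans (diff n m hm) _.
  apply: Rle_lt_trans (Kl n m hm) _.
  have /Rlt_div_r h := HN n hn; have {}h := h k0.
  by have := sl n; have := Rabs_pos K; nra.
exists S => N; apply: le_epsilon => e he.
have e2 : 0 < e / 2 by lra.
have e3 : 0 < e / 2 / (1 + Rabs K) by apply: Rdiv_lt_0_compat; have := Rabs_pos K; lra.
have [N1 H1] := hS _ e2; have [N2 H2] := tl0 _ e3.
pose m := (N + (N1 + N2))%N.
have m1 : (N1 <= m)%N by rewrite /m addnCA leq_addr.
have m2 : (N2 <= m)%N by rewrite /m addnA leq_addl.
have {}H1 := H1 m m1; have /Rlt_div_r {}H2 := H2 m m2.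
have {}H2 := H2 k0.
rewrite (_ : (csum u N - S = - (csum u m - csum u N) + (csum u m - S))%C); last ring.
apply: Rle_trans (Cmod_triangle _ _) _; rewrite Cmod_opp.
have d := diff N m (leq_addr _ _).
have : K * (s m - s N) <= K * (l - s N) + e / 2.
  have := sl m; have := Rabs_pos K; have := Rle_abs (- K); rewrite Rabs_Ropp; nra.
lra.
Qed.

(** * The formula in one variable *)

Lemma Chalf : (1 / 2)%C = RtoC (1 / 2).
Proof. by apply: C_ext; rewrite /Re /Im /=; field. Qed.

Lemma half_plus (c y : R) : (1 / 2 + (c, y))%C = ((1 / 2 + c)%R, y).
Proof. by rewrite Chalf; apply: C_ext; rewrite /Re /Im /=; ring. Qed.

Lemma line_decays (F : C -> C) (delta eps : R) : L_like F -> riemann_hypothesis F ->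
  0 < delta < 1 / 2 -> 0 < eps ->
  exists c0, 0 < c0 /\ forall c, Rabs c = delta ->
    (forall y, ccont (fun y => logderiv F ((1 / 2 + c)%R, y)) y) /\
    (forall y, Cmod (logderiv F ((1 / 2 + c)%R, y)) <= c0 * weight (eps / 2) y).
Proof.
move=> hF rh hd he.
have he2 : 0 < eps / 2 by lra.
have [c0 [c00 H]] := line_bound hF rh hd he2.
exists c0; split=> // c hc.
have hs y : Rabs (Re ((1 / 2 + c)%R, y) - 1 / 2) = delta.
  by rewrite /= (_ : 1 / 2 + c - 1 / 2 = c)%R //; ring.
split=> y; last by have [_] := H _ (hs y).
have [F0 _] := H _ (hs y).
apply: (@ccont_vline (logderiv F)); apply: hol_ccont.
apply: hol_div => //; last exact: entire_hol (L_like_entire hF).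
by apply: entire_hol; apply: entire_C_derive; apply: L_like_entire.
Qed.

(** Functions of the rotated variable [x = Ci * z]: the line [Re z = c] becomes [Im x = c], and the
    zeros lie on the real axis. [K] stays explicit because the later errors are linear in it. *)
Record strip_class (eta eps K : R) (g : C -> C) : Prop := StripClass {
  strip_hol : forall x, Rabs (Im x) < eta -> hol g x;
  strip_decay : forall x, Rabs (Im x) < eta -> Cmod (g x) <= K * weight (- (1 + eps)) (Re x) }.

Lemma strip_line (eta eps K c : R) (g : C -> C) : strip_class eta eps K g -> Rabs c < eta ->
  (forall y, ccont (fun y => g (Ci * (c, y))%C) y) /\
  forall y, Cmod (g (Ci * (c, y))%C) <= K * weight (- (1 + eps)) y.
Proof.
move=> h hc.
have E y : (Ci * (c, y))%C = ((- y)%R, c) by apply: C_ext; rewrite /Re /Im /=; ring.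
split=> y.
  apply: (@ccont_vline (fun z => g (Ci * z)%C)).
  apply: hol_ccont; apply: (hol_comp (F := g)); first by apply: (strip_hol h); rewrite E.
  by apply: hol_mult; [apply: hol_const | apply: hol_id].
by rewrite -(weight_opp _ y) E; apply: (strip_decay h).
Qed.

Lemma decays_mult (h g : R -> C) (c0 K eps : R) : 0 < eps -> 0 < c0 -> 0 <= K ->
  (forall y, ccont h y) -> (forall y, Cmod (h y) <= c0 * weight (eps / 2) y) ->
  (forall y, ccont g y) -> (forall y, Cmod (g y) <= K * weight (- (1 + eps)) y) ->
  decays (fun y => h y * g y)%C (c0 * K) (eps / 2).
Proof.
move=> he c00 K0 ch bh cg bg; split; first lra; split; first by apply: Rmult_le_pos; lra.
split; first by move=> t; apply: ccont_mult.
move=> y; rewrite Cmod_mult.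
have -> : weight (- (1 + eps / 2)) y = (weight (eps / 2) y * weight (- (1 + eps)) y)%R.
  by rewrite -weight_plus; congr weight; field.
have -> : (c0 * K * (weight (eps / 2) y * weight (- (1 + eps)) y) = c0 * weight (eps / 2) y * (K * weight (- (1 + eps)) y))%R by ring.
by apply: Rmult_le_compat => //; apply: Cmod_ge_0.
Qed.

Lemma lsum_big (h : C -> C) (l : seq C) : lsum h l = \big[Cplus/RtoC 0]_(p <- l) h p.
Proof. by elim: l => [|p l ih]; rewrite ?big_nil // big_cons /= ih. Qed.

(** [residue_rect] on rectangles bounded by the heights of [good_heights], whose horizontal sides
    contribute at most a constant times [weight (- (1 + eps / 2)) k]. The zeros inside are the
    heights below [T] and their negatives, so evenness of [g] turns [2 * PI * Ci] into
    [4 * PI * Ci]. *)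
Lemma one_variable (F : C -> C) (gamma : nat -> R) (delta eta eps K : R) (g : C -> C) (Ip Im' S : C) :
  L_like F -> riemann_hypothesis F ->
  (forall y, Cmod (F ((1 / 2)%R, y)) = Cmod (F ((1 / 2)%R, (- y)%R))) ->
  zero_heights F gamma ->
  0 < delta < 1 / 2 -> delta < eta -> 0 < eps -> strip_class eta eps K g ->
  (forall y : R, g (RtoC (- y)) = g (RtoC y)) ->
  improper (fun y => logderiv F ((1 / 2 + delta)%R, y) * g (Ci * (delta, y)))%C Ip ->
  improper (fun y => logderiv F ((1 / 2 - delta)%R, y) * g (Ci * ((- delta)%R, y)))%C Im' ->
  clim (csum (fun t => g (RtoC (gamma t)))) S ->
  (Ci * Ip - Ci * Im')%C = (4 * PI * Ci * S)%C.
Proof.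
move=> hF rh sym hg hd he heps hS ev iP iM cS.
have K0 : 0 <= K.
  have h0 : Rabs (Im (RtoC 0)) < eta by rewrite /= Rabs_R0; lra.
  by have := strip_decay hS h0; rewrite /= weight_0 Rmult_1_r; have := Cmod_ge_0 (g 0); lra.
pose h s := g (Ci * (s - RtoC (1 / 2)))%C.
have hx x y : (Ci * ((x, y) - RtoC (1 / 2)))%C = ((- y)%R, (x - 1 / 2)%R).
  by apply: C_ext; rewrite /Re /Im /=; field.
have hh s : Rabs (Re s - 1 / 2) < eta -> hol h s.
  case: s => x y hs; apply: (hol_comp (F := g)); first by rewrite hx; apply: (strip_hol hS).
  by apply: hol_mult; [apply: hol_const | apply: hol_minus; [apply: hol_id | apply: hol_const]].
have hb s : Rabs (Re s - 1 / 2) < eta -> Cmod (h s) <= K * weight (- (1 + eps)) (Im s).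
  by case: s => x y hs; rewrite -(weight_opp _ (Im _)) /h hx; apply: (strip_decay hS).
have he2 : 0 < eps / 2 by lra.
have [c [c0 good]] := good_heights hF rh hd he2.
have step k : exists T n, INR k <= T <= INR k + 1 /\ (forall t, (t < n)%N <-> gamma t < T) /\
   (0 < INR k -> Cmod (Ci * cint (fun y => logderiv F ((1 / 2 + delta)%R, y) * g (Ci * (delta, y))) (- T) T -
     Ci * cint (fun y => logderiv F ((1 / 2 - delta)%R, y) * g (Ci * ((- delta)%R, y))) (- T) T -
     4 * PI * Ci * csum (fun t => g (RtoC (gamma t))) n)%C <= 4 * delta * c * K * weight (- (1 + eps / 2)) (INR k)).
  have [T [hT HT]] := good (INR k) (pos_INR k).
  (* [T = 0] forces [k = 0], where the estimate claims nothing; then [n = 0], as no height is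
     negative. *)
  case: (Rle_lt_or_eq_dec 0 T); [by have := pos_INR k; lra | move=> T0 | move=> T0]; last first.
    exists T, 0%N; split=> //; split; last by lra.
    by move=> t; split=> //; have := heights_ge0 hg t; lra.
  have HF s : Rabs (Re s - 1 / 2) <= delta -> Im s = T \/ Im s = (- T)%R -> F s <> 0.
    by move=> h1 h2; have [] := HT s h1 h2.
  have [l [G [hG [E [hl [hGn R1]]]]]] := residue_rect hF rh hd he T0 hh HF.
  have [n [nT perm]] := heights_perm hg hG E sym hl hGn.
  exists T, n; split=> //; split=> // k1.
  have ls : lsum h l = (2 * csum (fun t => g (RtoC (gamma t))) n)%C.
    have -> : lsum h l = \big[Cplus/RtoC 0]_(y <- [seq Im p | p <- l]) g (RtoC y).
      rewrite big_map lsum_big big_seq_cond [RHS]big_seq_cond; apply: eq_bigr => p /andP [/hl [hp _] _].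
      rewrite -ev /h; congr g; case: p hp => a b /= ->; rewrite hx.
      by apply: C_ext => /=; ring.
    rewrite (perm_big _ perm) /= big_cat /= !big_map.
    have -> : \big[Cplus/RtoC 0]_(t <- seq.iota 0 n) g (RtoC (- gamma t)) =
       \big[Cplus/RtoC 0]_(t <- seq.iota 0 n) g (RtoC (gamma t)).
      by apply: eq_bigr => t _; rewrite ev.
    have -> : \big[Cplus/RtoC 0]_(t <- seq.iota 0 n) g (RtoC (gamma t)) = csum (fun t => g (RtoC (gamma t))) n.
      by rewrite /csum -(big_mkord xpredT (fun t => g (RtoC (gamma t)))) /index_iota subn0.
    by ring.
  rewrite ls /rect in R1.
  have vP : vint (fun s => logderiv F s * h s)%C (1 / 2 + delta) (- T) T =
     cint (fun y => logderiv F ((1 / 2 + delta)%R, y) * g (Ci * (delta, y)))%C (- T) T.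
    apply: cint_ext => y _; congr (_ * g _)%C; rewrite hx.
    by apply: C_ext; rewrite /Re /Im /=; field.
  have vM : vint (fun s => logderiv F s * h s)%C (1 / 2 - delta) (- T) T =
     cint (fun y => logderiv F ((1 / 2 - delta)%R, y) * g (Ci * ((- delta)%R, y)))%C (- T) T.
    apply: cint_ext => y _; congr (_ * g _)%C; rewrite hx.
    by apply: C_ext; rewrite /Re /Im /=; field.
  have hbd Y : Y = T \/ Y = (- T)%R ->
     Cmod (hint (fun s => logderiv F s * h s)%C Y (1 / 2 - delta) (1 / 2 + delta)) <= 2 * delta * c * K * weight (- (1 + eps / 2)) (INR k).
    move=> hY.
    have aY : Rabs Y = T by case: hY => ->; rewrite ?Rabs_Ropp Rabs_pos_eq; lra.
    have inS x : 1 / 2 - delta <= x <= 1 / 2 + delta -> Rabs (x - 1 / 2) <= delta.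
      by move=> hx1; apply/Rabs_le; lra.
    rewrite (_ : 2 * delta * c * K * weight (- (1 + eps / 2)) (INR k) =
       c * K * weight (- (1 + eps / 2)) (INR k) * Rabs (1 / 2 + delta - (1 / 2 - delta)))%R; last first.
      by rewrite Rabs_pos_eq; [field | lra].
    apply: cint_bound.
      apply: cex_cont => t; rewrite Rmin_left ?Rmax_right; try lra; move=> ht.
      apply: (@ccont_hline (fun s => logderiv F s * h s)%C); apply: hol_ccont.
      have st := inS t ht.
      have [Fs _] := HT (t, Y) st hY.
      apply: hol_mult; last by apply: hh => /=; lra.
      apply: hol_div => //; last exact: entire_hol (L_like_entire hF).
      by apply: entire_hol; apply: entire_C_derive; apply: L_like_entire.
    move=> t; rewrite Rmin_left ?Rmax_right; try lra; move=> ht.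
    have st := inS t ht.
    have [_ Lb] := HT (t, Y) st hY.
    have hb' := hb (t, Y) ltac:(rewrite /=; lra).
    rewrite Cmod_mult.
    apply: (Rle_trans _ (c * weight (eps / 2) (INR k) * (K * weight (- (1 + eps)) (INR k)))).
      apply: Rmult_le_compat => //; try exact: Cmod_ge_0.
      apply: Rle_trans hb' _; apply: Rmult_le_compat_l => //.
      by apply: weight_neg_mono; [lra | rewrite /= aY Rabs_pos_eq; lra].
    right; rewrite (_ : weight (- (1 + eps / 2)) (INR k) = weight (eps / 2) (INR k) * weight (- (1 + eps)) (INR k))%R; first by ring.
    by rewrite -weight_plus; congr weight; field.
  rewrite vP vM in R1.
  set A := cint _ _ _ in R1 *; set B := cint _ _ _ in R1 *.
  have -> : (Ci * A - Ci * B - 4 * PI * Ci * csum (fun t => g (RtoC (gamma t))) n =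
     hint (fun s => logderiv F s * h s) T (1 / 2 - delta)%R (1 / 2 + delta)%R -
     hint (fun s => logderiv F s * h s) (- T)%R (1 / 2 - delta)%R (1 / 2 + delta)%R)%C.
    have -> : (4 * PI * Ci * csum (fun t => g (RtoC (gamma t))) n = 2 * PI * Ci * (2 * csum (fun t => g (RtoC (gamma t))) n))%C.
      by ring.
    rewrite -R1; ring.
  apply: Rle_trans (Cmod_triangle _ _) _; rewrite Cmod_opp.
  by have := hbd T (or_introl erefl); have := hbd (- T)%R (or_intror erefl); lra.
apply: Csub_eq0; apply: Cmod_eq_0; apply: Rle_antisym; last exact: Cmod_ge_0.
apply: le_epsilon => e e0; rewrite Rplus_0_l.
have e4 : 0 < e / 8 by lra.
have e16 : 0 < e / (16 * PI) by have := PI_RGT_0 => ?; apply: Rdiv_lt_0_compat; lra.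
have [_ /(_ _ e4) [T1 [T10 H1]]] := iP.
have [_ /(_ _ e4) [T2 [T20 H2]]] := iM.
have [N H3] := cS _ e16.
have D0 : 0 < 4 * delta * c * K + 1.
  have : 0 <= 4 * delta * c * K by do !apply: Rmult_le_pos; lra.
  lra.
have e8 : 0 < e / 8 / (4 * delta * c * K + 1) by apply: Rdiv_lt_0_compat.
have b0 : 0 < 1 + eps / 2 by lra.
have [T4 [T40 H4]] := weight_neg_lim b0 e8.
(* Beyond [T1], [T2] and [T4] the two integrals and the horizontal sides are close to their limits;
   beyond [gamma N] the number [n] of heights below [T] exceeds [N]. *)
have [k hk] := INR_unbounded (T1 + T2 + T4 + gamma N).
have gN := heights_ge0 hg N.
have [T [n [hT [nT B]]]] := step k.
have {}B := B ltac:(lra).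
have {}H1 := H1 T ltac:(lra). have {}H2 := H2 T ltac:(lra).
have nN : (N < n)%N by apply/nT; lra.
have {}H3 := H3 n (ltnW nN).
have /Rlt_div_r {}H4 := H4 (INR k) ltac:(lra).
have {}H4 := H4 D0.
set A1 := cint _ _ _ in B H1; set A2 := cint _ _ _ in B H2.
set s := csum _ _ in B H3.
have -> : (Ci * Ip - Ci * Im' - 4 * PI * Ci * S =
   (Ci * A1 - Ci * A2 - 4 * PI * Ci * s) - Ci * (A1 - Ip) + Ci * (A2 - Im') + 4 * PI * Ci * (s - S))%C by ring.
have P0 := PI_RGT_0.
have c4 : Cmod (4 * PI * Ci)%C = (4 * PI)%R.
  by rewrite !Cmod_mult Cmod_Ci !Cmod_R !Rabs_pos_eq; lra.
apply: Rle_trans (Cmod_triangle _ _) _; rewrite (Cmod_mult (4 * PI * Ci)) c4.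
have t1 := Cmod_triangle (Ci * A1 - Ci * A2 - 4 * PI * Ci * s - Ci * (A1 - Ip)) (Ci * (A2 - Im')).
have t2 := Cmod_triangle (Ci * A1 - Ci * A2 - 4 * PI * Ci * s) (- (Ci * (A1 - Ip))).
rewrite Cmod_opp !Cmod_mult !Cmod_Ci !Rmult_1_l in t1 t2.
have H5 : 4 * PI * Cmod (s - S) <= e / 4.
  have := Rmult_lt_compat_l (4 * PI) _ _ ltac:(lra) H3.
  rewrite (_ : 4 * PI * (e / (16 * PI)) = e / 4)%R; [lra | field; lra].
have := weight_gt0 (- (1 + eps / 2)) (INR k) => ?.
have : 4 * delta * c * K * weight (- (1 + eps / 2)) (INR k) <= e / 8 by nra.
rewrite -/(Cminus _ _) in t2; lra.
Qed.

(** * Several variables *)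

Lemma vcons0 (n : nat) (z0 : C) (z : 'I_n -> C) : vcons z0 z ord0 = z0.
Proof. by rewrite /vcons unlift_none. Qed.

Lemma vconsS (n : nat) (z0 : C) (z : 'I_n -> C) (j : 'I_n) : vcons z0 z (lift ord0 j) = z j.
Proof. by rewrite /vcons liftK. Qed.

Lemma vcons_eta (n : nat) (z : 'I_n.+1 -> C) : z = vcons (z ord0) (fun j => z (lift ord0 j)).
Proof.
by apply: functional_extensionality => i; rewrite /vcons; case: unliftP => [j ->|->].
Qed.

Lemma vcons_map (n : nat) (h : C -> C) (z0 : C) (z : 'I_n -> C) :
  (fun j => h (vcons z0 z j)) = vcons (h z0) (fun j => h (z j)).
Proof. by rewrite (vcons_eta (fun j => h (vcons z0 z j))) vcons0; congr vcons; apply: functional_extensionality => j; rewrite vconsS. Qed.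

Lemma in_strip_vcons (n : nat) (eta : R) (z0 : C) (z : 'I_n -> C) :
  Rabs (Im z0) < eta -> in_strip eta z -> in_strip eta (vcons z0 z).
Proof. by move=> h0 h i; rewrite /vcons; case: unliftP => [j _|_]. Qed.

Definition fcons (A : finType) (n : nat) (a : A) (b : {ffun 'I_n -> A}) : {ffun 'I_n.+1 -> A} :=
  [ffun i => if unlift ord0 i is Some j then b j else a].

Lemma fcons0 (A : finType) (n : nat) (a : A) (b : {ffun 'I_n -> A}) : fcons a b ord0 = a.
Proof. by rewrite ffunE unlift_none. Qed.

Lemma fconsS (A : finType) (n : nat) (a : A) (b : {ffun 'I_n -> A}) (j : 'I_n) :
  fcons a b (lift ord0 j) = b j.
Proof. by rewrite ffunE liftK. Qed.

Lemma big_fcons (A : finType) (n : nat) (F : {ffun 'I_n.+1 -> A} -> C) :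
  \big[Cplus/RtoC 0]_(t : {ffun 'I_n.+1 -> A}) F t =
  \big[Cplus/RtoC 0]_(a : A) \big[Cplus/RtoC 0]_(b : {ffun 'I_n -> A}) F (fcons a b).
Proof.
rewrite pair_big /= (reindex (fun p : A * {ffun 'I_n -> A} => fcons p.1 p.2)) //=.
exists (fun t : {ffun 'I_n.+1 -> A} => (t ord0, [ffun j => t (lift ord0 j)])) => [[a b]|t] _ /=.
- by rewrite fcons0; congr pair; apply/ffunP => j; rewrite ffunE fconsS.
- by apply/ffunP => i; rewrite ffunE; case: unliftP => [j ->|->] //; rewrite ffunE.
Qed.

Lemma big_ffun0 (A : finType) (F : {ffun 'I_0 -> A} -> C) (x : C) : (forall t, F t = x) ->
  \big[Cplus/RtoC 0]_(t : {ffun 'I_0 -> A}) F t = x.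
Proof.
move=> h; rewrite (eq_bigr (fun=> x)); last by move=> t _; apply: h.
by rewrite big_const card_ffun card_ord expn0 /= Cplus_0_r.
Qed.

Lemma Cmod_big_le (I : finType) (f : I -> C) (B : R) : (forall i, Cmod (f i) <= B) ->
  Cmod (\big[Cplus/RtoC 0]_(i : I) f i) <= INR #|I| * B.
Proof.
move=> h; rewrite cardE -big_enum /=.
elim: (enum I) => [|i s ih]; first by rewrite big_nil Cmod_0 /=; lra.
rewrite big_cons [size _]/= S_INR; apply: Rle_trans (Cmod_triangle _ _) _.
by have := h i; lra.
Qed.

Lemma Cbig_distr (I : finType) (c : C) (f : I -> C) :
  (c * \big[Cplus/RtoC 0]_(i : I) f i)%C = \big[Cplus/RtoC 0]_(i : I) (c * f i)%C.
Proof. by rewrite (big_morph (Cmult c) (Cmult_plus_distr_l c) (Cmult_0_r c)). Qed.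

Section Classes.
Variables (eta eps : R).
Hypothesis eta0 : 0 < eta.
Hypothesis eps0 : 0 < eps.

Local Notation wt x := (weight (- (1 + eps)) (Re x)).

(** This class and the next two recurse on the first variable, like [iterated_line_integral], so
    that slices stay in the class; in [weighted_bound] the weight of the fixed variable is absorbed
    into the constant. *)
Fixpoint separately_hol (n : nat) : (('I_n -> C) -> C) -> Prop :=
  match n with
  | 0 => fun _ => True
  | m.+1 => fun f =>
      (forall x', in_strip eta x' -> forall x0, Rabs (Im x0) < eta -> hol (fun z => f (vcons z x')) x0) /\
      forall x0, Rabs (Im x0) < eta -> separately_hol (fun x' : 'I_m -> C => f (vcons x0 x'))
  end.

Fixpoint weighted_bound (n : nat) : R -> (('I_n -> C) -> C) -> Prop :=
  match n with
  | 0 => fun K f => Cmod (f (fun=> RtoC 0)) <= K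
  | m.+1 => fun K f =>
      forall x0, Rabs (Im x0) < eta -> weighted_bound (K * wt x0) (fun x' : 'I_m -> C => f (vcons x0 x'))
  end.

Fixpoint separately_even (n : nat) : (('I_n -> C) -> C) -> Prop :=
  match n with
  | 0 => fun _ => True
  | m.+1 => fun f =>
      (forall x', in_strip eta x' -> forall x0, Rabs (Im x0) < eta -> f (vcons (- x0)%C x') = f (vcons x0 x')) /\
      forall x0, Rabs (Im x0) < eta -> separately_even (fun x' : 'I_m -> C => f (vcons x0 x'))
  end.

Lemma separately_hol_minus (n : nat) (f g : ('I_n -> C) -> C) :
  separately_hol f -> separately_hol g -> separately_hol (fun x => f x - g x)%C.
Proof.
elim: n f g => [//|n ih] f g [h1 h2] [k1 k2]; split.
- by move=> x' hx' x0 hx0; apply: hol_minus; [apply: h1 | apply: k1].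
- by move=> x0 hx0; apply: ih; [apply: h2 | apply: k2].
Qed.

Lemma strip_real (n : nat) (g : 'I_n -> R) : in_strip eta (fun j => RtoC (g j)).
Proof. by move=> j; rewrite /= Rabs_R0. Qed.

Lemma weighted_bound_ge0 (n : nat) (K : R) (f : ('I_n -> C) -> C) : weighted_bound K f -> 0 <= K.
Proof.
elim: n K f => [|n ih] K f /= h; first by apply: Rle_trans h; apply: Cmod_ge_0.
have h0 : Rabs (Im (RtoC 0)) < eta by rewrite /= Rabs_R0.
by have := ih _ _ (h 0 h0); have := weight_gt0 (- (1 + eps)) (Re (RtoC 0)); nra.
Qed.

Lemma weighted_bound_mono (n : nat) (K K' : R) (f : ('I_n -> C) -> C) : K <= K' -> weighted_bound K f -> weighted_bound K' f.
Proof.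
elim: n K K' f => [|n ih] K K' f hK /= h; first lra.
move=> x0 hx0; apply: ih (h x0 hx0); apply: Rmult_le_compat_r => //.
exact: Rlt_le (weight_gt0 _ _).
Qed.

Lemma strip_rect (z : C) (r : R) : exists b, forall w, Rabs (Im z) + r < eta -> Cmod (w - z) <= r ->
  orect (- b) b (- eta) eta w.
Proof.
exists (Rabs (Re z) + r + 1)%R => w h hw.
have h1 : Rabs (Re w - Re z) <= r by apply: Rle_trans hw; apply: (re_le_Cmod (w - z)).
have h2 : Rabs (Im w - Im z) <= r by apply: Rle_trans hw; apply: (im_le_Cmod (w - z)).
have r0 := Rabs_pos (Re w - Re z).
move: h1 h2 => /Rabs_le_between ? /Rabs_le_between ?.
have := Rle_abs (Re z); have := Rle_abs (- Re z); rewrite Rabs_Ropp.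
have := Rle_abs (Im z); have := Rle_abs (- Im z); rewrite Rabs_Ropp.
by move=> *; split; lra.
Qed.

(* Cauchy's estimate, applied to all values of the remaining variables at once. *)
Lemma lipschitz_family (m : nat) (f : C -> ('I_m -> C) -> C) (a z : C) (r B : R) :
  0 < r -> Rabs (Im a) + r < eta -> Cmod (z - a) <= r / 2 ->
  (forall x', in_strip eta x' -> forall x0, Rabs (Im x0) < eta -> hol (fun z => f z x') x0) ->
  (forall x0, Rabs (Im x0) < eta -> weighted_bound B (f x0)) ->
  weighted_bound (2 * B / r * Cmod (z - a)) (fun x' => f z x' - f a x')%C.
Proof.
move=> r0 har hz; elim: m f B => [|m ih] f B hf hb /=.
  have [b hbD] := strip_rect a r.
  have inI w : orect (- b) b (- eta) eta w -> Rabs (Im w) < eta by move=> [_ ?]; apply: Rabs_def1; lra.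
  apply: (@lipschitz_disc (fun z => f z (fun=> RtoC 0)) (- b) b (- eta) eta a r) => //.
  - by move=> w /inI; apply: hf; move=> j; case: j.
  - by move=> w hw; apply: hbD.
  - by move=> t; apply: hb; apply: inI; apply: hbD => //; rewrite Cmod_circ; lra.
move=> x1 hx1.
rewrite (_ : 2 * B / r * Cmod (z - a) * wt x1 = 2 * (B * wt x1) / r * Cmod (z - a))%R; last by field; lra.
apply: (ih (fun z x' => f z (vcons x1 x'))).
- by move=> x' hx'; apply: hf; apply: in_strip_vcons.
- by move=> x0 /hb /(_ x1 hx1).
Qed.

(** ** Iterated integrals *)

(* All the improper integrals met in the evaluation converge. *)
Fixpoint iter_ok (n : nat) : ('I_n -> R) -> (('I_n -> C) -> C) -> Prop :=
  match n with
  | 0 => fun _ _ => True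
  | m.+1 => fun c g =>
      (forall y, iter_ok (fun j : 'I_m => c (lift ord0 j)) (fun z => g (vcons (c ord0, y) z))) /\
      exists I, improper (fun y => iterated_line_integral (fun j : 'I_m => c (lift ord0 j))
                        (fun z => g (vcons (c ord0, y) z))) I
  end.

Lemma iterE (m : nat) (c : 'I_m.+1 -> R) (g : ('I_m.+1 -> C) -> C) (I : C) :
  improper (fun y => iterated_line_integral (fun j : 'I_m => c (lift ord0 j))
                        (fun z => g (vcons (c ord0, y) z))) I ->
  iterated_line_integral c g = (Ci * I)%C.
Proof.
move=> h; rewrite /= /line_integral; congr Cmult.
exact: (is_RInt_gen_unique (V := C_R_CompleteNormedModule) _ _ (improper_gen h)).
Qed.

Lemma iter_lin (n : nat) (k : C) (c : 'I_n -> R) (g g' : ('I_n -> C) -> C) :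
  iter_ok c g -> iter_ok c g' -> iter_ok c (fun z => g z + k * g' z)%C /\
  iterated_line_integral c (fun z => g z + k * g' z)%C =
    (iterated_line_integral c g + k * iterated_line_integral c g')%C.
Proof.
elim: n c g g' => [//|n ih] c g g' [h1 [I hI]] [k1 [J hJ]].
have E y := ih _ _ _ (h1 y) (k1 y).
have hIJ : improper (fun y => iterated_line_integral (fun j : 'I_n => c (lift ord0 j))
                        (fun z => g (vcons (c ord0, y) z) + k * g' (vcons (c ord0, y) z))%C) (I + k * J)%C.
  rewrite (functional_extensionality _ _ (fun y => proj2 (E y))).
  by apply: improper_plus => //; apply: improper_scal.
split; first by split; [move=> y; case: (E y) | exists (I + k * J)%C].
by rewrite (iterE hIJ) (iterE hI) (iterE hJ); ring.
Qed.

Lemma iter_zero (n : nat) (c : 'I_n -> R) : iter_ok c (fun=> RtoC 0) /\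
  iterated_line_integral c (fun=> RtoC 0) = 0.
Proof.
elim: n c => [//|n ih] c.
have [ok0 E] := ih (fun j => c (lift ord0 j)).
have h : improper (fun _ : R => iterated_line_integral (fun j : 'I_n => c (lift ord0 j)) (fun=> RtoC 0)) 0.
  by rewrite E; apply: improper_zero.
split; first by split => //; exists 0.
by rewrite (iterE (g := fun=> RtoC 0) h); ring.
Qed.

Lemma iter_scal (n : nat) (k : C) (c : 'I_n -> R) (g : ('I_n -> C) -> C) :
  iter_ok c g -> iter_ok c (fun z => k * g z)%C /\
  iterated_line_integral c (fun z => k * g z)%C = (k * iterated_line_integral c g)%C.
Proof.
move=> h; have [h0 E0] := iter_zero c; have := iter_lin k h0 h.
rewrite E0 Cplus_0_l (_ : (fun z => 0 + k * g z)%C = (fun z => k * g z)%C) //.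
by apply: functional_extensionality => z; rewrite Cplus_0_l.
Qed.

Lemma iter_sum (n : nat) (D : Type) (s : seq D) (P : pred D) (c : 'I_n -> R) (g : D -> ('I_n -> C) -> C) :
  (forall d, P d -> iter_ok c (g d)) ->
  iter_ok c (fun z => \big[Cplus/RtoC 0]_(d <- s | P d) g d z)%C /\
  iterated_line_integral c (fun z => \big[Cplus/RtoC 0]_(d <- s | P d) g d z)%C =
    \big[Cplus/RtoC 0]_(d <- s | P d) iterated_line_integral c (g d).
Proof.
move=> h; elim: s => [|d s [ih1 ih2]].
  rewrite big_nil (_ : (fun z => _) = (fun=> RtoC 0)); first exact: iter_zero.
  by apply: functional_extensionality => z; rewrite big_nil.
rewrite big_cons; case: ifP => Pd.
- have := iter_lin 1 ih1 (h d Pd); rewrite ih2 Cmult_1_l Cplus_comm.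
  rewrite (_ : (fun z => _ + 1 * g d z)%C = (fun z => \big[Cplus/RtoC 0]_(d <- d :: s | P d) g d z)) //.
  by apply: functional_extensionality => z; rewrite big_cons Pd Cmult_1_l Cplus_comm.
- rewrite -ih2 (_ : (fun z => \big[Cplus/RtoC 0]_(d <- d :: s | P d) g d z) =
     (fun z => \big[Cplus/RtoC 0]_(d <- s | P d) g d z)) //.
  by apply: functional_extensionality => z; rewrite big_cons Pd.
Qed.

Variables (A : finType) (cc : A -> R) (H : A -> C -> C) (c0 : R).
Hypothesis c0_gt0 : 0 < c0.
Hypothesis hcc : forall a, Rabs (cc a) < eta.
Hypothesis Hcont : forall a y, ccont (fun y => H a (cc a, y)) y.
Hypothesis Hbound : forall a y, Cmod (H a (cc a, y)) <= c0 * weight (eps / 2) y.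

(** [A] is the set of kinds of a variable, later the three blocks of a partition. The kind [a j]
    determines both the factor [H (a j)] and the line [cc (a j)]. *)
Definition integrand (n : nat) (a : 'I_n -> A) (f : ('I_n -> C) -> C) (z : 'I_n -> C) : C :=
  (\big[Cmult/RtoC 1]_(j < n) H (a j) (z j) * f (fun j => Ci * z j))%C.

Lemma integrand_vcons (n : nat) (a : 'I_n.+1 -> A) (f : ('I_n.+1 -> C) -> C) (z0 : C) (z : 'I_n -> C) :
  integrand a f (vcons z0 z) =
  (H (a ord0) z0 * integrand (fun j => a (lift ord0 j)) (fun x' => f (vcons (Ci * z0) x')) z)%C.
Proof.
rewrite /integrand big_ord_recl vcons0 (vcons_map (Cmult Ci)) -Cmult_assoc; congr (_ * (_ * _))%C.
by apply: eq_bigr => j _; rewrite vconsS.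
Qed.

Lemma integrand_minus (n : nat) (a : 'I_n -> A) (f g : ('I_n -> C) -> C) :
  integrand a (fun x => f x - g x)%C = (fun z => integrand a f z + (- (1)) * integrand a g z)%C.
Proof. by apply: functional_extensionality => z; rewrite /integrand; ring. Qed.

(** The price of one integration: the bound [2 * B / a] of [improper_exists] with [a = eps / 2] and
    [B] equal to [c0] times the bound of the inner integral. *)
Definition line_const : R := (2 * c0 / (eps / 2))%R.

Lemma line_const_ge0 : 0 <= line_const.
Proof. by apply: Rdiv_le_0_compat; lra. Qed.

Lemma Im_line (c y : R) : (Ci * (c, y))%C = ((- y)%R, c).
Proof. by apply: C_ext; rewrite /Re /Im /=; ring. Qed.

(** Convergence and bound are proved together. The inner integral must be continuous in the outer
    variable, as [improper] demands; its increment is the iterated integral of a difference of two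
    slices, small by [lipschitz_family] and the bound for one variable less. *)
Lemma iter_integrand (n : nat) (a : 'I_n -> A) (f : ('I_n -> C) -> C) (K : R) :
  separately_hol f -> weighted_bound K f -> iter_ok (fun j => cc (a j)) (integrand a f) /\
  Cmod (iterated_line_integral (fun j => cc (a j)) (integrand a f)) <= K * line_const ^ n.
Proof.
elim: n a f K => [|n ih] a f K.
  move=> _ hb; split=> //=; rewrite /integrand big_ord0 Cmult_1_l Rmult_1_r.
  by rewrite (_ : (fun j : 'I_0 => _) = (fun=> RtoC 0)) //; apply: functional_extensionality; case.
move=> [h1 h2] hb.
have K0 := weighted_bound_ge0 hb.
pose c := cc (a ord0).
have hc : Rabs c < eta by apply: hcc.
pose sl (y : R) := fun x' => f (vcons (Ci * (c, y))%C x').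
have inS y : Rabs (Im (Ci * (c, y))%C) < eta by rewrite Im_line.
have ih' y := ih (fun j => a (lift ord0 j)) (sl y) _ (h2 _ (inS y)) (hb _ (inS y)).
pose V y := iterated_line_integral (fun j => cc (a (lift ord0 j))) (integrand (fun j => a (lift ord0 j)) (sl y)).
have Vb y : Cmod (V y) <= K * line_const ^ n * weight (- (1 + eps)) y.
  case: (ih' y) => _; rewrite Im_line /= weight_opp => h; apply: Rle_trans h _; right; ring.
have Vc y : ccont V y.
  apply/ccont_epsR => e he.
  (* Half the distance from the line to the edge of the strip, so that Cauchy's estimate has
     room. *)
  pose r := ((eta - Rabs c) / 2)%R.
  have r0 : 0 < r by rewrite /r; lra.
  have hW := pow_le _ n line_const_ge0.
  have M0 : 0 <= 2 * K / r * line_const ^ n.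
    by apply: Rmult_le_pos => //; apply: Rdiv_le_0_compat; lra.
  exists (Rmin (r / 2) (e / (1 + 2 * K / r * line_const ^ n))); split.
    by apply: Rmin_glb_lt; [lra | apply: Rdiv_lt_0_compat; lra].
  move=> u hu.
  have hu1 := Rlt_le_trans _ _ _ hu (Rmin_l _ _).
  have hu2 := Rlt_le_trans _ _ _ hu (Rmin_r _ _).
  have dz : Cmod (Ci * (c, u) - Ci * (c, y))%C = Rabs (u - y).
    rewrite (_ : (Ci * (c, u) - Ci * (c, y))%C = RtoC (- (u - y))).
      by rewrite Cmod_R Rabs_Ropp.
    by apply: C_ext; rewrite /Re /Im /=; ring.
  have lb : weighted_bound (2 * K / r * Rabs (u - y)) (fun x' => sl u x' - sl y x')%C.
    rewrite -dz; apply: (lipschitz_family (f := fun z x' => f (vcons z x')) r0).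
    - by rewrite Im_line /=; rewrite /r; lra.
    - by rewrite dz; lra.
    - exact: h1.
    - move=> x0 hx0; apply: weighted_bound_mono (hb x0 hx0).
      by have := weight_neg_le1 (a := 1 + eps) (Re x0) ltac:(lra); nra.
  have [ok2 b2] := ih (fun j => a (lift ord0 j)) _ _ (separately_hol_minus (h2 _ (inS u)) (h2 _ (inS y))) lb.
  have [ok1 _] := ih' u; have [ok0 _] := ih' y.
  have [_ E] := iter_lin (- (1)) ok1 ok0.
  rewrite (_ : (V u - V y)%C = iterated_line_integral (fun j => cc (a (lift ord0 j)))
     (integrand (fun j => a (lift ord0 j)) (fun x' => sl u x' - sl y x')%C)); last first.
    by rewrite integrand_minus; apply: (eq_trans _ (esym E)); rewrite -/(V u) -/(V y); ring.
  apply: Rle_lt_trans b2 _.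
  move/Rlt_div_r: hu2 => /(_ ltac:(lra)) hu2.
  have := Rabs_pos (u - y); nra.
have dec : decays (fun y => H (a ord0) (c, y) * V y)%C (c0 * (K * line_const ^ n)) (eps / 2).
  apply: (decays_mult eps0 c0_gt0 _ (Hcont (a ord0)) (Hbound (a ord0)) Vc Vb).
  by apply: Rmult_le_pos => //; apply: pow_le; apply: line_const_ge0.
have [I [hI bI]] := improper_exists dec.
have E y : iter_ok (fun j => cc (a (lift ord0 j))) (fun z => integrand a f (vcons (c, y) z)) /\
    iterated_line_integral (fun j => cc (a (lift ord0 j))) (fun z => integrand a f (vcons (c, y) z)) =
    (H (a ord0) (c, y) * V y)%C.
  rewrite (_ : (fun z => integrand a f (vcons (c, y) z)) =
    (fun z => H (a ord0) (c, y) * integrand (fun j => a (lift ord0 j)) (sl y) z)%C).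
    by apply: iter_scal; case: (ih' y).
  by apply: functional_extensionality => z; rewrite integrand_vcons.
have hI2 : improper (fun y => iterated_line_integral (fun j => cc (a (lift ord0 j))) (fun z => integrand a f (vcons (c, y) z))) I.
  by rewrite (functional_extensionality _ _ (fun y => proj2 (E y))).
split; first by split; [move=> y; case: (E y) | exists I].
rewrite (iterE hI2) Cmod_mult Cmod_Ci Rmult_1_l; apply: Rle_trans bI _.
by right; rewrite /line_const /=; field; lra.
Qed.
End Classes.

Lemma improper_bound (phi : R -> C) (I : C) (B a : R) : 0 < a -> 0 <= B -> improper phi I ->
  (forall y, Cmod (phi y) <= B * weight (- (1 + a)) y) -> Cmod I <= 2 * B / a.
Proof.
move=> ha hB hI hb; have [[B' [a' [_ [_ [hc _]]]]] _] := hI.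
have [J [hJ bJ]] := improper_exists (conj ha (conj hB (conj hc hb))).
by rewrite (improper_unique hI hJ).
Qed.

Lemma improper_big (J : finType) (phi : J -> R -> C) (I : J -> C) : (forall i, improper (phi i) (I i)) ->
  improper (fun y => \big[Cplus/RtoC 0]_(i : J) phi i y) (\big[Cplus/RtoC 0]_(i : J) I i).
Proof.
move=> h; elim: (index_enum J) => [|i s ih].
  rewrite big_nil (_ : (fun y => _) = (fun=> RtoC 0)); first exact: improper_zero.
  by apply: functional_extensionality => y; rewrite big_nil.
rewrite big_cons (_ : (fun y => _) = (fun y => phi i y + \big[Cplus/RtoC 0]_(i <- s) phi i y)%C).
  exact: improper_plus.
by apply: functional_extensionality => y; rewrite big_cons.
Qed.

Lemma hol_big (J : finType) (phi : J -> C -> C) (z : C) : (forall i, hol (phi i) z) ->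
  hol (fun w => \big[Cplus/RtoC 0]_(i : J) phi i w) z.
Proof.
move=> h; elim: (index_enum J) => [|i s ih].
  rewrite (_ : (fun y => _) = (fun=> RtoC 0)); first exact: hol_const.
  by apply: functional_extensionality => y; rewrite big_nil.
rewrite (_ : (fun y => _) = (fun y => phi i y + \big[Cplus/RtoC 0]_(i <- s) phi i y)%C).
  exact: hol_plus.
by apply: functional_extensionality => y; rewrite big_cons.
Qed.

Lemma csum_le_rsum (u : nat -> C) (w : nat -> R) (K : R) (N : nat) :
  (forall t, Cmod (u t) <= K * w t) -> Cmod (csum u N) <= K * rsum w (seq.iota 0 N).
Proof.
move=> h; elim: N => [|N ih]; first by rewrite /csum big_ord0 Cmod_0 /=; lra.
rewrite csumS -addn1 iotaD rsum_cat /= add0n; apply: Rle_trans (Cmod_triangle _ _) _.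
by have := h N; lra.
Qed.

(** * From one variable to several: sums over boxes of heights *)

Section Main.
Variables (eta eps : R).
Hypothesis eta0 : 0 < eta.
Hypothesis eps0 : 0 < eps.
Variables (A : finType) (cc : A -> R) (H : A -> C -> C) (c0 : R).
Hypothesis c0_gt0 : 0 < c0.
Hypothesis hcc : forall a, Rabs (cc a) < eta.
Hypothesis Hcont : forall a y, ccont (fun y => H a (cc a, y)) y.
Hypothesis Hbound : forall a y, Cmod (H a (cc a, y)) <= c0 * weight (eps / 2) y.
Variables (gamma : nat -> R) (tail : nat -> R).
Hypothesis tail_bounds : forall N, 0 <= tail N <= tail 0%N.
Hypothesis tail_lim : forall e, 0 < e -> exists N0, forall N, (N0 <= N)%N -> tail N < e.
Hypothesis tail_sum : forall N, rsum (fun t => weight (- (1 + eps)) (gamma t)) (seq.iota 0 N) <= tail 0%N.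
Hypothesis tail_tails : forall (u : nat -> C) K,
  (forall t, Cmod (u t) <= K * weight (- (1 + eps)) (gamma t)) ->
  exists S, forall N, Cmod (csum u N - S) <= K * tail N.
Hypothesis one_variable_formula : forall (g : C -> C) (K : R) (S : C) (I : A -> C),
  strip_class eta eps K g -> (forall y : R, g (RtoC (- y)) = g (RtoC y)) ->
  (forall a, improper (fun y => H a (cc a, y) * g (Ci * (cc a, y)))%C (I a)) ->
  clim (csum (fun t => g (RtoC (gamma t)))) S ->
  \big[Cplus/RtoC 0]_(a : A) (Ci * I a)%C = (4 * PI * Ci * S)%C.

Definition box (n : nat) (f : ('I_n -> C) -> C) (T : nat) : C :=
  \big[Cplus/RtoC 0]_(t : {ffun 'I_n -> 'I_T}) f (fun j => RtoC (gamma (t j))).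

Lemma box0 (f : ('I_0 -> C) -> C) (T : nat) : box f T = f (fun=> RtoC 0).
Proof.
by apply: big_ffun0 => t; congr f; apply: functional_extensionality; case.
Qed.

Lemma boxS (n : nat) (f : ('I_n.+1 -> C) -> C) (T : nat) :
  box f T = csum (fun t0 => box (fun x' => f (vcons (RtoC (gamma t0)) x')) T) T.
Proof.
rewrite /box big_fcons; apply: eq_bigr => a _; apply: eq_bigr => b _; congr f.
rewrite (vcons_eta (fun j => _)) fcons0; congr vcons.
by apply: functional_extensionality => j; rewrite fconsS.
Qed.

Lemma in_strip_real (y : R) : Rabs (Im (RtoC y)) < eta.
Proof. by rewrite /= Rabs_R0. Qed.

Lemma box_bound (n : nat) (f : ('I_n -> C) -> C) (K : R) (T : nat) : weighted_bound eta eps K f ->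
  Cmod (box f T) <= K * tail 0%N ^ n.
Proof.
elim: n f K => [|n ih] f K hb; first by rewrite box0 /= Rmult_1_r.
have K0 := weighted_bound_ge0 eta0 hb.
have t0 : 0 <= tail 0%N by have := tail_bounds 0%N; lra.
have tn : 0 <= K * tail 0%N ^ n by apply: Rmult_le_pos => //; apply: pow_le.
rewrite boxS.
apply: Rle_trans (csum_le_rsum (K := K * tail 0%N ^ n) (w := fun t => weight (- (1 + eps)) (gamma t)) _ _) _.
  move=> t; apply: Rle_trans (ih _ _ (hb _ (in_strip_real (gamma t)))) _; right; rewrite /=; ring.
rewrite /= (_ : K * (tail 0%N * tail 0%N ^ n) = K * tail 0%N ^ n * tail 0%N)%R; last ring.
exact: Rmult_le_compat_l.
Qed.

Lemma box_strip (n : nat) (f : ('I_n.+1 -> C) -> C) (K : R) (T : nat) :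
  separately_hol eta f -> weighted_bound eta eps K f ->
  strip_class eta eps (K * tail 0%N ^ n) (fun x0 => box (fun x' => f (vcons x0 x')) T).
Proof.
move=> [hf _] hb; split.
- by move=> x hx; apply: hol_big => t; apply: hf => //; apply: strip_real.
- by move=> x hx; apply: Rle_trans (box_bound T (hb x hx)) _; right; ring.
Qed.

Lemma box_even (n : nat) (f : ('I_n.+1 -> C) -> C) (T : nat) (y : R) : separately_even eta f ->
  box (fun x' => f (vcons (RtoC (- y)) x')) T = box (fun x' => f (vcons (RtoC y) x')) T.
Proof.
move=> [h _]; apply: eq_bigr => t _; rewrite RtoC_opp; apply: h.
- exact: strip_real.
- exact: in_strip_real.
Qed.

Lemma iter_slice (n : nat) (f : ('I_n.+1 -> C) -> C) (K : R) (a : A) (b : {ffun 'I_n -> A}) :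
  separately_hol eta f -> weighted_bound eta eps K f ->
  exists I, improper (fun y => H a (cc a, y) *
      iterated_line_integral (fun j => cc (b j)) (integrand H b (fun x' => f (vcons (Ci * (cc a, y)) x'))))%C I /\
    iterated_line_integral (fun j => cc (fcons a b j)) (integrand H (fcons a b) f) = (Ci * I)%C.
Proof.
move=> hf hb.
have [[_ [I hI]] _] := iter_integrand eta0 eps0 c0_gt0 hcc Hcont Hbound (fcons a b) hf hb.
exists I; split; last exact: iterE hI.
move: hI; rewrite fcons0.
have -> : (fun j : 'I_n => cc (fcons a b (lift ord0 j))) = (fun j => cc (b j)).
  by apply: functional_extensionality => j; rewrite fconsS.
congr (improper _ I); apply: functional_extensionality => y.
have inS : Rabs (Im (Ci * (cc a, y))%C) < eta by rewrite Im_line; apply: hcc.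
have [ok _] := iter_integrand eta0 eps0 c0_gt0 hcc Hcont Hbound b (proj2 hf _ inS) (hb _ inS).
rewrite -(proj2 (iter_scal (H a (cc a, y)) ok)); congr iterated_line_integral.
apply: functional_extensionality => z; rewrite integrand_vcons fcons0; congr (_ * integrand H _ _ _)%C.
by apply: functional_extensionality => j; rewrite fconsS.
Qed.

(* The error of the inner box sums, integrated over the lines, plus the tail of
   the outer sum. *)
Fixpoint box_error (n T : nat) : R :=
  if n is m.+1 then
    INR #|A| * (line_const eps c0 * box_error m T) + (4 * PI) ^ m.+1 * tail 0%N ^ m * tail T
  else 0.

Lemma box_error_ge0 (n T : nat) : 0 <= box_error n T.
Proof.
have P0 := PI_RGT_0; have w0 := line_const_ge0 eps0 c0_gt0.
elim: n => [|n ih] /=; first lra.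
have [t1 t2] := tail_bounds T.
apply: Rplus_le_le_0_compat.
  by apply: Rmult_le_pos; [apply: pos_INR | apply: Rmult_le_pos].
apply: Rmult_le_pos => //; apply: Rmult_le_pos; last by apply: pow_le; lra.
by apply: Rmult_le_pos; [lra | apply: pow_le; lra].
Qed.

Lemma box_error_lim (n : nat) (e : R) : 0 < e -> exists N, forall T, (N <= T)%N -> box_error n T < e.
Proof.
have P0 := PI_RGT_0; have w0 := line_const_ge0 eps0 c0_gt0.
have t0 : 0 <= tail 0%N by have := tail_bounds 0%N; lra.
elim: n e => [|n ih] e he; first by exists 0%N.
pose a1 := (INR #|A| * line_const eps c0)%R; pose a2 := ((4 * PI) ^ n.+1 * tail 0%N ^ n)%R.
have a10 : 0 <= a1 by apply: Rmult_le_pos => //; apply: pos_INR.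
have a20 : 0 <= a2 by apply: Rmult_le_pos; apply: pow_le; lra.
have k1 : 0 < 1 + a1 by lra.
have k2 : 0 < 1 + a2 by lra.
have he2 : 0 < e / 2 by lra.
have [N1 H1] := ih _ (Rdiv_lt_0_compat _ _ he2 k1).
have [N2 H2] := tail_lim (Rdiv_lt_0_compat _ _ he2 k2).
exists (N1 + N2)%N => T hT.
have /Rlt_div_r {}H1 := H1 T (leq_trans (leq_addr _ _) hT).
have /Rlt_div_r {}H2 := H2 T (leq_trans (leq_addl _ _) hT).
have {}H1 := H1 k1; have {}H2 := H2 k2.
have e0 := box_error_ge0 n T; have [t1 _] := tail_bounds T.
rewrite (_ : box_error n.+1 T = a1 * box_error n T + a2 * tail T)%R; last by rewrite /a1 /a2 /=; ring.
lra.
Qed.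

(** Two replacements with the same [T]. The inner integrals [V] become the box sum [g]; the error
    carries the weight of the outer variable, so its integral is at most [line_const] times the
    previous error. Then the full outer sum given by [one_variable_formula] is cut at [T], at the
    cost of [tail T]. *)
Theorem box_estimate (n : nat) (f : ('I_n -> C) -> C) (K : R) (T : nat) :
  separately_hol eta f -> weighted_bound eta eps K f -> separately_even eta f ->
  Cmod (\big[Cplus/RtoC 0]_(a : {ffun 'I_n -> A})
          iterated_line_integral (fun j => cc (a j)) (integrand H a f) -
        (4 * PI * Ci) ^ n * box f T)%C <= K * box_error n T.
Proof.
have P0 := PI_RGT_0.
have c4 : Cmod (4 * PI * Ci)%C = (4 * PI)%R.
  by rewrite !Cmod_mult Cmod_Ci !Cmod_R !Rabs_pos_eq; lra.
elim: n f K => [|n ih] f K hf hb he.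
  rewrite box0 (big_ffun0 (x := f (fun=> RtoC 0))).
    rewrite (_ : (_ - _)%C = 0) ?Cmod_0 /=; [lra | ring].
  move=> t /=; rewrite /integrand big_ord0 Cmult_1_l; congr f.
  by apply: functional_extensionality; case.
have K0 := weighted_bound_ge0 eta0 hb.
have t0 : 0 <= tail 0%N by have := tail_bounds 0%N; lra.
have [I hI] : exists I : A * {ffun 'I_n -> A} -> C, forall p : A * {ffun 'I_n -> A},
   improper (fun y => H p.1 (cc p.1, y) *
      iterated_line_integral (fun j => cc (p.2 j)) (integrand H p.2 (fun x' => f (vcons (Ci * (cc p.1, y)) x'))))%C (I p) /\
   iterated_line_integral (fun j => cc (fcons p.1 p.2 j)) (integrand H (fcons p.1 p.2) f) = (Ci * I p)%C.
  exists (fun p => proj1_sig (constructive_indefinite_description _ (iter_slice p.1 p.2 hf hb))) => p.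
  by case: constructive_indefinite_description.
pose V x0 := \big[Cplus/RtoC 0]_(b : {ffun 'I_n -> A})
   iterated_line_integral (fun j => cc (b j)) (integrand H b (fun x' => f (vcons x0 x'))).
pose g x0 := box (fun x' => f (vcons x0 x')) T.
pose IV a := \big[Cplus/RtoC 0]_(b : {ffun 'I_n -> A}) I (a, b).
have hIV a : improper (fun y => H a (cc a, y) * V (Ci * (cc a, y)))%C (IV a).
  have := improper_big (fun b => proj1 (hI (a, b))).
  congr (improper _ _); apply: functional_extensionality => y.
  by rewrite /V Cbig_distr.
have LHS : \big[Cplus/RtoC 0]_(a : {ffun 'I_n.+1 -> A}) iterated_line_integral (fun j => cc (a j)) (integrand H a f) =
   \big[Cplus/RtoC 0]_(a : A) (Ci * IV a)%C.
  rewrite big_fcons; apply: eq_bigr => a _; rewrite /IV Cbig_distr.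
  by apply: eq_bigr => b _; apply: (proj2 (hI (a, b))).
have gs := box_strip T hf hb.
have [Ig hIg] : exists Ig : A -> C, forall a, improper (fun y => H a (cc a, y) * g (Ci * (cc a, y)))%C (Ig a).
  have ex a : exists I, improper (fun y => H a (cc a, y) * g (Ci * (cc a, y)))%C I.
    have [l1 l2] := strip_line gs (hcc a).
    have [J [hJ _]] := improper_exists (decays_mult eps0 c0_gt0
      (Rmult_le_pos _ _ K0 (pow_le _ n t0)) (Hcont a) (Hbound a) l1 l2).
    by exists J.
  by exists (fun a => proj1_sig (constructive_indefinite_description _ (ex a))) => a; case: constructive_indefinite_description.
have [S hS] : exists S, forall N, Cmod (csum (fun t => g (RtoC (gamma t))) N - S) <= K * tail 0%N ^ n * tail N.
  by apply: tail_tails => t; apply: (strip_decay gs (in_strip_real (gamma t))).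
have kn : 0 <= K * tail 0%N ^ n by apply: Rmult_le_pos => //; apply: pow_le.
have cS : clim (csum (fun t => g (RtoC (gamma t)))) S.
  move=> e e0; have k1 : 0 < 1 + K * tail 0%N ^ n by lra.
  have [N0 HN] := tail_lim (Rdiv_lt_0_compat _ _ e0 k1); exists N0 => N hN.
  have /Rlt_div_r {}HN := HN N hN; have {}HN := HN k1.
  by have := hS N; have := tail_bounds N; lra.
(* [g] depends on [T], hence so does its full sum [S] over the outer heights; [S] disappears again
   when the sum is cut at [T]. *)
have F1 := one_variable_formula gs (fun y => box_even T y he) hIg cS.
have bV a y : Cmod (H a (cc a, y) * V (Ci * (cc a, y)) + - (4 * PI * Ci) ^ n * (H a (cc a, y) * g (Ci * (cc a, y))))%C
    <= c0 * (K * box_error n T) * weight (- (1 + eps / 2)) y.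
  have inS : Rabs (Im (Ci * (cc a, y))%C) < eta by rewrite Im_line; apply: hcc.
  have := ih _ _ (proj2 hf _ inS) (hb _ inS) (proj2 he _ inS).
  rewrite -/(V _) -/(g _) Im_line /= weight_opp -Im_line => B.
  rewrite (_ : (_ + _)%C = (H a (cc a, y) * (V (Ci * (cc a, y)) - (4 * PI * Ci) ^ n * g (Ci * (cc a, y))))%C); last ring.
  rewrite Cmod_mult.
  apply: Rle_trans (Rmult_le_compat _ _ _ _ (Cmod_ge_0 _) (Cmod_ge_0 _) (Hbound a y) B) _.
  right; rewrite (_ : weight (- (1 + eps / 2)) y = weight (eps / 2) y * weight (- (1 + eps)) y)%R; first by ring.
  by rewrite -weight_plus; congr weight; field.
have bI a : Cmod (Ci * (IV a + - (4 * PI * Ci) ^ n * Ig a))%C <= line_const eps c0 * (K * box_error n T).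
  rewrite Cmod_mult Cmod_Ci Rmult_1_l.
  have e2 : 0 < eps / 2 by lra.
  have q0 : 0 <= c0 * (K * box_error n T).
    by apply: Rmult_le_pos; [lra | apply: Rmult_le_pos => //; apply: box_error_ge0].
  have := improper_bound e2 q0 (improper_plus (hIV a) (improper_scal (- (4 * PI * Ci) ^ n)%C (hIg a))) (bV a).
  by move=> h; apply: Rle_trans h _; right; rewrite /line_const; field; lra.
rewrite LHS boxS -/(csum _ _).
have -> : (\big[Cplus/RtoC 0]_(a : A) (Ci * IV a) - (4 * PI * Ci) ^ n.+1 * csum (fun t0 => box (fun x' => f (vcons (gamma t0) x')) T) T =
   \big[Cplus/RtoC 0]_(a : A) (Ci * (IV a + - (4 * PI * Ci) ^ n * Ig a)) +
   (4 * PI * Ci) ^ n.+1 * - (csum (fun t => g (RtoC (gamma t))) T - S))%C.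
  have -> : \big[Cplus/RtoC 0]_(a : A) (Ci * (IV a + - (4 * PI * Ci) ^ n * Ig a))%C =
    (\big[Cplus/RtoC 0]_(a : A) (Ci * IV a) + (- (4 * PI * Ci) ^ n) * \big[Cplus/RtoC 0]_(a : A) (Ci * Ig a))%C.
    by rewrite Cbig_distr -big_split /=; apply: eq_bigr => a _; ring.
  by rewrite F1 Cpow_S /g; ring.
apply: Rle_trans (Cmod_triangle _ _) _.
rewrite (_ : K * box_error n.+1 T = INR #|A| * (line_const eps c0 * (K * box_error n T)) + (4 * PI) ^ n.+1 * (K * tail 0%N ^ n * tail T))%R; last first.
  by rewrite /=; ring.
apply: Rplus_le_compat; first exact: Cmod_big_le.
rewrite Cmod_mult Cmod_pow c4 Cmod_opp; apply: Rmult_le_compat_l; first by apply: pow_le; lra.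
exact: hS.
Qed.

(** The integrals do not depend on [T] while the error tends to 0, so the convergence of the box
    sums is a consequence of [box_estimate]. This is what gives [Clim_seq] its meaning here. *)
Theorem box_limit (n : nat) (f : ('I_n -> C) -> C) (K : R) :
  separately_hol eta f -> weighted_bound eta eps K f -> separately_even eta f ->
  \big[Cplus/RtoC 0]_(a : {ffun 'I_n -> A})
          iterated_line_integral (fun j => cc (a j)) (integrand H a f) =
  ((4 * PI * Ci) ^ n * Clim_seq (box f))%C.
Proof.
move=> hf hb he.
have P0 := PI_RGT_0.
have c4 : Cmod (4 * PI * Ci)%C = (4 * PI)%R.
  by rewrite !Cmod_mult Cmod_Ci !Cmod_R !Rabs_pos_eq; lra.
have n0 : ((4 * PI * Ci) ^ n)%C <> 0.
  by apply: Cpow_nz; apply/Cmod_gt_0; rewrite c4; lra.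
set X := \big[Cplus/_]_(_ : _) _.
have K0 := weighted_bound_ge0 eta0 hb.
suff h : clim (box f) (X / (4 * PI * Ci) ^ n)%C by rewrite (clim_Clim_seq h); field.
move=> e e0.
have m0 : 0 < Cmod ((4 * PI * Ci) ^ n) by apply/Cmod_gt_0.
have k1 : 0 < 1 + K by lra.
have [N HN] := box_error_lim n (Rdiv_lt_0_compat _ _ (Rmult_lt_0_compat _ _ e0 m0) k1).
exists N => T hT.
have /Rlt_div_r {}HN := HN T hT; have {}HN := HN k1.
have := box_estimate T hf hb he; rewrite -/X => B.
rewrite (_ : (box f T - X / (4 * PI * Ci) ^ n = - ((X - (4 * PI * Ci) ^ n * box f T) / (4 * PI * Ci) ^ n))%C); last by field.
rewrite Cmod_opp Cmod_div //; apply/Rlt_div_l => //.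
have := box_error_ge0 n T; lra.
Qed.

End Main.

HB.instance Definition _ := Monoid.isComLaw.Build C (RtoC 1) Cmult Cmult_assoc Cmult_comm Cmult_1_l.

(** * From joint to separate holomorphy, decay and evenness *)

Lemma holomorphic_first (n : nat) (f : ('I_n.+1 -> C) -> C) (x0 : C) (x : 'I_n -> C) :
  holomorphic_at f (vcons x0 x) -> hol (fun z => f (vcons z x)) x0.
Proof.
move=> [g hg]; exists (g ord0); apply/cderP => eps he.
have [r [r0 Hr]] := hg eps he; exists r; split=> // w hw.
have := Hr (vcons (w - x0)%C (fun=> RtoC 0)).
rewrite !big_ord_recl !vcons0 big1; last by move=> j _; rewrite vconsS Cmult_0_r.
rewrite (_ : \big[Rplus/0]_(i < n) _ = 0); last first.
  apply: (big_ind (fun x => x = 0)) => [//|a b -> ->|j _]; [ring|].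
  by rewrite vconsS Cmod_0.
rewrite (_ : (fun j => _ + _)%C = vcons w x); last first.
  apply: functional_extensionality => i; rewrite /vcons; case: unliftP => [j _|_]; ring.
rewrite Cplus_0_r Rplus_0_r; apply=> j.
by rewrite /vcons; case: unliftP => [i _|_] //; rewrite Cmod_0.
Qed.

Lemma holomorphic_slice (n : nat) (f : ('I_n.+1 -> C) -> C) (x0 : C) (x : 'I_n -> C) :
  holomorphic_at f (vcons x0 x) -> holomorphic_at (fun x => f (vcons x0 x)) x.
Proof.
move=> [g hg]; exists (fun j => g (lift ord0 j)) => eps he.
have [r [r0 Hr]] := hg eps he; exists r; split=> // h hh.
have := Hr (vcons (RtoC 0) h).
rewrite !big_ord_recl !vcons0 Cmod_0 Rplus_0_l Cmult_0_r Cplus_0_l.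
rewrite (_ : (fun j => _ + _)%C = vcons x0 (fun j => x j + h j)%C); last first.
  by apply: functional_extensionality => i; rewrite /vcons; case: unliftP => [j _|_] //; ring.
under eq_bigr do rewrite vconsS.
under [X in eps * X]eq_bigr do rewrite vconsS.
apply=> j; rewrite /vcons; case: unliftP => [i _|_] //.
by rewrite Cmod_0.
Qed.

Lemma holomorphic_separately (n : nat) (eta : R) (f : ('I_n -> C) -> C) :
  (forall x, in_strip eta x -> holomorphic_at f x) -> separately_hol eta f.
Proof.
elim: n f => [//|n ih] f h; split.
- by move=> x' hx' x0 hx0; apply: holomorphic_first; apply: h; apply: in_strip_vcons.
- by move=> x0 hx0; apply: ih => x' hx'; apply: holomorphic_slice; apply: h; apply: in_strip_vcons.
Qed.

Lemma decay_weighted_bound (n : nat) (eta eps K : R) (f : ('I_n -> C) -> C) :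
  (forall x : 'I_n -> C, in_strip eta x ->
    Cmod (f x) <= K * \big[Rmult/1%R]_(j < n) Rpower (1 + Rabs (Re (x j))) (- (1 + eps))) ->
  weighted_bound eta eps K f.
Proof.
elim: n K f => [|n ih] K f h /=.
  by apply: Rle_trans (h _ _) _; [case | rewrite big_ord0; lra].
move=> x0 hx0; apply: ih => x hx; apply: Rle_trans (h _ (in_strip_vcons hx0 hx)) _.
rewrite big_ord_recl vcons0 Rmult_assoc; right; congr (_ * (_ * _))%R.
by apply: eq_bigr => j _; rewrite vconsS.
Qed.

Lemma even_separately (n : nat) (eta : R) (f : ('I_n -> C) -> C) : even_in_each_variable eta f -> separately_even eta f.
Proof.
elim: n f => [//|n ih] f h; split.
- move=> x' hx' x0 hx0; rewrite -(h (fun i => i == ord0) _ (in_strip_vcons hx0 hx')); congr f.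
  apply: functional_extensionality => i; rewrite /vcons.
  by case: unliftP => [j ->|->]; rewrite ?eqxx //.
- move=> x0 hx0; apply: ih => e x hx.
  rewrite -(h (fun i => if unlift ord0 i is Some j then e j else false) _ (in_strip_vcons hx0 hx)); congr f.
  apply: functional_extensionality => i; rewrite /vcons.
  by case: unliftP => [j _|_].
Qed.

(** * The twisted L-functions *)

Lemma Cmod_Cexp (z : C) : Cmod (Cexp z) = exp (Re z).
Proof.
rewrite (_ : Cexp z = (RtoC (exp (Re z)) * expi (Im z))%C).
  rewrite Cmod_mult Cmod_expi Cmod_R Rmult_1_r Rabs_pos_eq //.
  exact: Rlt_le (exp_pos _).
by apply: C_ext; rewrite /Cexp /expi /Re /Im /=; ring.
Qed.

Lemma Cconj_inv (z : C) : Cconj (/ z) = (/ Cconj z)%C.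
Proof.
case: z => x y; apply: C_ext; rewrite /Re /Im /=.
- by rewrite (_ : - y * (- y * 1) = y * (y * 1))%R //; ring.
- by rewrite (_ : - y * (- y * 1) = y * (y * 1))%R; [rewrite /Rdiv; ring | ring].
Qed.

Lemma Cconj_Rcpow (x : R) (s : C) : Cconj (Rcpow x s) = Rcpow x (Cconj s).
Proof.
rewrite /Rcpow /Cexp; case: s => a b; apply: C_ext; rewrite /Re /Im /=.
- rewrite (_ : a * 0 + - b * ln x = - (a * 0 + b * ln x))%R; last ring.
  by rewrite cos_neg (_ : a * ln x - - b * 0 = a * ln x - b * 0)%R //; ring.
- rewrite (_ : a * 0 + - b * ln x = - (a * 0 + b * ln x))%R; last ring.
  by rewrite sin_neg (_ : a * ln x - - b * 0 = a * ln x - b * 0)%R; ring.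
Qed.

Lemma Clim_seq_conj (u : nat -> C) : Clim_seq (fun k => Cconj (u k)) = Cconj (Clim_seq u).
Proof.
apply: C_ext; rewrite /Clim_seq /Re /Im //=.
(* Infinite limits are covered too: [real] sends both infinities to 0, which negation fixes. *)
by rewrite Lim_seq_opp; case: (Lim_seq _) => [r| |] /=; ring.
Qed.

Lemma CGamma_conj (s : C) : CGamma (Cconj s) = Cconj (CGamma s).
Proof.
rewrite /CGamma -Clim_seq_conj; congr Clim_seq; apply: functional_extensionality => k.
have conjR r : Cconj (RtoC r) = RtoC r by apply: C_ext; rewrite /Re /Im /=; ring.
rewrite /Cdiv !Cmult_conj Cconj_inv conjR Cconj_Rcpow; congr (_ * / _)%C.
rewrite (big_morph Cconj Cmult_conj (conjR 1)); apply: eq_bigr => j _.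
by rewrite Cplus_conj conjR.
Qed.

(* The Gamma quotient is [conj G / G] here; it is [0] if [G = 0], hence an
   inequality. *)
Lemma psi_critical (N : nat) (omega : Z) (d : nat) (y : R) : even_twist N omega d ->
  Cmod (psi N omega d ((1 / 2)%R, y)) <= 1.
Proof.
move=> /andP [_ /Z.eqb_eq h]; rewrite /psi h.
set c := (2 * PI / _)%R.
have -> : (3 / 2 - ((1 / 2)%R, y))%C = Cconj (((1 / 2)%R, y) + 1 / 2)%C.
  by apply: C_ext; rewrite /Re /Im /=; field.
rewrite CGamma_conj.
set G := CGamma _.
rewrite !Cmod_mult Cmod_R Rabs_R1 Rmult_1_l /Rcpow Cmod_Cexp.
have -> : Re ((2 * ((1 / 2)%R, y) - 1) * RtoC (ln c))%C = 0 by rewrite /Re /=; field.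
rewrite exp_0 Rmult_1_l Cmod_conj.
case: (classic (G = 0)) => [->|G0]; first by rewrite Cmod_0; lra.
rewrite Cmod_inv // Rinv_r; first lra.
by move/Cmod_gt_0: G0; lra.
Qed.

Section Twist.
Variables (E : weierstrass) (N : nat) (omega : Z) (d : nat) (L : C -> C).
Hypothesis hN : prime N.
Hypothesis hL : is_twisted_L E N omega d L.
Hypothesis hd : even_twist N omega d.

Lemma functional_strip (s : C) : 0 < Re s < 1 -> L s = (psi N omega d s * L (1 - s))%C.
Proof.
move=> hs; apply: (twisted_L_functional_equation hL) => k e;
  by move: hs; rewrite e /=; have := pos_INR k; lra.
Qed.

(** [psi_critical] is only an inequality, but applied at [y] and at [- y] it gives both
    directions. *)
Lemma critical_symmetry (y : R) : Cmod (L ((1 / 2)%R, y)) = Cmod (L ((1 / 2)%R, (- y)%R)).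
Proof.
have main z : Cmod (L ((1 / 2)%R, z)) <= Cmod (L ((1 / 2)%R, (- z)%R)).
  rewrite functional_strip /=; last lra.
  have -> : (1 - ((1 / 2)%R, z))%C = ((1 / 2)%R, (- z)%R) by apply: C_ext; rewrite /Re /Im /=; field.
  rewrite Cmod_mult; have := psi_critical z hd; have := Cmod_ge_0 (L ((1 / 2)%R, (- z)%R)); nra.
by apply: Rle_antisym => //; have := main (- y)%R; rewrite Ropp_involutive.
Qed.

(** Near [s] neither [L w] nor [L (1 - w)] vanishes, so [psi] agrees there with their quotient. Its
    differentiability and logarithmic derivative are thus read off from [L]. *)
Lemma logderiv_psi (delta : R) (s : C) : riemann_hypothesis L -> 0 < delta < 1 / 2 ->
  Re s = (1 / 2 - delta)%R ->
  logderiv (psi N omega d) s = (logderiv L s + logderiv L (1 - s))%C.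
Proof.
move=> rh hdel hs.
have hE := twisted_L_entire hL.
(* Within [r] of [s] the points stay inside the critical strip and off the critical line, so [rh]
   excludes zeros. *)
pose r := Rmin delta (1 / 2 - delta).
have r0 : 0 < r by apply: Rmin_glb_lt; lra.
have r1 : r <= delta by apply: Rmin_l.
have r2 : r <= 1 / 2 - delta by apply: Rmin_r.
have near w : Cmod (w - s) < r -> 0 < Re w < 1 /\ Re w <> (1 / 2)%R.
  move=> hw; have := Rle_lt_trans _ _ _ (re_le_Cmod (w - s)) hw.
  by rewrite /Re /= -/(Re w) -/(Re s) hs => /Rabs_def2 ?; lra.
have n0 w : 0 < Re w < 1 -> Re w <> (1 / 2)%R -> L w <> 0.
  by move=> h1 h2 /(rh w h1).
have n1 w : 0 < Re w < 1 -> Re w <> (1 / 2)%R -> L (1 - w)%C <> 0.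
  by move=> h1 h2; apply: n0; rewrite /Re /= -/(Re w); lra.
have ss : Cmod (s - s) < r by rewrite (_ : (s - s = 0)%C) ?Cmod_0 //; ring.
have [s1 s2] := near s ss.
have eq w : Cmod (w - s) < r -> (L w / L (1 - w) = psi N omega d w)%C.
  by move=> /near [h1 h2]; rewrite functional_strip //; field; apply: n1.
have d1 := hol_der (entire_hol s hE).
have d2 := cder_comp (hol_der (entire_hol (1 - s)%C hE)) (cder_minus (cder_const 1 s) (cder_id s)).
have d3 := @cder_div L (fun w => L (1 - w))%C s _ _ (n1 s s1 s2) d1 d2.
have d4 := cder_ext (ex_intro _ r (conj r0 eq)) d3.
rewrite /logderiv (is_C_derive_unique _ _ _ d4) -(eq s ss).
by field; split; [apply: n1 | apply: n0].
Qed.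

Lemma kronecker_prime_le1 (a : Z) (p : nat) : Rabs (IZR (kronecker_prime a p)) <= 1.
Proof.
rewrite /kronecker_prime.
by do ?case: ifP => _; rewrite ?Rabs_R0 ?Rabs_R1 ?Rabs_Ropp ?Rabs_R1; try lra;
  rewrite /Rabs; case: Rcase_abs; lra.
Qed.

Lemma kronecker_at_prime (a : Z) (p : nat) : prime p ->
  kronecker a (Z.of_nat p) = kronecker_prime a p.
Proof.
move=> hp; rewrite /kronecker.
have p0 := prime_gt0 hp.
case: Z.eqb_spec => [e|_]; first by move: p0; rewrite (_ : p = 0%N) //; lia.
have -> : (Z.of_nat p <? 0)%Z = false by apply/Z.ltb_ge; lia.
rewrite andFb Z.mul_1_l Zabs2Nat.id prime_decompE primes_prime // big_map.
rewrite big_cons big_nil /= logn_prime // eqxx.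
by rewrite Z.pow_1_r Z.mul_1_r.
Qed.

(** If [N] divided [d] the Kronecker symbol would vanish, whereas for an even twist its product with
    [omega] is 1. *)
Lemma even_twist_coprime : coprime d N.
Proof.
rewrite coprime_sym prime_coprime //; apply/negP => hdvd.
move: hd => /andP [_ /Z.eqb_eq]; rewrite /kronecker.
have p0 := prime_gt0 hN.
case: Z.eqb_spec => [e|_]; first by exfalso; move: p0; rewrite (_ : N = 0%N) //; lia.
have -> : Z.abs_nat (- Z.of_nat N) = N by lia.
rewrite prime_decompE primes_prime // big_map big_cons big_nil /= logn_prime // eqxx.
rewrite (_ : kronecker_prime (Z.of_nat d) N = 0%Z); first by rewrite Z.pow_1_r Z.mul_0_l Z.mul_0_r.
have [k ek] := dvdnP hdvd.
rewrite /kronecker_prime; case: eqP => [e2|_].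
  rewrite ek e2 (_ : Z.even _ = true) //; apply/Z.even_spec; exists (Z.of_nat k).
  by rewrite -multE Nat2Z.inj_mul; lia.
rewrite (_ : (_ mod _ =? 0)%Z = true) //; apply/Z.eqb_eq.
by rewrite ek -multE Nat2Z.inj_mul; apply: Z.mod_mul; move/ltP: p0; lia.
Qed.

Lemma frobenius_trace_bound (p : nat) : Rabs (IZR (frobenius_trace E p)) <= INR p ^ 2 \/ p = 0%N.
Proof.
case: p => [|p]; [by right | left].
rewrite /frobenius_trace minus_IZR -!INR_IZR_INZ.
have h : INR (affine_points E p.+1) <= INR p.+1 ^ 2.
  have -> : (INR p.+1 ^ 2 = INR (p.+1 * p.+1))%R by rewrite -multE mult_INR; ring.
  apply: le_INR; apply/leP.
  by apply: leq_trans (max_card _) _; rewrite card_prod card_ord.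
have p1 : 1 <= INR p.+1 by rewrite S_INR; have := pos_INR p; lra.
have a0 := pos_INR (affine_points E p.+1).
by apply/Rabs_le; nra.
Qed.

(** With [q = / p], the trivial bound for the trace and [|u| = q ^ 5] make both terms after the 1 at
    most [q ^ 3 <= q ^ 2 / 2]; the claim is then [1 / (1 + q ^ 2) >= 1 - q ^ 2]. *)
Lemma euler_factor_bound (p : nat) (y : R) : prime p ->
  1 - / INR p ^ 2 <= Cmod (/ euler_poly E N d p (5, y)).
Proof.
move=> hp.
have p2 : 2 <= INR p by apply: (le_INR 2); apply/leP; apply: prime_gt1.
rewrite /euler_poly kronecker_at_prime //.
set chi := RtoC (IZR (kronecker_prime _ _)); set lam := RtoC (_ / _); set u := Rcpow _ _; set v := (if _ then _ else _)%C.
have c1 : Cmod chi <= 1 by rewrite Cmod_R; apply: kronecker_prime_le1.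
have l2 : Cmod lam <= INR p ^ 2.
  have s1 : 1 <= sqrt (INR p) by rewrite -sqrt_1; apply: sqrt_le_1_alt; lra.
  rewrite Cmod_R Rabs_div; last lra.
  rewrite (Rabs_pos_eq (sqrt _)); last lra.
  apply/Rle_div_l; first lra.
  have [h|e] := frobenius_trace_bound p; last by move: hp; rewrite e.
  by have := Rabs_pos (IZR (frobenius_trace E p)); nra.
have q0 : 0 < / INR p by apply: Rinv_0_lt_compat; lra.
have u5 : Cmod u = (/ INR p) ^ 5.
  rewrite /u /Rcpow Cmod_Cexp.
  have -> : Re (- (5, y) * RtoC (ln (INR p)))%C = (INR 5 * ln (/ INR p))%R.
    by rewrite ln_Rinv; [rewrite /Re /=; ring | lra].
  by rewrite -ln_pow_nat // exp_ln //; apply: pow_lt.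
set q := / INR p in q0 u5.
have pq : (INR p * q = 1)%R by rewrite /q Rinv_r; lra.
have q2 : q <= / 2 by apply: Rinv_le_contravar; lra.
have hv : Cmod v <= q ^ 3.
  rewrite /v; case: ifP => _; first by rewrite Cmod_0; apply: pow_le; lra.
  rewrite Cmod_mult !Cmod_pow u5.
  have h1 : Cmod chi ^ 2 <= 1 by rewrite -(pow1 2); apply: pow_incr; split; [apply: Cmod_ge_0 | done].
  have h2 : (q ^ 5) ^ 2 <= q ^ 3.
    rewrite (_ : (q ^ 5) ^ 2 = q ^ 3 * q ^ 7)%R; last ring.
    have : q ^ 7 <= 1 by rewrite -(pow1 7); apply: pow_incr; lra.
    by have := pow_lt q 3 q0; nra.
  have h3 : 0 <= (q ^ 5) ^ 2 by apply: pow_le; apply: pow_le; lra.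
  by have := Cmod_ge_0 chi; nra.
have hu : Cmod (lam * chi * u)%C <= q ^ 3.
  rewrite !Cmod_mult u5.
  have q5 : 0 <= q ^ 5 by apply: pow_le; lra.
  apply: (Rle_trans _ (INR p ^ 2 * 1 * q ^ 5)).
    apply: Rmult_le_compat_r => //; apply: Rmult_le_compat => //; exact: Cmod_ge_0.
  right; rewrite (_ : INR p ^ 2 * 1 * q ^ 5 = (INR p * q) ^ 2 * q ^ 3)%R; last ring.
  by rewrite pq; ring.
have hx : Cmod (- (lam * chi * u) + v)%C <= q ^ 2.
  apply: Rle_trans (Cmod_triangle _ _) _; rewrite Cmod_opp.
  have : q ^ 3 <= / 2 * q ^ 2.
    rewrite (_ : q ^ 3 = q * q ^ 2)%R; last ring.
    by apply: Rmult_le_compat_r => //; apply: pow_le; lra.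
  lra.
rewrite (_ : (1 - lam * chi * u + v = 1 + (- (lam * chi * u) + v))%C); last ring.
set x := (- (lam * chi * u) + v)%C in hx *.
have q22 : q ^ 2 <= / 4 by rewrite /=; nra.
have e1 : Cmod (1 + x) <= 1 + q ^ 2.
  by apply: Rle_trans (Cmod_triangle _ _) _; rewrite Cmod_1; lra.
have e2 : 1 - q ^ 2 <= Cmod (1 + x).
  have := Cmod_triangle (1 + x) (- x); rewrite Cmod_opp (_ : (1 + x + - x = 1)%C); last ring.
  by rewrite Cmod_1; lra.
rewrite Cmod_inv; last by apply/Cmod_gt_0; lra.
rewrite -pow_inv -/q.
apply: (Rmult_le_reg_r (Cmod (1 + x))); first lra.
rewrite Rinv_l; last lra.
have : 0 <= q ^ 2 by apply: pow_le; lra.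
nra.
Qed.

(** Inserting a factor [1 - 1 / j ^ 2] at the composite [j] as well only lowers the bound, and the
    product over all [j] from 2 to [k + 1] telescopes to [(k + 2) / (2 (k + 1))], which exceeds
    [1 / 2]. *)
Lemma euler_lower (y : R) : 1 / 2 <= Cmod (L (5, y)).
Proof.
pose P k := \big[Cmult/RtoC 1]_(0 <= p < k | prime p) (/ euler_poly E N d p (5, y))%C.
have PS k : P k.+1 = (P k * (if prime k then / euler_poly E N d k (5, y) else 1))%C.
  by rewrite /P big_mkcond big_nat_recr //= -big_mkcond.
have low k : INR k.+2 / (2 * INR k.+1) <= Cmod (P k.+2).
  elim: k => [|k ih].
    rewrite !PS /P big_geq //= !Cmult_1_l Cmod_1; lra.
  rewrite PS Cmod_mult.
  have k1 : 1 <= INR k.+1 by rewrite S_INR; have := pos_INR k; lra.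
  have s2 : INR k.+2 = (INR k.+1 + 1)%R by rewrite S_INR.
  have s3 : INR k.+3 = (INR k.+1 + 2)%R by rewrite S_INR s2; ring.
  set m := INR k.+1 in k1 s2 s3 ih.
  have key : INR k.+3 / (2 * INR k.+2) <= INR k.+2 / (2 * m) * (1 - / INR k.+2 ^ 2).
    by right; rewrite s2 s3; field; lra.
  apply: Rle_trans key _; apply: Rmult_le_compat => //.
  - by apply: Rdiv_le_0_compat; lra.
  - have : / INR k.+2 ^ 2 <= / 1; last lra.
    by apply: Rinv_le_contravar; [lra | rewrite s2 /=; nra].
  - case: ifP => hp; first exact: euler_factor_bound.
    have : 0 < / INR k.+2 ^ 2 by apply: Rinv_0_lt_compat; apply: pow_lt; lra.
    by rewrite Cmod_1; lra.
have low2 k : (2 <= k)%N -> 1 / 2 <= Cmod (P k).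
  case: k => [|[|k]] // _; apply: Rle_trans (low k).
  have k1 : 1 <= INR k.+1 by rewrite S_INR; have := pos_INR k; lra.
  have s2 := S_INR k.+1; move: (INR k.+1) (INR k.+2) k1 s2 => u v k1 s2.
  have [h _] := Rle_div_r (1 / 2) v (2 * u) ltac:(lra); apply: h; lra.
have lim := twisted_L_euler hL (s := (5, y)) ltac:(rewrite /=; lra).
apply: le_epsilon => e he.
have e2 : 0 < e / 2 by lra.
(* Balls of the uniform structure on [C] are products of intervals, hence the radius [e / 2]. *)
have hloc : locally (L (5, y)) (fun w : C => Cmod (w - L (5, y)) < e).
  exists (mkposreal _ e2) => w [b1 b2].
  apply: Rle_lt_trans (Cmod_le_abs _) _.
  move: b1 b2; rewrite /ball /= /AbsRing_ball /abs /minus /plus /opp /= /Re /Im /=; lra.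
have [M HM] := lim _ hloc.
have {}HM := HM (M + 2)%N ltac:(apply/leP; apply: leq_addr).
have := low2 (M + 2)%N (leq_addl _ _).
have := Cmod_triangle_inv (P (M + 2)%N) (L (5, y)); rewrite -/(P _) in HM; lra.
Qed.

Lemma twisted_L_like : L_like L.
Proof.
split; [exact: twisted_L_entire hL | exact: twisted_L_growth hL | exact: euler_lower].
Qed.

End Twist.

(** * The sum over the partitions *)

Definition side (delta : R) (a : 'I_3) : R := if a == 0%N :> nat then delta else (- delta)%R.

(* The factor contributed by a variable in K, L, M respectively, the last one
   with its share of the sign [(-1)^|M|]. *)
Definition factor (N : nat) (omega : Z) (d : nat) (L : C -> C) (a : 'I_3) (z : C) : C :=
  match nat_of_ord a with
  | 0 => logderiv L (1 / 2 + z)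
  | 1 => logderiv L (1 / 2 + - z)
  | _ => - (1) * logderiv (psi N omega d) (1 / 2 + z)
  end%C.

Lemma twist_formula (E : weierstrass) (N : nat) (omega : Z) (d : nat) (L : C -> C)
    (gamma : nat -> R) (delta eta eps K : R) (n : nat) (f : ('I_n -> C) -> C) :
  prime N -> is_twisted_L E N omega d L -> even_twist N omega d ->
  riemann_hypothesis L -> zero_heights L gamma ->
  0 < delta < 1 / 2 -> delta < eta -> 0 < eps ->
  separately_hol eta f -> weighted_bound eta eps K f -> separately_even eta f ->
  (forall a : 'I_n -> 'I_3, iter_ok (fun j => side delta (a j)) (integrand (factor N omega d L) a f)) /\
  \big[Cplus/RtoC 0]_(a : {ffun 'I_n -> 'I_3})
    iterated_line_integral (fun j => side delta (a j)) (integrand (factor N omega d L) a f) =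
  ((4 * PI * Ci) ^ n * Clim_seq (box gamma f))%C.
Proof.
move=> hN tw hd rh hg hdel he eps0 hf hb hev.
have eta0 : 0 < eta by lra.
have hF := twisted_L_like tw.
have [c0 [c00 Hc]] := line_decays hF rh hdel eps0.
have [cP bP] := Hc delta ltac:(rewrite Rabs_pos_eq; lra).
have [cM bM] := Hc (- delta)%R ltac:(rewrite Rabs_Ropp Rabs_pos_eq; lra).
have hcc a : Rabs (side delta a) < eta.
  by rewrite /side; case: ifP => _; rewrite ?Rabs_Ropp Rabs_pos_eq; lra.
have s0 y : (1 / 2 + (delta, y) = ((1 / 2 + delta)%R, y))%C by rewrite half_plus.
have s1 y : (1 / 2 + - ((- delta)%R, y) = ((1 / 2 + delta)%R, (- y)%R))%C.
  by rewrite -half_plus; congr Cplus; apply: C_ext; rewrite /Re /Im /=; ring.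
have s2 y : (1 / 2 + ((- delta)%R, y) = ((1 / 2 + - delta)%R, y))%C by rewrite half_plus.
have psiE y : logderiv (psi N omega d) (1 / 2 + ((- delta)%R, y))%C =
   (logderiv L ((1 / 2 + - delta)%R, y) + logderiv L ((1 / 2 + delta)%R, (- y)%R))%C.
  rewrite s2 (logderiv_psi tw rh hdel) //; congr (_ + logderiv L _)%C.
  by apply: C_ext; rewrite /Re /Im /=; field.
have cR : forall y, ccont (fun y => logderiv L ((1 / 2 + delta)%R, (- y)%R)) y.
  exact: (ccont_reflect cP).
have bR y : Cmod (logderiv L ((1 / 2 + delta)%R, (- y)%R)) <= c0 * weight (eps / 2) y.
  by rewrite -(weight_opp _ y).
have Hcont (a : 'I_3) y : ccont (fun y => factor N omega d L a (side delta a, y)) y.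
  case: a => [[|[|[|m]]] hm] //; rewrite /factor /side /=.
  - by rewrite (functional_extensionality _ _ (fun y => f_equal (logderiv L) (s0 y))).
  - by rewrite (functional_extensionality _ _ (fun y => f_equal (logderiv L) (s1 y))).
  - rewrite (functional_extensionality _ _ (fun y => f_equal (Cmult (- (1))) (psiE y))).
    by apply: ccont_mult; [apply: ccont_const | apply: ccont_plus].
(* The factor 2 is for the third kind, where [psi' / psi] is a sum of two values of [L' / L]. *)
have Hbound (a : 'I_3) y : Cmod (factor N omega d L a (side delta a, y)) <= 2 * c0 * weight (eps / 2) y.
  have := bP y; have := bM y; have := bR y; have := weight_gt0 (eps / 2) y => p0 h1 h2 h3.
  case: a => [[|[|[|m]]] hm] //; rewrite /factor /side /=.
  - by rewrite s0; nra.
  - by rewrite s1; nra.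
  - rewrite psiE Cmod_mult Cmod_opp Cmod_1 Rmult_1_l.
    by apply: Rle_trans (Cmod_triangle _ _) _; lra.
have c20 : 0 < 2 * c0 by lra.
split=> [a|]; first by have [] := iter_integrand eta0 eps0 c20 hcc Hcont Hbound a hf hb.
have [W hW] := weights_bounded hF hg eps0.
have [tail [t1 [t2 [t3 t4]]]] := summable_tails (fun t => Rlt_le _ _ (weight_gt0 _ _)) hW.
apply: (box_limit eta0 eps0 c20 hcc Hcont Hbound t1 t2 t3 t4 _ hf hb hev).
move=> g K' S I gs ge hI hS.
(* The second and third kinds share the line [Re z = - delta], and by [psiE] their factors add up to
   minus [L' / L] at [1 / 2 + z]; together they form the left-hand integral of [one_variable]. *)
have [iP iM] : improper (fun y => logderiv L ((1 / 2 + delta)%R, y) * g (Ci * (delta, y)))%C (I ord0) /\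
  improper (fun y => logderiv L ((1 / 2 - delta)%R, y) * g (Ci * ((- delta)%R, y)))%C
    (- (1) * (I (lift ord0 ord0) + I (lift ord0 (lift ord0 ord0))))%C.
  split.
    have := hI ord0; rewrite /factor /side /=.
    by congr (improper _ _); apply: functional_extensionality => y; rewrite s0.
  have := improper_scal (- (1)) (improper_plus (hI (lift ord0 ord0)) (hI (lift ord0 (lift ord0 ord0)))).
  congr (improper _ _); apply: functional_extensionality => y; rewrite /factor /side /=.
  by rewrite psiE s1 /Rminus; ring.
have := one_variable hF rh (critical_symmetry tw hd) hg hdel he eps0 gs ge iP iM hS.
by rewrite !big_ord_recl big_ord0 => <-; ring.
Qed.

(** Ordered partitions into three possibly empty blocks are colourings of the indices by ['I_3].
    Colourings recurse on the first variable, as [box_limit] requires. *)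
Lemma big_partition3 (n : nat) (F : {set 'I_n} -> {set 'I_n} -> {set 'I_n} -> C) :
  \big[Cplus/RtoC 0]_(K : {set 'I_n})
  \big[Cplus/RtoC 0]_(L' : {set 'I_n})
  \big[Cplus/RtoC 0]_(M : {set 'I_n} |
      [&& [disjoint K & L'], [disjoint K & M], [disjoint L' & M]
        & K :|: L' :|: M == [set: 'I_n]]) F K L' M =
  \big[Cplus/RtoC 0]_(a : {ffun 'I_n -> 'I_3})
    F [set j | a j == 0%N :> nat] [set j | a j == 1%N :> nat] [set j | a j == 2%N :> nat].
Proof.
rewrite pair_big_dep pair_big_dep /=.
pose h (a : {ffun 'I_n -> 'I_3}) := ([set j | a j == 0%N :> nat], [set j | a j == 1%N :> nat], [set j | a j == 2%N :> nat]).
pose h' (p : {set 'I_n} * {set 'I_n} * {set 'I_n}) : {ffun 'I_n -> 'I_3} :=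
  [ffun j => if j \in p.1.1 then inord 0 else if j \in p.1.2 then inord 1 else inord 2].
rewrite (reindex_onto h h') /=; last first.
  move=> [[K L'] M] /= /and4P [dKL dKM dLM /eqP cov].
  have d1 j : (j \in K) && (j \in L') = false.
    by apply/negP => /andP [x]; rewrite (disjointFr dKL x).
  have d2 j : (j \in K) && (j \in M) = false.
    by apply/negP => /andP [x]; rewrite (disjointFr dKM x).
  have d3 j : (j \in L') && (j \in M) = false.
    by apply/negP => /andP [x]; rewrite (disjointFr dLM x).
  have c j : [|| j \in K, j \in L' | j \in M].
    by have := in_setT j; rewrite -cov !inE -orbA.
  congr (_, _, _); apply/setP => j; rewrite inE ffunE /=; move: (d1 j) (d2 j) (d3 j) (c j);
    by case: (j \in K); case: (j \in L'); case: (j \in M) => //=; rewrite ?inordK.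
have lt3 (a : {ffun 'I_n -> 'I_3}) j : [|| a j == 0%N :> nat, a j == 1%N :> nat | a j == 2%N :> nat].
  by case: (a j) => [[|[|[|m]]] hm].
have dis (a : {ffun 'I_n -> 'I_3}) (u v : nat) : u != v ->
    [disjoint [set j | a j == u :> nat] & [set j | a j == v :> nat]].
  move=> uv; rewrite -setI_eq0; apply/eqP/setP => j; rewrite !inE.
  by apply/negP => /andP [/eqP -> e]; rewrite e in uv.
apply: eq_bigl => a; rewrite !dis //=; apply/andP; split.
  by apply/eqP/setP => j; rewrite !inE -orbA; apply: lt3.
apply/eqP/ffunP => j; rewrite ffunE !inE /=; apply: val_inj.
by case: (a j) => [[|[|[|m]]] hm] //=; rewrite inordK.
Qed.

Lemma big_minus1 (n : nat) (M : {set 'I_n}) (x : 'I_n -> C) :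
  \big[Cmult/RtoC 1]_(j in M) (- (1) * x j)%C = ((- (1)) ^ #|M| * \big[Cmult/RtoC 1]_(j in M) x j)%C.
Proof.
rewrite big_split /= big_const; congr Cmult.
by elim: #|M| => [//|k ih]; rewrite iterS ih.
Qed.

Lemma integrand_partition (N : nat) (omega : Z) (d : nat) (L : C -> C) (n : nat)
    (f : ('I_n -> C) -> C) (a : {ffun 'I_n -> 'I_3}) (z : 'I_n -> C) :
  let K := [set j | a j == 0%N :> nat] in
  let L' := [set j | a j == 1%N :> nat] in
  let M := [set j | a j == 2%N :> nat] in
  ((- (1)) ^ #|M| *
    (\big[Cmult/RtoC 1]_(alpha <- [seq z k | k <- enum K] ++ [seq (- z l)%C | l <- enum L'])
       logderiv L (1 / 2 + alpha) *
     \big[Cmult/RtoC 1]_(beta <- [seq z m | m <- enum M]) logderiv (psi N omega d) (1 / 2 + beta)) *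
   f (fun j => Ci * z j))%C = integrand (factor N omega d L) a f z.
Proof.
move=> K L' M; rewrite /integrand; congr Cmult.
(* The sign is distributed over the factors indexed by [M], as in the last case of [factor]; then
   the product over all indices is split by colour. *)
rewrite big_cat !big_map !big_enum /= (Cmult_comm (_ ^ _)) -!Cmult_assoc (Cmult_comm _ (_ ^ _)) -big_minus1.
rewrite [RHS](bigID [in K]) /=; apply: (f_equal2 Cmult).
  by apply: eq_bigr => j; rewrite inE /factor => /eqP ->.
rewrite [RHS](bigID [in L']) /=; apply: (f_equal2 Cmult).
- apply: eq_big => [j|j]; rewrite !inE; first by case: (a j) => [[|[|[|m]]] hm].
  by rewrite /factor => /eqP ->.
- apply: eq_big => [j|j]; rewrite !inE; first by case: (a j) => [[|[|[|m]]] hm].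
  by rewrite /factor => /eqP ->.
Qed.

Lemma sum_family_scal (N : nat) (omega : Z) (X : R) (c e : C) (F : nat -> C) :
  (c * sum_family N omega X F * e)%C = sum_family N omega X (fun d => c * F d * e)%C.
Proof.
rewrite /sum_family (big_morph (fun x => c * x * e)%C (id1 := RtoC 0) (op1 := Cplus)) //; first by move=> x y; ring.
by ring.
Qed.

Theorem theorem5p9
  (E : weierstrass) (N : nat) (hN : has_prime_conductor E N)
  (omega : Z) (homega : omega = 1%Z \/ omega = (-1)%Z)
  (L : nat -> C -> C)
  (hL : forall d : nat, (0 < d)%N -> fundamental_discriminant (Z.of_nat d) ->
          coprime d N -> is_twisted_L E N omega d (L d))
  (hRH : forall d : nat, (0 < d)%N -> even_twist N omega d ->
          riemann_hypothesis (L d))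
  (gamma : nat -> nat -> R)
  (hgamma : forall d : nat, (0 < d)%N -> even_twist N omega d ->
          zero_heights (L d) (gamma d))
  (X : R) (delta eta : R)
  (hdelta : (0 < delta < 1 / 2)%R) (heta : (delta < eta)%R)
  (n : nat) (f : ('I_n -> C) -> C)
  (f_holo : forall x, in_strip eta x -> holomorphic_at f x)
  (f_even : even_in_each_variable eta f)
  (f_decay : integrable_decay eta f) :
  (2 ^ n * (2 * PI * Ci) ^ n * S_E N omega X gamma f)%C =
  \big[Cplus/RtoC 0]_(K : {set 'I_n})
  \big[Cplus/RtoC 0]_(L' : {set 'I_n})
  \big[Cplus/RtoC 0]_(M : {set 'I_n} |
      [&& [disjoint K & L'], [disjoint K & M], [disjoint L' & M]
        & K :|: L' :|: M == [set: 'I_n]])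
    iterated_line_integral
      (fun j => if j \in K then delta else (- delta)%R)
      (fun z =>
         ((- (1)) ^ #|M| *
          J_E N omega X L
            ([seq z k | k <- enum K] ++ [seq (- z l)%C | l <- enum L'])
            [seq z m | m <- enum M] *
          f (fun j => (Ci * z j)%C))%C).
Proof.
have [K [eps [eps0 hK]]] := f_decay.
have pN : prime N by case: hN.
have hf := holomorphic_separately f_holo.
have hb := decay_weighted_bound hK.
have he := even_separately f_even.
have tw d : (0 < d)%N && even_twist N omega d ->
   (forall a : 'I_n -> 'I_3, iter_ok (fun j => side delta (a j)) (integrand (factor N omega d (L d)) a f)) /\
   \big[Cplus/RtoC 0]_(a : {ffun 'I_n -> 'I_3})
     iterated_line_integral (fun j => side delta (a j)) (integrand (factor N omega d (L d)) a f) =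
   ((4 * PI * Ci) ^ n * Clim_seq (box (gamma d) f))%C.
  move=> /andP [d0 hd].
  have fd : fundamental_discriminant (Z.of_nat d) by case/andP: hd.
  apply: (twist_formula pN (hL d d0 fd (even_twist_coprime pN hd)) hd (hRH d d0 hd) (hgamma d d0 hd) hdelta heta eps0 hf hb he).
rewrite big_partition3.
pose m := Z.to_nat (up X).
(* The guard [0 < d], implied by the range, joins the summation predicate so that [tw] applies to
   each term. *)
have family F : sum_family N omega X F = \big[Cplus/RtoC 0]_(d <- index_iota 1 m | (0 < d)%N && even_twist N omega d) F d.
  rewrite /sum_family big_nat_cond [RHS]big_nat_cond; apply: eq_bigl => d.
  by case: (0 < d)%N.
have term (a : {ffun 'I_n -> 'I_3}) :
  iterated_line_integral (fun j => if j \in [set j | a j == 0%N :> nat] then delta else (- delta)%R)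
    (fun z => ((- (1)) ^ #|[set j | a j == 2%N :> nat]| *
          J_E N omega X L
            ([seq z k | k <- enum [set j | a j == 0%N :> nat]] ++ [seq (- z l)%C | l <- enum [set j | a j == 1%N :> nat]])
            [seq z m | m <- enum [set j | a j == 2%N :> nat]] *
          f (fun j => (Ci * z j)%C))%C) =
  \big[Cplus/RtoC 0]_(d <- index_iota 1 m | (0 < d)%N && even_twist N omega d)
     iterated_line_integral (fun j => side delta (a j)) (integrand (factor N omega d (L d)) a f).
  (* The sum over [d] leaves the iterated integral by linearity, which rests on the convergence of
     every integral involved, the first half of [tw]. *)
  rewrite -(proj2 (iter_sum (index_iota 1 m) (fun d hd => proj1 (tw d hd) a))).
  congr iterated_line_integral; apply: functional_extensionality.
  - by move=> j; rewrite inE.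
  - move=> z; rewrite /J_E sum_family_scal family; apply: eq_bigr => d _.
    exact: integrand_partition.
rewrite (eq_bigr _ (fun a _ => term a)) exchange_big /= /S_E family.
rewrite (big_morph (Cmult (2 ^ n * (2 * PI * Ci) ^ n)%C) (Cmult_plus_distr_l _) (Cmult_0_r _)).
apply: eq_bigr => d /tw [_ ->].
by rewrite -Cpow_mult_l; congr (_ ^ _ * _)%C; ring.
Qed.
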